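(* Let $\{\mathbf{w}_j\}_{j=1}^\infty$ be a sequence of weights in $\mathbb{R}^d$, let $\{\boldsymbol\theta^j\}_{j=1}^\infty$ be a sequence of (constant) vectors in $\mathbb{R}^d$, and let $\{f_j\}_{j=1}^\infty$ be $C^1$-diffeomorphisms of $\mathbb{R}^d$. Then $$\bigcap_{j=1}^\infty f_j\big(\mathbf{Bad}_{\boldsymbol\theta^j}(\mathbf{w}_j)\big)$$ is hyperplane absolute winning. In particular, for every Ahlfors regular absolutely decaying measure $\mu$ on $\mathbb{R}^d$, $$\dim\Big(\bigcap_{j=1}^\infty f_j\big(\mathbf{Bad}_{\boldsymbol\theta^j}(\mathbf{w}_j)\big)\cap\operatorname{supp}\mu\Big)=\dim(\operatorname{supp}\mu),$$ where $\dim$ denotes Hausdorff dimension.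
   Context: A weight in $\mathbb{R}^d$ is a vector $\mathbf{w}=(w_1,\dots,w_d)$ with $w_i\ge 0$ and $\sum_i w_i=1$. $|x|_{\mathbb{Z}}$ is the distance from $x\in\mathbb{R}$ to the nearest integer. For $\boldsymbol\theta=(\theta_i)\in\mathbb{R}^d$, $$\mathbf{Bad}_{\boldsymbol\theta}(\mathbf{w}):=\Big\{\mathbf{x}\in\mathbb{R}^d:\ \liminf_{q\in\mathbb{Z}\setminus\{0\},\,|q|\to\infty}\ \max_{1\le i\le d}|qx_i-\theta_i|_{\mathbb{Z}}^{1/w_i}\,|q|>0\Big\},$$ with the convention $|x|_{\mathbb{Z}}^{1/w_i}:=0$ if $w_i=0$. Hyperplane absolute game on $\mathbb{R}^d$: Bob fixes $0<\beta<1/3$ and chooses a closed ball $B_0$ of radius $r_0>0$. At stage $n\ge 0$, given $B_n$ of radius $r_n$, Alice chooses an affine hyperplane $H_n$ and $0<\varepsilon_n\le\beta r_n$, and Bob chooses a closed ball $B_{n+1}\subset B_n$ of radius $r_{n+1}\ge\beta r_n$ disjoint from the $\varepsilon_n$-neighbourhood of $H_n$. $S\subset\mathbb{R}^d$ is hyperplane absolute winning if for every $0<\beta<1/3$ Alice has a strategy guaranteeing $\bigcap_n B_n\cap S\ne\emptyset$. A Borel measure $\mu$ on $\mathbb{R}^d$ is $\alpha$-Ahlfors regular if there are $A,r_0>0$ with $A^{-1}\rho^\alpha\le\mu(B(\mathbf{x},\rho))\le A\rho^\alpha$ for all $\mathbf{x}\in\operatorname{supp}\mu$, $0<\rho\le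 r_0$; it is Ahlfors regular if this holds for some $\alpha$. It is absolutely decaying if there are $D,\delta,r_0>0$ such that for all $\mathbf{x}\in\operatorname{supp}\mu$, $0<r\le r_0$, every affine hyperplane $H\subset\mathbb{R}^d$ and $r'>0$, $\mu(B(H,r')\cap B(\mathbf{x},r))\le D(r'/r)^\delta\mu(B(\mathbf{x},r))$, where $B(H,r')$ is the closed $r'$-neighbourhood of $H$ and $B(\mathbf{x},r)$ the closed ball. *)

(* Defs.v *)
From HB Require Import structures.
From mathcomp Require Import all_boot all_order all_algebra.
From mathcomp Require Import all_classical all_reals all_analysis.
Set Implicit Arguments.
Unset Strict Implicit.
Unset Printing Implicit Defensive.
Import Order.TTheory GRing.Theory Num.Theory.
Import numFieldNormedType.Exports.

Local Open Scope classical_set_scope.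
Local Open Scope ring_scope.

Section EuclideanGeometry.
Context {R : realType} {d : nat}.
Implicit Types (x c : 'rV[R]_d) (A H : set 'rV[R]_d).

(* The library norm on 'rV[R]_d is the sup norm; balls, neighbourhoods and
   diameters below are Euclidean. *)
Definition enorm x : R := Num.sqrt (\sum_(i < d) x 0 i ^+ 2).

Definition eball c (r : R) : set 'rV[R]_d := [set x | enorm (x - c) <= r].

Definition edist_set A x : R := inf [set enorm (x - y) | y in A].

Definition open_nbhd A (e : R) : set 'rV[R]_d := [set x | edist_set A x < e].

Definition closed_nbhd A (e : R) : set 'rV[R]_d := [set x | edist_set A x <= e].

Definition affine_hyperplane H : Prop :=
  exists (a : 'rV[R]_d) (b : R),
    a != 0 /\ H = [set x | \sum_(i < d) a 0 i * x 0 i = b].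

Definition ediam A : \bar R :=
  ereal_sup [set (enorm (p.1 - p.2))%:E | p in A `*` A].

End EuclideanGeometry.

Section BadlyApproximable.
Context {R : realType} {d : nat}.

Definition weight (w : 'rV[R]_d) : Prop :=
  (forall i, 0 <= w 0 i) /\ \sum_(i < d) w 0 i = 1.

Definition dist_int (t : R) : R := inf [set `|t - n%:~R| | n in [set: int]].

(* |t|_Z^(1/v), with the convention that it is 0 when v = 0 *)
Definition wpow (t v : R) : R := if v == 0 then 0 else dist_int t `^ v^-1.

(* liminf of u q over nonzero integers q, as |q| tends to infinity *)
Definition liminf_int (u : int -> R) : \bar R :=
  ereal_sup [set ereal_inf [set (u q)%:E | q in
      [set q : int | q != 0 /\ (N <= `|q|)%N]] | N in [set: nat]].

(* The default value 0 of the iterated maximum is harmless: its terms are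
   nonnegative. *)
Definition bad_quality (theta w x : 'rV[R]_d) (q : int) : R :=
  (\big[Num.max/0]_(i < d) wpow (q%:~R * x 0 i - theta 0 i) (w 0 i))
  * `|q|%:~R.

Definition Bad (theta w : 'rV[R]_d) : set 'rV[R]_d :=
  [set x | (0 < liminf_int (bad_quality theta w x))%E].

End BadlyApproximable.

Section Diffeomorphisms.
Context {R : realType} {d : nat}.

Definition C1 (f : 'rV[R]_d -> 'rV[R]_d) : Prop :=
  (forall x, differentiable f x) /\ continuous (fun x => jacobian f x).

Definition C1_diffeomorphism (f : 'rV[R]_d -> 'rV[R]_d) : Prop :=
  C1 f /\ exists g, [/\ cancel f g, cancel g f & C1 g].

End Diffeomorphisms.

Section HyperplaneAbsoluteGame.
Context {R : realType} {d : nat}.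

(* A pair (c, r) stands for the closed ball of centre c and radius r. *)
Definition ball_pair : Type := ('rV[R]_d * R)%type.

Definition pball (B : ball_pair) : set 'rV[R]_d := eball B.1 B.2.

(* Alice's move (H_n, e_n) is a function of the earlier balls
   [:: B_0; ...; B_(n-1)] and of the current ball B_n; her own earlier moves
   are determined by these. *)
Definition alice_strategy : Type :=
  seq ball_pair -> ball_pair -> set 'rV[R]_d * R.

Definition alice_move (sigma : alice_strategy) (B : nat -> ball_pair) (n : nat) :
  set 'rV[R]_d * R := sigma (mkseq B n) (B n).

Definition alice_legal (beta : R) (sigma : alice_strategy) : Prop :=
  forall h B, 0 < B.2 ->
    affine_hyperplane (sigma h B).1 /\ 0 < (sigma h B).2 <= beta * B.2.

Definition bob_legal (beta : R) (sigma : alice_strategy) (B : nat -> ball_pair) :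
  Prop :=
  0 < (B 0%N).2 /\
  forall n, let: (H, e) := alice_move sigma B n in
    [/\ pball (B n.+1) `<=` pball (B n),
        beta * (B n).2 <= (B n.+1).2 &
        pball (B n.+1) `&` open_nbhd H e = set0].

Definition hyperplane_absolute_winning (S : set 'rV[R]_d) : Prop :=
  forall beta : R, 0 < beta < 3^-1 ->
    exists sigma : alice_strategy, alice_legal beta sigma /\
      forall B, bob_legal beta sigma B ->
        (\bigcap_n pball (B n)) `&` S !=set0.

End HyperplaneAbsoluteGame.

Notation borel_rV R d := (g_sigma_algebraType (@open 'rV[R]_d)).

Section Measures.
Context {R : realType} {d : nat}.
Variable mu : {measure set (borel_rV R d) -> \bar R}.

Definition supp : set 'rV[R]_d :=
  [set x | forall U : set 'rV[R]_d, open U -> U x -> (0 < mu U)%E].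

Definition ahlfors_regular_exp (alpha : R) : Prop :=
  exists A r0 : R, [/\ 0 < A, 0 < r0 &
    forall x rho, supp x -> 0 < rho <= r0 ->
      ((A^-1 * rho `^ alpha)%:E <= mu (eball x rho) <=
       (A * rho `^ alpha)%:E)%E].

Definition ahlfors_regular : Prop := exists alpha, ahlfors_regular_exp alpha.

Definition absolutely_decaying : Prop :=
  exists D delta r0 : R, [/\ 0 < D, 0 < delta, 0 < r0 &
    forall x r, supp x -> 0 < r <= r0 ->
    forall (H : set 'rV[R]_d) (r' : R), affine_hyperplane H -> 0 < r' ->
      (mu (closed_nbhd H r' `&` eball x r) <=
       (D * (r' / r) `^ delta)%:E * mu (eball x r))%E].

End Measures.

Section HausdorffDimension.
Context {R : realType} {d : nat}.
Local Open Scope ereal_scope.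

(* The empty set, for which ediam is -oo, is given value 0 for every s. *)
Definition diam_pow (s : R) (A : set 'rV[R]_d) : \bar R :=
  if A == set0 then 0 else ediam A `^ s.

Definition hausdorff_content (s delta : R) (S : set 'rV[R]_d) : \bar R :=
  ereal_inf [set \sum_(0 <= k <oo) diam_pow s (U k) |
    U in [set U : nat -> set 'rV[R]_d |
      S `<=` \bigcup_k U k /\ forall k, ediam (U k) <= delta%:E]].

Definition hausdorff_measure (s : R) (S : set 'rV[R]_d) : \bar R :=
  ereal_sup [set hausdorff_content s delta S | delta in [set e : R | (0 < e)%R]].

Definition hausdorff_dim (S : set 'rV[R]_d) : \bar R :=
  ereal_inf [set s%:E | s in
    [set s : R | (0 <= s)%R /\ hausdorff_measure s S = 0]].

End HausdorffDimension.

(* Main.v *)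
(* A potential argument turns the hyperplane game into a bookkeeping problem.
   At selected ("major") balls of Bob, Alice announces countably many sets N of
   widths s, each of which lies close to a hyperplane inside every ball of
   radius at least s, with the sum of the s^gamma at most a small multiple of
   r^gamma.  The potential of a ball is the sum of s^gamma over the announced
   sets that meet it.  A nearly flat set misses one of d+1 small balls whose
   centres span a fat simplex, so the potentials of such balls add up to at most
   d times the potential of the big ball.  Hence, off a neighbourhood of a
   suitable hyperplane, the potential drops by the factor (d+1)/(d+2); playing
   that hyperplane, Alice keeps it below r^gamma, and then no announced set of
   width s meets a major ball of radius less than s.

   For one weight, with the zero entries dropped, the announcements are made in
   the coordinates y = f^-1(x).  Consider the lattice Z^(n+1) of affine forms
   b + a.y under a diagonal flow, and keep a flag of sublattices: whenever a
   sublattice becomes short it joins the flag, and a neighbourhood of the zero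
   set of one of its minors (an affine form in y) is announced, which stops it
   from ever becoming much shorter.  As a consequence there are never short
   vectors.  By transference, at each scale at most one pair (q, p) can make
   q y - p - theta small on the current ball, and announcing a neighbourhood of
   the corresponding hyperplane makes y badly approximable.  Countably many
   weights, shifts and charts share the budget geometrically.

   For the dimension, let alpha be the exponent of mu and suppose that the
   winning set meets supp mu in a set of H^s-measure zero for some s < alpha.
   Cover it by sets with tiny weights.  Bob shrinks by a small factor beta and
   can choose among at least beta^-s' (s < s' < alpha) separated balls centred
   on supp mu, because absolute decay makes Alice's hyperplane negligible; he
   takes the one that meets the least total weight.  The limit point lies in no
   covering set. *)
Require Import Defs.
From HB Require Import structures.
From mathcomp Require Import all_boot all_order all_algebra.
From mathcomp Require Import all_classical all_reals all_analysis.
From mathcomp Require Import perm zify ring lra.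
Set Implicit Arguments.
Unset Strict Implicit.
Unset Printing Implicit Defensive.
Import Order.TTheory GRing.Theory Num.Theory.
Import numFieldNormedType.Exports.
Local Open Scope classical_set_scope.
Local Open Scope ring_scope.

(** * Minors of integer lattices and Minkowski's theorem *)

Section Minors.
Context {R : realType}.

(** Slabs cannot be announced for short vectors one by one, since nothing bounds the number of short
    vectors of one lattice. A flag has at most one member per rank, so at most [n] slabs are
    announced for each ball, time and stage. The stage [p] tells how far a ball exceeds the natural
    scale [exp (- g * max_rate * t)] of time [t]. At stage [p] a slab has relative width about
    [exp (- g * eta * p)], while only about [M * p] times are active on one ball, so all stages and
    times together cost as little as desired. The obstacle is that a flag starts from nothing: when
    a time enters its window, no sublattice may already be short. A sublattice that is short then is
    followed backwards in time. Its minors that depend on the ball decay; once the other, purely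
    arithmetic, minors dominate, Minkowski's theorem yields a vector that is short at an earlier
    time, and protection already known for an earlier ball or another stage excludes it. The
    exponent [gamma] of the game is tiny, which is why widths have to decay at a prescribed
    geometric rate [tau]. *)

Definition upd (I : eqType) (T : Type) (f : I -> T) (k : I) (u : T) : I -> T :=
  fun k' => if k' == k then u else f k'.

Definition minor j m (Z : 'M[R]_(j, m)) (F : 'I_j -> 'cV[R]_m) : R :=
  \det (\matrix_(i, k) (Z *m F k) i 0).

Lemma minor_mul j m (T : 'M[R]_j) (Z : 'M[R]_(j, m)) F :
  minor (T *m Z) F = \det T * minor Z F.
Proof.
rewrite /minor -det_mulmx; congr (\det _); apply/matrixP => i k.
rewrite [LHS]mxE -mulmxA [LHS]mxE [RHS]mxE.
by apply: eq_bigr => l _; rewrite [in RHS]mxE.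
Qed.

Lemma minor_upd j m (Z : 'M[R]_(j, m)) F k u :
  minor Z (upd F k u) =
  \sum_i (Z *m u) i 0 * cofactor (\matrix_(i, k) (Z *m F k) i 0) i k.
Proof.
rewrite /minor (expand_det_col _ k); apply: eq_bigr => i _.
rewrite mxE /upd eqxx; congr (_ * _).
rewrite /cofactor; congr (_ * \det _); apply/matrixP => a c; rewrite !mxE.
by rewrite /upd eq_sym (negbTE (neq_lift _ _)).
Qed.

Lemma minor_updD j m (Z : 'M[R]_(j, m)) F k u (I : finType) (c : I -> R) U :
  minor Z (upd F k (u + \sum_l c l *: U l)) =
  minor Z (upd F k u) + \sum_l c l * minor Z (upd F k (U l)).
Proof.
rewrite !minor_upd.
under [X in _ = _ + X]eq_bigr do rewrite minor_upd big_distrr /=.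
rewrite exchange_big -big_split /=; apply: eq_bigr => i _.
rewrite mulmxDr mxE mulrDl; congr (_ + _).
rewrite mulmx_sumr summxE mulr_suml; apply: eq_bigr => l _.
by rewrite -scalemxAr mxE mulrA.
Qed.

Lemma upd_id (I : eqType) (T : Type) (f : I -> T) k : upd f k (f k) = f.
Proof. by apply/funext => i; rewrite /upd; case: eqP => // ->. Qed.

Lemma minor_scale j m (Z : 'M[R]_(j, m)) F (D : 'I_j -> R) :
  minor Z (fun k => D k *: F k) = (\prod_k D k) * minor Z F.
Proof.
rewrite /minor.
have -> : \matrix_(i, k) (Z *m (D k *: F k)) i 0 =
   (\matrix_(i, k) (Z *m F k) i 0) *m diag_mx (\row_k D k).
  apply/matrixP => i k; rewrite mul_mx_diag [LHS]mxE -scalemxAr [LHS]mxE.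
  by rewrite [RHS]mxE mulrC; congr (_ * _); rewrite [RHS]mxE.
rewrite det_mulmx det_diag mulrC; congr (_ * _).
by apply: eq_bigr => k _; rewrite mxE.
Qed.

Lemma minor_col_mx j m (v : 'rV[R]_m) (Z : 'M[R]_(j, m)) (F : 'I_j.+1 -> 'cV_m) :
  minor (col_mx v Z : 'M[R]_(j.+1, m)) F =
  \sum_k (v *m F k) 0 0 * ((-1) ^+ k * minor Z (fun i => F (lift k i))).
Proof.
have e0 (u : 'cV_m) : ((col_mx v Z : 'M[R]_(j.+1, m)) *m u) 0 0 = (v *m u) 0 0.
  have h : (0 : 'I_j.+1) = lshift j (0 : 'I_1) :> 'I_j.+1 by apply/val_inj.
  by rewrite {1}h; apply: etrans (col_mxEu _ (Z *m u) 0 0); rewrite -mul_col_mx.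
have e1 (u : 'cV_m) a :
  ((col_mx v Z : 'M[R]_(j.+1, m)) *m u) (lift 0 a) 0 = (Z *m u) a 0.
  have h : lift (0 : 'I_j.+1) a = rshift 1 a :> 'I_j.+1 by apply/val_inj.
  by rewrite {1}h; apply: etrans (col_mxEd (v *m u) _ a 0); rewrite -mul_col_mx.
rewrite /minor (expand_det_row _ 0); apply: eq_bigr => k _.
rewrite [X in X * _ = _]mxE e0; congr (_ * _).
rewrite /cofactor add0n; congr (_ * \det _); apply/matrixP => a c.
by rewrite 3!mxE e1 [RHS]mxE.
Qed.

(** Cramer's rule: the adjugate of the matrix of [Z] on [F], applied to [Z *m u], lists the minors
    with one column replaced by [u]. It recovers the value of a lattice vector on any column [u]
    from its values on a family [F] whose minor is large. *)
Lemma minor_cramer j m (Z : 'M[R]_(j, m)) F (x : 'rV[R]_j) (u : 'cV[R]_m) :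
  minor Z F * (x *m Z *m u) 0 0 =
  \sum_k (x *m Z *m F k) 0 0 * minor Z (upd F k u).
Proof.
set S := \matrix_(i, k) (Z *m F k) i 0.
have e1 k : (x *m Z *m F k) 0 0 = (x *m S) 0 k.
  by rewrite -mulmxA [LHS]mxE [RHS]mxE; apply: eq_bigr => l _; rewrite [in RHS]mxE.
have e2 k : minor Z (upd F k u) = (\adj S *m (Z *m u)) k 0.
  rewrite minor_upd [RHS]mxE; apply: eq_bigr => i _.
  by rewrite mulrC; congr (_ * _); rewrite [RHS]mxE.
transitivity ((x *m S *m (\adj S *m (Z *m u))) 0 0); last first.
  by rewrite mxE; apply: eq_bigr => k _; rewrite e1 e2.
rewrite (mulmxA (x *m S)) -(mulmxA x S) mul_mx_adj mul_mx_scalar -scalemxAl.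
by rewrite mulmxA [RHS]mxE.
Qed.

Lemma det_le n (A : 'M[R]_n) X :
  (forall i k, `|A i k| <= X) -> `|\det A| <= (n`!)%:R * X ^+ n.
Proof.
move=> h; rewrite /determinant (le_trans (ler_norm_sum _ _ _)) //.
apply: (@le_trans _ _ (\sum_(s : 'S_n) X ^+ n)).
  apply: ler_sum => s _; rewrite normrM normrX normrN1 expr1n mul1r.
  rewrite normr_prod -[n in X ^+ n]card_ord -prodr_const.
  by apply: ler_prod => i _; rewrite normr_ge0 h.
by rewrite sumr_const card_Sn mulr_natl.
Qed.

End Minors.

Section Minkowski.
Context {R : realType}.

Lemma det_unit_int n (M : 'M[int]_n) : M \in unitmx ->
  `|\det (map_mx (intr : int -> R) M)| = 1.
Proof.
by rewrite unitmxE det_map_mx => /orP[] /eqP->; rewrite ?rmorphN /= ?normrN normr1.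
Qed.

(** The Smith form of a single row has one entry, so [x] is a multiple of the first row of the
    unimodular right factor; that row belongs to a basis of the lattice. *)
Lemma unimodular_completion n (x : 'rV[int]_n.+1) : x != 0 ->
  exists (g : int) (M : 'M[int]_n.+1),
    [/\ g != 0, M \in unitmx & x = g *: row 0 M].
Proof.
move=> x0; have [L Lu [M Mu [d _ xE]]] := int_Smith_normal_form x.
exists (L 0 0 * d`_0), M; have xE' : x = (L 0 0 * d`_0) *: row 0 M.
  rewrite xE; apply/rowP => k; rewrite -mulmxA [LHS]mxE big_ord1 [RHS]mxE -mulrA.
  rewrite [row 0 M 0 k]mxE; congr (_ * _); rewrite mxE (bigD1 0) //= mxE eqxx mulr1n.
  rewrite big1 ?addr0 // => i i0.
  by rewrite mxE /= eq_sym -val_eqE /= in i0 *; rewrite (negbTE i0) mulr0n mul0r.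
split => //; apply: contra_neq x0 => g0; by rewrite xE' g0 scale0r.
Qed.

Lemma near_int (t : R) : exists k : int, `|t - k%:~R| <= 2^-1.
Proof.
exists (Num.floor (t + 2^-1)).
have := floor_le_tmp (t + 2^-1); have := floorD1_gt (t + 2^-1).
rewrite intrD /=; set u := (_)%:~R => h1 h2; rewrite ler_norml; lra.
Qed.

End Minkowski.

Section Minkowski.
Context {R : realType}.

Definition comb (T : Type) j (Y : 'I_j -> T -> R) (x : 'rV[int]_j) (c : T) : R :=
  \sum_i (x 0 i)%:~R * Y i c.

Definition ocons (T : Type) j (a : T) (f : 'I_j -> T) (k : 'I_j.+1) : T :=
  if unlift 0 k is Some k' then f k' else a.

Lemma ocons0 T j (a : T) (f : 'I_j -> T) : ocons a f 0 = a.
Proof. by rewrite /ocons unlift_none. Qed.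

Lemma oconsS T j (a : T) (f : 'I_j -> T) k : ocons a f (lift 0 k) = f k.
Proof. by rewrite /ocons liftK. Qed.

Lemma det_eliminate j (A : 'M[R]_j.+1) : A 0 0 != 0 ->
  \det A = A 0 0 * \det (\matrix_(i < j, k < j)
     (A (lift 0 i) (lift 0 k) - A (lift 0 i) 0 / A 0 0 * A 0 (lift 0 k))).
Proof.
move=> A0.
pose L := \matrix_(i < j.+1, l < j.+1)
  ((i == l)%:R + (if l == 0 then (if i == 0 then 0 else A i 0 / A 0 0) else 0)) : 'M[R]_j.+1.
pose B := \matrix_(i < j.+1, k < j.+1)
  (if i == 0 then A 0 k else A i k - A i 0 / A 0 0 * A 0 k) : 'M[R]_j.+1.
have AE : A = L *m B.
  apply/matrixP => i k; rewrite mxE (bigD1 0) //= !mxE eqxx.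
  have [->|i0] := eqVneq i 0.
    rewrite big1; first by rewrite ?eqxx !addr0 mul1r.
    by move=> l l0; rewrite !mxE eq_sym (negbTE l0) addr0 mul0r.
  rewrite add0r (bigD1 i) //= big1; last first.
    move=> l /andP[l0 li]; rewrite !mxE (negbTE l0) eq_sym (negbTE li) addr0.
    by rewrite mul0r.
  by rewrite !mxE eqxx (negbTE i0) !addr0 mulr1n mul1r addrC subrK.
have -> : \det A = \det L * \det B by rewrite -det_mulmx -AE.
have -> : \det L = 1.
  rewrite det_trig; last first.
    apply/is_trig_mxP => i l il; rewrite mxE -val_eqE /= (ltn_eqF il).
    have /negbTE -> : l != 0 by rewrite -val_eqE /= -lt0n (leq_ltn_trans _ il).
    by rewrite addr0.
  by apply: big1 => i _; rewrite mxE eqxx; case: eqP; rewrite addr0.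
rewrite mul1r (expand_det_col _ 0) (bigD1 0) //= big1 ?addr0; last first.
  by move=> i i0; rewrite mxE (negbTE i0) divfK // subrr mul0r.
rewrite mxE eqxx; congr (_ * _).
rewrite /cofactor expr0 mul1r; congr (\det _); apply/matrixP => i k.
by rewrite !mxE.
Qed.

(** A nearly shortest vector [u] is completed to a basis and eliminated at the coordinate where it
    is largest. A vector of the quotient lifts with a coefficient of [u] of modulus at most 1/2, and
    [u] has norm below 3/2 of the infimum [m], so the quotient still has minimum at least [m / 4].
    The powers of 1/4 collected on the way stay within [j * j]. *)
Lemma minkowski (T : finType) j (Y : 'I_j -> T -> R) (mu : R) : 0 < mu ->
  (forall x : 'rV[int]_j, x != 0 -> exists c, mu <= `|comb Y x c|) ->
  exists f : 'I_j -> T,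
    4^-1 ^+ (j * j) * mu ^+ j <= `|\det (\matrix_(i, k) Y i (f k))|.
Proof.
elim: j Y mu => [|j IH] Y mu mu0 hY.
  have f : 'I_0 -> T by case.
  by exists f; rewrite det_mx00 normr1 !expr0 mulr1.
pose nrm (u : T -> R) := \big[Num.max/0]_c `|u c|.
have nrm_ge u c : `|u c| <= nrm u by exact: (le_bigmax _ (fun c => `|u c|)).
pose S := [set nrm (comb Y x) | x in [set x | x != 0]].
have S0 : S !=set0.
  exists (nrm (comb Y (const_mx 1))); exists (const_mx 1) => //=.
  by apply/eqP => /rowP /(_ 0); rewrite !mxE.
have Smu : lbound S mu.
  move=> _ [x x0 <-]; have [c hc] := hY x x0; exact: le_trans hc (nrm_ge _ c).
set m := inf S; have mum : mu <= m by exact: lb_le_inf.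
have m0 : 0 < m by exact: lt_le_trans mum.
have [_ [x x0 <-] xm] := @inf_adherent _ S (m / 2) (divr_gt0 m0 (ltr0Sn _ _))
  (conj S0 (ex_intro _ mu Smu)).
have hm z : z != 0 -> m <= nrm (comb Y z).
  by move=> z0; apply: ge_inf; [exists mu|exists z].
have [g [M [g0 Mu xE]]] := unimodular_completion x0.
pose Y1 := fun i c => comb Y (row i M) c.
have combM z c : comb Y (z *m M) c = comb Y1 z c.
  rewrite /comb; under eq_bigr do rewrite mxE rmorph_sum mulr_suml.
  rewrite exchange_big /=; apply: eq_bigr => l _; rewrite mulr_sumr.
  by apply: eq_bigr => i _; rewrite mxE rmorphM mulrA.
set u := Y1 0.
(* [x] is a nonzero integer multiple of [u], so [u] is nearly shortest as well. *)
have um : nrm u < 3 / 2 * m.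
  apply: le_lt_trans (_ : nrm (comb Y x) < _); last by rewrite -/m in xm; lra.
  apply: bigmax_le; first by apply: bigmax_ge_id.
  move=> c _; apply: le_trans (nrm_ge _ c).
  have -> : comb Y x c = g%:~R * u c.
    rewrite /u /Y1 /comb mulr_sumr; apply: eq_bigr => i _.
    by rewrite xE [X in X%:~R]mxE rmorphM mulrA.
  rewrite normrM ler_peMl // -intr_norm ler1z -gtz0_ge1 normr_gt0 //.
have u0 : m <= nrm u.
  apply: hm; apply: contra_neq x0 => h; by rewrite xE h scaler0.
have [c0 _] := hY _ x0.
have [i1 _ hi1] : {i1 | i1 \in xpredT & nrm u = `|u i1|}.
  by apply: (@eq_bigmax _ _ _ _ c0) => // i _; rewrite normr_ge0.
have ui1 : u i1 != 0 by rewrite -normr_gt0 -hi1; exact: lt_le_trans u0.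
pose Y' (i : 'I_j) c := Y1 (lift 0 i) c - Y1 (lift 0 i) i1 / u i1 * u c.
have [|z z0|f' hf'] := IH Y' (m / 4); first by apply: divr_gt0.
  have [k hk] := near_int ((\sum_i (z 0 i)%:~R * Y1 (lift 0 i) i1) / u i1).
  pose z' : 'rV[int]_j.+1 := \row_i ocons (- k) (fun i => z 0 i) i.
  have z'0 : z' *m M != 0.
    apply: contra_neq z0 => h; have : z' *m M *m invmx M = 0 by rewrite h mul0mx.
    rewrite mulmxK // => /rowP h'; apply/rowP => i.
    by have := h' (lift 0 i); rewrite !mxE oconsS.
  set tau := (_ / u i1) in hk.
  have z'E c : comb Y1 z' c = comb Y' z c + (tau - k%:~R) * u c.
    rewrite /comb big_ord_recl !mxE ocons0.
    under eq_bigr do rewrite mxE oconsS.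
    under [in RHS]eq_bigr do rewrite /Y' mulrBr.
    rewrite sumrB -/u /tau rmorphN /=.
    have -> : \sum_i (z 0 i)%:~R * (Y1 (lift 0 i) i1 / u i1 * u c) =
      (\sum_i (z 0 i)%:~R * Y1 (lift 0 i) i1) / u i1 * u c.
      by rewrite !mulr_suml; apply: eq_bigr => i _; rewrite !mulrA.
    ring.
  have [c _ hc] : {c | c \in xpredT & nrm (comb Y (z' *m M)) = `|comb Y (z' *m M) c|}.
    by apply: (@eq_bigmax _ _ _ _ c0) => // i _; rewrite normr_ge0.
  exists c; have := hm _ z'0; rewrite hc combM z'E => h1.
  have h2 : `|(tau - k%:~R) * u c| <= 2^-1 * (3 / 2 * m).
    by rewrite normrM ler_pM // (le_trans (nrm_ge u c)) // ltW.
  have := ler_normD (comb Y' z c) ((tau - k%:~R) * u c); lra.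
exists (ocons i1 f').
have -> : `|\det (\matrix_(i, k) Y i (ocons i1 f' k))| =
          `|\det (\matrix_(i, k) Y1 i (ocons i1 f' k))|.
  rewrite -[LHS]mul1r -(@det_unit_int R _ _ Mu) -normrM -det_mulmx.
  congr `|\det _|; apply/matrixP => i k; rewrite !mxE /Y1 /comb.
  by apply: eq_bigr => l _; rewrite !mxE.
rewrite det_eliminate mxE ocons0 -/u // normrM -hi1.
have -> : \matrix_(i < j, k < j) ((\matrix_(i, k) Y1 i (ocons i1 f' k)) (lift 0 i) (lift 0 k) -
  (\matrix_(i, k) Y1 i (ocons i1 f' k)) (lift 0 i) 0 / u i1 *
  (\matrix_(i, k) Y1 i (ocons i1 f' k)) 0 (lift 0 k)) = \matrix_(i, k) Y' i (f' k).
  by apply/matrixP => i k; rewrite !mxE !oconsS !ocons0.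
apply: le_trans (_ : m * (4^-1 ^+ (j * j) * (m / 4) ^+ j) <= _); last first.
  apply: ler_pM => //; first exact: ltW.
  by rewrite ltW // mulr_gt0 ?exprn_gt0 ?divr_gt0 ?invr_gt0.
have -> : m * (4^-1 ^+ (j * j) * (m / 4) ^+ j) =
          4^-1 ^+ (j * j + j) * m ^+ j.+1.
  by rewrite exprMn exprD exprS; ring.
have p0 a : 0 <= 4^-1 ^+ a :> R by apply: exprn_ge0; lra.
apply: ler_pM; [exact: p0|by apply: exprn_ge0; apply: ltW| |].
  by apply: ler_wiXn2l; [lra|lra|lia].
by rewrite ler_pXn2r // nnegrE ltW.
Qed.

End Minkowski.

(** * Dual lattices under the diagonal flow *)

Section Lattices.
Context {R : realType} {n : nat}.
Notation ZR := (map_mx (intr : int -> R)).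

Definition coord : Type := option (bool * 'I_n).

Definition special (c : coord) : bool := if c is Some (false, _) then false else true.

Definition wts : Type := (R * ('I_n -> R))%type.
Definition yball : Type := ('rV[R]_n * R)%type.

(* Applied to a row (b, a) of integers these columns give, up to the scales D:
   None, the value of b + a.y at the centre of the ball; (false, i), the entry
   a_i; (true, i), the variation r a_i of b + a.y across the ball. *)
Definition cvec (D : wts) (B : yball) (c : coord) : 'cV[R]_n.+1 :=
  match c with
  | None => D.1 *: (delta_mx 0 0 + \sum_i B.1 0 i *: delta_mx (lift 0 i) 0)
  | Some (false, i) => D.2 i *: delta_mx (lift 0 i) 0
  | Some (true, i) => (D.1 * B.2) *: delta_mx (lift 0 i) 0
  end.

(* Moving the centre changes the None column by a combination of the (true, i)
   columns, so minors with two special columns never occur. *)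
Definition adm j (f : 'I_j -> coord) : Prop :=
  forall k k', special (f k) -> special (f k') -> k = k'.

Definition small (X : R) (D : wts) j (Z : 'M[int]_(j, n.+1)) (B : yball) : Prop :=
  forall f : 'I_j -> coord, adm f -> `|minor (ZR Z) (cvec D B \o f)| < X.

Definition vsmall (x : R) (D : wts) (v : 'rV[int]_n.+1) (B : yball) : Prop :=
  forall c, `|(ZR v *m cvec D B c) 0 0| < x.

Lemma small_le X X' D j (Z : 'M[int]_(j, n.+1)) B :
  X <= X' -> small X D Z B -> small X' D Z B.
Proof. by move=> h s f af; apply: lt_le_trans (s f af) h. Qed.

Lemma comp_upd (I : eqType) (S T : Type) (g : S -> T) (f : I -> S) k u :
  g \o upd f k u = upd (g \o f) k (g u).
Proof. by apply/funext => i /=; rewrite /upd; case: eqP. Qed.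

Lemma adm_upd j (f : 'I_j -> coord) k u : adm f -> special (f k) ->
  adm (upd f k u).
Proof.
move=> af sk a c; rewrite /upd; case: eqP => [->|_]; case: eqP => [->|_] //.
- by move=> _ /(af _ _ sk) <-.
- by move=> /(af _ _ sk) <-.
exact: af.
Qed.

(** Only one column of an admissible family depends on the ball. A new radius rescales it, and a new
    centre adds to the column [None] multiples of the columns [(true, i)]; every family that arises
    is again admissible, so multilinearity bounds the change by the factor [c]. *)
Lemma small_chg (c Delta X : R) D j (Z : 'M[int]_(j, n.+1)) (B1 B2 : yball) :
  0 < B1.2 -> 0 < B2.2 -> (forall i, `|B1.1 0 i - B2.1 0 i| <= Delta) ->
  1 + n%:R * Delta / B2.2 <= c -> B1.2 / B2.2 <= c -> 1 <= c ->
  small X D Z B2 -> small (c * X) D Z B1.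
Proof.
move=> r1 r2 hD hc1 hc2 c1 s f af.
have X0 : 0 < X by apply: le_lt_trans (s f af); exact: normr_ge0.
have [[k sk]|ns] := pselect (exists k, special (f k)); last first.
  have -> : cvec D B1 \o f = cvec D B2 \o f.
    apply/funext => k /=; have : ~ special (f k) by move=> h; apply: ns; exists k.
    by case: (f k) => [[[] i]|] //= h; case: h.
  by apply: lt_le_trans (s f af) _; rewrite ler_peMl // ltW.
have -> : cvec D B1 \o f = upd (cvec D B2 \o f) k (cvec D B1 (f k)).
  apply/funext => i /=; rewrite /upd; case: eqP => [->//|ik] /=.
  have : ~ special (f i) by move=> si; apply: ik; exact: af.
  by case: (f i) => [[[] i']|] //= h; case: h.
have hu i : `|minor (ZR Z) (upd (cvec D B2 \o f) k (cvec D B2 (Some (true, i))))| < X.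
  by rewrite -comp_upd; apply: s; apply: adm_upd.
case E : (f k) sk => [[[] i]|] // _.
  have -> : cvec D B1 (Some (true, i)) =
      0 + \sum_(l : 'I_1) (B1.2 / B2.2) *: cvec D B2 (Some (true, i)).
    rewrite add0r big_ord1 /= scalerA; congr (_ *: _).
    by rewrite mulrCA divfK // gt_eqF.
  rewrite minor_updD minor_upd big1; last by move=> l _; rewrite mulmx0 mxE mul0r.
  rewrite add0r big_ord1 normrM ger0_norm ?divr_ge0 ?ltW //.
  apply: le_lt_trans (_ : c * `|minor (ZR Z) (upd (cvec D B2 \o f) k (cvec D B2 (Some (true, i))))| < _).
    by rewrite ler_wpM2r.
  by rewrite ltr_pM2l // (lt_le_trans _ c1).
have -> : cvec D B1 None = cvec D B2 None +
   \sum_i ((B1.1 0 i - B2.1 0 i) / B2.2) *: cvec D B2 (Some (true, i)).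
  rewrite /= !scalerDr -addrA; congr (_ + _).
  rewrite !scaler_sumr -big_split /=; apply: eq_bigr => i _.
  rewrite !scalerA -scalerDl; congr (_ *: _).
  by field; rewrite gt_eqF.
rewrite minor_updD -{1}E.
have -> : cvec D B2 (f k) = (cvec D B2 \o f) k by [].
rewrite upd_id; apply: le_lt_trans (ler_normD _ _) _.
apply: lt_le_trans (_ : (1 + n%:R * Delta / B2.2) * X <= _); last by rewrite ler_wpM2r // ltW.
rewrite mulrDl mul1r ltr_leD //; first exact: s.
apply: le_trans (ler_norm_sum _ _ _) _.
have -> : n%:R * Delta / B2.2 * X = \sum_(i < n) (Delta / B2.2 * X).
  by rewrite sumr_const card_ord -[RHS]mulr_natl !mulrA.
apply: ler_sum => i _; rewrite normrM; apply: ler_pM => //; last exact: ltW.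
by rewrite normrM normfV (gtr0_norm r2) ler_pM2r // invr_gt0.
Qed.

Lemma small_wt X (D D' : wts) j (Z : 'M[int]_(j, n.+1)) B :
  D.1 = D'.1 -> (forall i, 0 < D.2 i <= D'.2 i) ->
  small X D' Z B -> small X D Z B.
Proof.
move=> e1 e2 s f af; apply: le_lt_trans (s f af).
pose q (c : coord) := if c is Some (false, i) then D'.2 i / D.2 i else 1.
have q1 c : 1 <= q c.
  rewrite /q; case: c => [[[] i]|] //.
  by have /andP[h1 h2] := e2 i; rewrite ler_pdivlMr // mul1r.
have -> : cvec D' B \o f = (fun k => q (f k) *: (cvec D B \o f) k).
  apply/funext => k; rewrite /= /q; case: (f k) => [[[] i]|] /=.
  - by rewrite scale1r e1.
  - rewrite scalerA divfK // gt_eqF //; by have /andP[] := e2 i.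
  - by rewrite scale1r e1.
rewrite minor_scale normrM ler_peMl //.
have : 1 <= \prod_k q (f k).
  by elim/big_rec: _ => // i x _ hx; rewrite mulr_ege1.
by move=> h; rewrite ger0_norm // (le_trans _ h).
Qed.

Lemma small_col_mx X x D j (Z : 'M[int]_(j, n.+1)) (v : 'rV[int]_n.+1) B :
  0 < X -> small X D Z B -> vsmall x D v B ->
  small (j.+1%:R * X * x) D (col_mx v Z : 'M[_]_(j.+1, n.+1)) B.
Proof.
move=> X0 sZ sv f af.
have -> : ZR (col_mx v Z) = (col_mx (ZR v) (ZR Z) : 'M[_]_(j.+1, n.+1)).
  exact: (map_col_mx (intr : int -> R) v Z).
rewrite minor_col_mx; apply: le_lt_trans (ler_norm_sum _ _ _) _.
have -> : j.+1%:R * X * x = \sum_(i < j.+1) (X * x).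
  by rewrite sumr_const card_ord -[RHS]mulr_natl !mulrA.
apply: ltr_sum => [|k _]; first by apply/hasP; exists 0; rewrite // mem_index_enum.
rewrite !normrM normrX normrN1 expr1n mul1r mulrC.
apply: ltr_pM => //; last exact: sv.
by apply: (sZ (fun i => f (lift k i))) => a c s1 s2; apply: (@lift_inj _ k); apply: af.
Qed.

(** Primitivity without saturation: no integral basis of the same rational space has smaller
    covolume. Smallness of any integral basis of the space then passes to [Z]. *)
Definition reduced j (Z : 'M[int]_(j, n.+1)) : Prop :=
  forall (T : 'M[R]_j) (Z' : 'M[int]_(j, n.+1)),
    ZR Z' = T *m ZR Z -> \det T != 0 -> 1 <= `|\det T|.

(** An integral substitute for the covolume. It is multiplied by [|det T|] under a change of basis
    [T], so a minimum over [nat] is a reduced basis. *)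
Definition hgt j (Z : 'M[int]_(j, n.+1)) : nat :=
  (\sum_(f : {ffun 'I_j -> 'I_n.+1}) `|\det (\matrix_(i, k) Z i (f k))%R|)%N.

Lemma hgtE j (Z : 'M[int]_(j, n.+1)) : (hgt Z)%:R =
  \sum_(f : {ffun 'I_j -> 'I_n.+1}) `|\det (\matrix_(i, k) ZR Z i (f k))|.
Proof.
rewrite /hgt natr_sum; apply: eq_bigr => f _.
have -> : \matrix_(i, k) ZR Z i (f k) = ZR (\matrix_(i, k) Z i (f k)).
  by apply/matrixP => i k; rewrite !mxE.
by rewrite det_map_mx -intr_norm natr_absz.
Qed.

Lemma hgt_mul j (T : 'M[R]_j) (Z Z' : 'M[int]_(j, n.+1)) :
  ZR Z' = T *m ZR Z -> (hgt Z')%:R = `|\det T| * (hgt Z)%:R.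
Proof.
move=> h; rewrite !hgtE mulr_sumr; apply: eq_bigr => f _.
rewrite -normrM -det_mulmx h; congr `|\det _|; apply/matrixP => i k.
by rewrite !mxE; apply: eq_bigr => l _; rewrite !mxE.
Qed.

Lemma row_free_minor j (Z : 'M[int]_(j, n.+1)) : row_free (ZR Z) ->
  exists f : {ffun 'I_j -> 'I_n.+1}, \det (\matrix_(i, k) ZR Z i (f k)) != 0.
Proof.
move=> rf; have rf' : row_full (ZR Z)^T by rewrite /row_full mxrank_tr.
exists (fullrankfun rf').
have := fullrowsub_unit rf'; rewrite unitmxE unitfE -det_tr.
by congr (\det _ != 0); apply/matrixP => i k; rewrite !mxE.
Qed.

Lemma exists_reduced j (Z : 'M[int]_(j, n.+1)) : row_free (ZR Z) ->
  exists Z0 : 'M[int]_(j, n.+1),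
    [/\ row_free (ZR Z0), reduced Z0 & (ZR Z0 :=: ZR Z)%MS].
Proof.
move=> rf.
pose P k := `[< exists Z' : 'M[int]_(j, n.+1), hgt Z' = k /\ (ZR Z' :=: ZR Z)%MS >].
have exP : exists k, P k by exists (hgt Z); apply/asboolP; exists Z.
case: (ex_minnP exP) => k /asboolP[Z0 [hk eZ]] min.
have rf0 : row_free (ZR Z0) by rewrite /row_free eZ.
exists Z0; split => // T Z' e T0.
have Tu : T \in unitmx by rewrite unitmxE unitfE.
have le : (hgt Z0 <= hgt Z')%N.
  rewrite hk; apply: min; apply/asboolP; exists Z'; split => //.
  rewrite e; apply: eqmx_trans eZ; apply: eqmxMfull.
  by rewrite row_full_unit.
have h0 : 0 < (hgt Z0)%:R :> R.
  rewrite hgtE; have [f hf] := row_free_minor rf0.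
  rewrite (bigD1 f) //= ltr_pwDl ?normr_gt0 //; apply: sumr_ge0 => *; exact: normr_ge0.
rewrite -(ler_pM2r h0) mul1r -(hgt_mul e) ler_nat //.
Qed.

Lemma small_span X D j (Z0 Z : 'M[int]_(j, n.+1)) B :
  reduced Z0 -> row_free (ZR Z) -> (ZR Z <= ZR Z0)%MS ->
  small X D Z B -> small X D Z0 B.
Proof.
move=> red rf /submxP[T e] s f af; apply: le_lt_trans (s f af).
rewrite e minor_mul normrM ler_peMl //; apply: (red _ _ e).
have := rf; rewrite /row_free e => /eqP h.
have : row_free T.
  by rewrite /row_free eqn_leq rank_leq_row -{1}h mxrankM_maxl.
by rewrite row_free_unit unitmxE unitfE.
Qed.

End Lattices.

(** * Flags of short sublattices *)

Section Flags.
Context {R : realType} {n : nat}.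
Notation ZR := (map_mx (intr : int -> R)).

Definition flag : Type := forall j, option 'M[int]_(j, n.+1).

Definition flag0 : flag := fun j => None.

Definition flag_add (F : flag) j0 (Z0 : 'M[int]_(j0, n.+1)) : flag := fun j =>
  match @eqP _ j0 j with
  | ReflectT e => Some (castmx (e, erefl) Z0)
  | ReflectF _ => F j
  end.

Lemma flag_add_id F j0 (Z0 : 'M[int]_(j0, n.+1)) : flag_add F Z0 j0 = Some Z0.
Proof.
rewrite /flag_add; case: eqP => // e; congr Some.
by rewrite (eq_axiomK e) castmx_id.
Qed.

Lemma flag_add_neq F j0 (Z0 : 'M[int]_(j0, n.+1)) j :
  j0 != j -> flag_add F Z0 j = F j.
Proof. by rewrite /flag_add; case: eqP => // ->; rewrite eqxx. Qed.

Definition flag_ok (F : flag) : Prop :=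
  (forall j (Z : 'M[int]_(j, n.+1)), F j = Some Z ->
     [/\ (0 < j <= n)%N, row_free (ZR Z) & reduced (R := R) Z]) /\
  (forall i j (Zi : 'M[int]_(i, n.+1)) (Zj : 'M[int]_(j, n.+1)),
     F i = Some Zi -> F j = Some Zj -> (i <= j)%N -> (ZR Zi <= ZR Zj)%MS).

Definition comparable (F : flag) j (Z : 'M[int]_(j, n.+1)) : Prop :=
  forall i (Zi : 'M[int]_(i, n.+1)), F i = Some Zi ->
    ((i <= j)%N -> (ZR Zi <= ZR Z)%MS) /\ ((j <= i)%N -> (ZR Z <= ZR Zi)%MS).

Definition maximal_upto (m : nat) (K : R) D B (F : flag) : Prop :=
  forall j (Z : 'M[int]_(j, n.+1)), (0 < j <= m)%N -> F j = None ->
    row_free (ZR Z) -> comparable F Z -> ~ small (K ^+ j) D Z B.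

Definition subflag (F F' : flag) : Prop :=
  forall j Z, F j = Some Z -> F' j = Some Z.

(** Ranks are treated in increasing order, each receiving a reduced short sublattice comparable with
    the flag if there is one. Maximality at the lower ranks survives, because a larger flag has
    fewer comparable sublattices. *)
Lemma flag_extend (K : R) D B (F : flag) : flag_ok F ->
  exists F', [/\ flag_ok F', subflag F F',
    (forall j Z, F' j = Some Z -> F j = None -> small (K ^+ j) D Z B) &
    maximal_upto n K D B F'].
Proof.
move=> okF; suff : forall m, (m <= n)%N -> exists F', [/\ flag_ok F', subflag F F',
    (forall j Z, F' j = Some Z -> F j = None -> small (K ^+ j) D Z B) &
    maximal_upto m K D B F'] by apply.
elim=> [_|m IH mn].
  exists F; split => //; first by move=> j Z ->.
  by move=> j Z; case: j Z.
have [F' [ok' sub' sm' max']] := IH (ltnW mn).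
have [h|h] := pselect (exists Z : 'M[int]_(m.+1, n.+1),
  [/\ F' m.+1 = None, row_free (ZR Z), comparable F' Z & small (K ^+ m.+1) D Z B]);
  last first.
  exists F'; split => // j Z /andP[j0]; rewrite leq_eqVlt => /orP[/eqP jm|jm].
    by move=> Fj rf cmp s; apply: h; move: Z Fj rf cmp s; rewrite jm => Z *; exists Z.
  by apply: max'; rewrite j0.
have [Z [Fm rf cmp s]] := h.
have [Z0 [rf0 red0 eZ]] := exists_reduced rf.
have s0 : small (K ^+ m.+1) D Z0 B by apply: (small_span red0 rf) s; rewrite eZ.
have subF : subflag F' (flag_add F' Z0).
  move=> j; have [<- Zj|jm Zj hj] := eqVneq m.+1 j; first by rewrite Fm.
  by rewrite flag_add_neq.
have inv j Zj : flag_add F' Z0 j = Some Zj -> j != m.+1 -> F' j = Some Zj.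
  by move=> h1 h2; rewrite -h1 flag_add_neq // eq_sym.
exists (flag_add F' Z0); split.
- split=> [j|i j].
    have [->|jm] := eqVneq j m.+1 => Zj; last by move/inv => /(_ jm); apply: ok'.1.
    by rewrite flag_add_id => -[<-].
  have [->|im] := eqVneq i m.+1; have [->|jm] := eqVneq j m.+1 => Zi Zj.
  - by rewrite !flag_add_id => -[<-] -[<-] _; exact: submx_refl.
  - rewrite flag_add_id => -[<-] /inv /(_ jm) hj ij.
    by rewrite eZ; apply: (cmp _ _ hj).2.
  - move=> /inv /(_ im) hi; rewrite flag_add_id => -[<-] ij.
    by rewrite eZ; apply: (cmp _ _ hi).1.
  - by move=> /inv /(_ im) hi /inv /(_ jm) hj; apply: ok'.2 hi hj.
- by move=> j Zj hj; apply/subF/sub'.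
- move=> j; have [->|jm] := eqVneq j m.+1 => Zj.
    by rewrite flag_add_id => -[<-].
  by move/inv => /(_ jm); apply: sm'.
- move=> j; have [->|jm'] := eqVneq j m.+1 => Zj /andP[j0 jm].
    by rewrite flag_add_id.
  rewrite flag_add_neq 1?eq_sym // => Fj rfj cj; apply: max' => //.
    by rewrite j0; move: jm; rewrite leq_eqVlt (negbTE jm').
  by move=> i Zi /subF; apply: cj.
Qed.

Lemma row_free_add j (Z : 'M[R]_(j, n.+1)) (v : 'rV[R]_n.+1) :
  row_free Z -> ~~ (v <= Z)%MS -> row_free (col_mx v Z : 'M[_]_(j.+1, n.+1)).
Proof.
move=> rf vZ; rewrite /row_free eqn_leq rank_leq_row /=.
rewrite -{1}(eqP rf); apply: rank_ltmx; rewrite ltmxE.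
have [h1 h2] : (v <= col_mx v Z)%MS /\ (Z <= col_mx v Z)%MS.
  by apply/andP; rewrite -(col_mx_sub v Z (col_mx v Z)) submx_refl.
by rewrite h2 /=; apply: contra vZ; apply: submx_trans.
Qed.

Lemma full_minor D (B : @yball R n) (W : 'M[int]_n.+1) : row_free (ZR W) ->
  0 < D.1 -> (forall i, 0 < D.2 i) ->
  exists2 f : 'I_n.+1 -> coord, adm f &
    D.1 * \prod_i D.2 i <= `|minor (ZR W) (cvec D B \o f)|.
Proof.
move=> rf D0 Di; pose f := ocons (None : @coord n) (fun i => Some (false, i)).
exists f.
  move=> k k'; rewrite /f /ocons.
  by case: unliftP => [a ->|->] //=; case: unliftP => [c ->|->].
pose C : 'M[R]_n.+1 := \matrix_(l, k) cvec D B (f k) l 0.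
have -> : minor (ZR W) (cvec D B \o f) = \det (ZR W) * \det C.
  rewrite -det_mulmx /minor; congr (\det _); apply/matrixP => i k.
  rewrite [LHS]mxE [LHS]mxE [RHS]mxE; apply: eq_bigr => l _.
  by congr (_ * _); rewrite [RHS]mxE.
have -> : \det C = D.1 * \prod_i D.2 i.
  rewrite det_trig; last first.
    apply/is_trig_mxP => i k ik; rewrite mxE.
    have : k != 0 by rewrite -val_eqE /= -lt0n (leq_ltn_trans _ ik).
    rewrite /f /ocons; case: unliftP => [a ka|->] //= _.
    by rewrite !mxE -ka -val_eqE /= (ltn_eqF ik) mulr0.
  have C0 : C 0 0 = D.1.
    rewrite /C mxE /f ocons0 /= !mxE eqxx summxE big1 ?addr0 ?mulr1 //.
    by move=> i _; rewrite !mxE /= mulr0.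
  have CS i : C (lift 0 i) (lift 0 i) = D.2 i.
    by rewrite /C mxE /f oconsS /= !mxE !eqxx mulr1.
  by rewrite big_ord_recl C0; congr (_ * _); apply: eq_bigr => i _; rewrite CS.
have P0 : 0 <= D.1 * \prod_i D.2 i by apply/ltW/mulr_gt0 => //; exact: prodr_gt0.
rewrite normrM [`|_ * \prod_i _|]ger0_norm //; apply: ler_peMl => //.
have : \det (ZR W) != 0 by rewrite -unitfE -unitmxE -row_free_unit.
rewrite det_map_mx -intr_norm intr_eq0 ler1z => h.
by rewrite -gtz0_ge1 normr_gt0.
Qed.

(** Adding a short [v] to the member [V] of rank [j] gives a sublattice [W] of rank [j.+1] that is
    comparable with the flag and below the threshold [K ^+ j.+1]. Either [W] has full rank and
    contradicts the covolume, or rank [j.+1] is missing and [W] contradicts maximality, or the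
    member of that rank spans the same space and is shorter than the lower bound assumed for it. *)
Lemma flag_vector_bound (K L c0 : R) D (B : @yball R n) (F : flag) :
  0 < K -> 0 < L -> 1 < c0 -> 0 < D.1 -> (forall i, 0 < D.2 i) ->
  flag_ok F -> maximal_upto n K D B F ->
  (forall j Z, F j = Some Z -> small (c0 * K ^+ j) D Z B) ->
  (forall j Z, F j = Some Z -> ~ small (n.+1%:R * c0 * L * K ^+ j.-1) D Z B) ->
  n.+1%:R * c0 * L <= K -> K ^+ n.+1 <= D.1 * \prod_i D.2 i ->
  forall v : 'rV[int]_n.+1, v != 0 -> ~ vsmall L D v B.
Proof.
move=> K0 L0 c1 D0 Di [ok1 ok2] mx sm nsm hK hP v v0 sv.
have Kj j : 0 < K ^+ j by rewrite exprn_gt0.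
(* V is the largest flag member not containing v, or 0. *)
have [j [Z [jn rfZ vZ smZ [jmax chain]]]] : exists j (Z : 'M[int]_(j, n.+1)),
  [/\ (j <= n)%N, row_free (ZR Z), ~~ (ZR v <= ZR Z)%MS, small (c0 * K ^+ j) D Z B &
    (forall i Zi, F i = Some Zi -> ~~ (ZR v <= ZR Zi)%MS -> (i <= j)%N) /\
    (forall i Zi, F i = Some Zi ->
      ((i <= j)%N -> (ZR Zi <= ZR Z)%MS) /\ ((j <= i)%N -> (ZR Z <= ZR Zi)%MS))].
  pose P j := `[< j = 0%N \/ exists Z, F j = Some Z /\ ~~ (ZR v <= ZR Z)%MS >].
  have exP : exists j, P j by exists 0%N; apply/asboolP; left.
  have Pn j : P j -> (j <= n)%N.
    by move/asboolP => [->//|[Z [/ok1[/andP[]]]]].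
  case: (ex_maxnP exP Pn) => j /asboolP Pj jmax'.
  have jmax i Zi : F i = Some Zi -> ~~ (ZR v <= ZR Zi)%MS -> (i <= j)%N.
    by move=> h1 h2; apply: jmax'; apply/asboolP; right; exists Zi.
  case: Pj => [j0|[Z [Fj vZ]]].
    rewrite j0 in jmax jmax' *.
    exists 0%N, (0 : 'M[_]_(0, n.+1)); split => //.
    - by rewrite /row_free -leqn0 rank_leq_row.
    - apply: contra v0 => /submxP[T]; rewrite [T]thinmx0 mul0mx => h.
      by apply/eqP/matrixP => a c; move/matrixP: h => /(_ a c); rewrite !mxE => /eqP; rewrite intr_eq0 => /eqP.
    - by move=> f af; rewrite /minor det_mx00 normr1 expr0 mulr1.
    split => // i Zi Fi; split; first by have [/andP[i0 _] _ _ i0'] := ok1 _ _ Fi; rewrite leqNgt i0 in i0'.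
    by rewrite flatmx0 sub0mx.
  have [/andP[j0 jn] rfZ red] := ok1 _ _ Fj.
  exists j, Z; split => //; first exact: sm.
  split => // i Zi Fi; split => h; exact: ok2 h.
set W : 'M[int]_(j.+1, n.+1) := col_mx v Z.
have WE : ZR W = (col_mx (ZR v) (ZR Z) : 'M[_]_(j.+1, n.+1)).
  exact: (map_col_mx (intr : int -> R) v Z).
have rfW : row_free (ZR W) by rewrite WE; exact: row_free_add.
have [vW ZW] : (ZR v <= ZR W)%MS /\ (ZR Z <= ZR W)%MS.
  by rewrite WE; apply/andP; rewrite -(col_mx_sub (ZR v) (ZR Z)) submx_refl.
have Wsub m (A : 'M[_]_(m, n.+1)) : (ZR v <= A)%MS -> (ZR Z <= A)%MS -> (ZR W <= A)%MS.
  by move=> h1 h2; rewrite WE; have := col_mx_sub (ZR v) (ZR Z) A; rewrite h1 h2.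
have cmpW : comparable F W.
  move=> i Zi Fi; have [h1 h2] := chain _ _ Fi.
  have [ij|ij] := leqP i j.
    by split => [_|//]; exact: submx_trans (h1 ij) ZW.
  have vZi : (ZR v <= ZR Zi)%MS.
    by apply: contraT => /(jmax _ _ Fi); rewrite leqNgt ij.
  have WZi : (ZR W <= ZR Zi)%MS by apply: Wsub => //; apply: h2; exact: ltnW.
  split => // h; have [_ rfi _] := ok1 _ _ Fi.
  by rewrite -(mxrank_leqif_sup WZi) (eqP rfi) (eqP rfW) eqn_leq h ij.
have smW : small (j.+1%:R * (c0 * K ^+ j) * L) D W B.
  by apply: small_col_mx => //; rewrite mulr_gt0 // (lt_trans _ c1).
have smW' : small (n.+1%:R * c0 * L * K ^+ j) D W B.
  apply: small_le smW.
  rewrite [leRHS]mulrAC -!mulrA ler_wpM2r //; last by rewrite ler_nat ltnS.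
  by rewrite !mulr_ge0 // ?ltW // (lt_trans _ c1).
have smW'' : small (K ^+ j.+1) D W B.
  by apply: small_le smW'; rewrite exprS ler_wpM2r // ltW.
move: jn; rewrite leq_eqVlt => /orP[/eqP jn|jn].
  clearbody W; clear smW smW' mx sm nsm cmpW Wsub WE vW ZW.
  move: W rfW smW''; rewrite jn => W rfW s.
  have [f af hf] := full_minor B rfW D0 Di.
  by have := lt_le_trans (s f af) (le_trans hP hf); rewrite ltxx.
case E : (F j.+1) => [U|]; last exact: mx E rfW cmpW smW''.
have [_ rfU redU] := ok1 _ _ E.
apply: (nsm _ _ E) => /=; apply: (small_span redU rfW) smW'.
by apply: (cmpW _ _ E).2.
Qed.

End Flags.

(** * Affine forms from minors, and short vectors in short sublattices *)

Section Emission.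
Context {R : realType} {n : nat}.
Notation ZR := (map_mx (intr : int -> R)).

Definition dot (a y : 'rV[R]_n) : R := \sum_i a 0 i * y 0 i.

Lemma not_small_minor X D j (Z : 'M[int]_(j, n.+1)) (B : yball) :
  ~ small X D Z B -> exists2 f : 'I_j -> coord, adm f &
    X <= `|minor (ZR Z) (cvec D B \o f)|.
Proof.
move=> h; apply: contrapT => h'; apply: h => f af.
by rewrite ltNge; apply/negP => h; apply: h'; exists f.
Qed.

(** A minor without special column does not depend on the ball, so it stays large. With a special
    column it is an affine form in the centre, and its coefficients are the minors where that column
    is a variation column. If all coefficients are small on the scale of [B], the value itself is
    large and cannot halve within distance [C * B.2]; otherwise this form is the one to announce. *)
Lemma emission_dichotomy X (C : R) D j (Z : 'M[int]_(j, n.+1)) (B : yball) :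
  (0 < n)%N -> 0 < X -> 1 <= C -> 0 < B.2 -> ~ small X D Z B ->
  (exists (a : 'rV[R]_n) (b : R) (i : 'I_n),
     X / (2 * n%:R * C) <= B.2 * `|a 0 i| /\
     forall e (B' : yball), 0 < B'.2 -> small e D Z B' ->
       `|dot a B'.1 + b| < e /\ B'.2 * `|a 0 i| < e) \/
  (forall B' : yball, 0 < B'.2 -> (forall i, `|B'.1 0 i - B.1 0 i| <= C * B.2) ->
     ~ small (X / 2) D Z B').
Proof.
move=> n0 X0 C1 r0 /not_small_minor[f af hf].
have n1 : 1 <= n%:R :> R by rewrite ler1n.
have [[k sk]|ns] := pselect (exists k, special (f k)); last first.
  right=> B' _ _ s.
  have e : cvec D B \o f = cvec D B' \o f.
    apply/funext => k /=; have : ~ special (f k) by move=> h; apply: ns; exists k.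
    by case: (f k) => [[[] i]|] //= h; case: h.
  by have := s f af; rewrite -e; lra.
have eB (B' : yball) c : cvec D B' \o upd f k c = upd (cvec D B \o f) k (cvec D B' c).
  rewrite comp_upd; apply/funext => i /=; rewrite /upd; case: eqP => [//|ik] /=.
  have : ~ special (f i) by move=> si; apply: ik; exact: af.
  by case: (f i) => [[[] i']|] //= h; case: h.
set g := cvec D B \o f.
pose a : 'rV[R]_n := \row_i (D.1 * minor (ZR Z) (upd g k (delta_mx (lift 0 i) 0))).
pose b := minor (ZR Z) (upd g k (D.1 *: delta_mx 0 0)).
have minZ c u : minor (ZR Z) (upd g k (c *: u)) = c * minor (ZR Z) (upd g k u).
  have := minor_updD (ZR Z) g k 0 (fun _ : 'I_1 => c) (fun _ => u).
  have h0 : minor (ZR Z) (upd g k 0) = 0.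
    by rewrite minor_upd big1 // => i _; rewrite mulmx0 mxE mul0r.
  by rewrite !big_ord1 add0r h0 add0r.
have phiE (B' : yball) : minor (ZR Z) (upd g k (cvec D B' None)) = dot a B'.1 + b.
  rewrite /= scalerDr scaler_sumr.
  under eq_bigr do rewrite scalerA.
  rewrite minor_updD addrC; congr (_ + _); apply: eq_bigr => i _.
  by rewrite !mxE; ring.
have ghE (B' : yball) i : minor (ZR Z) (upd g k (cvec D B' (Some (true, i)))) = B'.2 * a 0 i.
  by rewrite /= minZ mxE; ring.
have sphi e (B' : yball) : small e D Z B' -> `|dot a B'.1 + b| < e.
  by move=> s; rewrite -phiE -eB; apply: s; apply: adm_upd.
have [[i hi]|hi] := pselect (exists i, X / (2 * n%:R * C) <= B.2 * `|a 0 i|).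
  left; exists a, b, i; split => // e B' r0' s; split; first exact: sphi.
  have -> : B'.2 * `|a 0 i| = `|B'.2 * a 0 i| by rewrite normrM gtr0_norm.
  by rewrite -ghE -eB; apply: s; apply: adm_upd.
have {}hi i : B.2 * `|a 0 i| < X / (2 * n%:R * C).
  by rewrite ltNge; apply/negP => h; apply: hi; exists i.
have nC0 : 0 < 2 * n%:R * C by rewrite mulr_gt0 // ?mulr_gt0 //; lra.
have nC1 : 1 <= 2 * n%:R * C.
  have : 1 <= n%:R * C by apply: mulr_ege1.
  by rewrite -mulrA; lra.
right=> B' r0' hB' /sphi s.
have gE : g = upd g k (cvec D B (f k)) := esym (upd_id g k).
have fk : f k = None.
  case E : (f k) sk => [[[] i]|] // _.
  move: hf; rewrite -/g gE E ghE normrM gtr0_norm // => h.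
  have h3 : X / (2 * n%:R * C) <= X by rewrite ler_pdivrMr // ler_peMr // ltW.
  by have := lt_le_trans (le_lt_trans h (hi i)) h3; rewrite ltxx.
move: hf; rewrite -/g gE fk phiE => h.
have h2 : `|dot a B.1 - dot a B'.1| <= X / 2.
  rewrite /dot -sumrB; apply: le_trans (ler_norm_sum _ _ _) _.
  have -> : X / 2 = \sum_(i < n) (X / (2 * n%:R * C) * C).
    rewrite sumr_const card_ord -mulr_natl; field.
    by rewrite !gt_eqF //; lra.
  apply: ler_sum => i _; rewrite -mulrBr normrM distrC.
  apply: le_trans (_ : `|a 0 i| * (C * B.2) <= _); first exact: ler_wpM2l (hB' i).
  have -> : `|a 0 i| * (C * B.2) = (B.2 * `|a 0 i|) * C by ring.
  by rewrite ler_wpM2r // ?ltW //; lra.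
have := ler_normD (dot a B'.1 + b) (dot a B.1 - dot a B'.1).
have -> : dot a B'.1 + b + (dot a B.1 - dot a B'.1) = dot a B.1 + b by ring.
by lra.
Qed.

(** Minkowski's theorem is applied to the coordinates [None] and [(false, i)]: a nonzero minor uses
    [None] at most once, so it is admissible and bounded by the minor of [fs]. The variation
    coordinates then follow from Cramer's rule along [fs], which costs the factor [j]. *)
Lemma short_vector (mu : R) D j (Z : 'M[int]_(j, n.+1)) (B : yball)
    (fs : 'I_j -> coord) :
  0 < mu -> (forall k, ~~ special (fs k)) ->
  0 < `|minor (ZR Z) (cvec D B \o fs)| ->
  (forall f, adm f -> `|minor (ZR Z) (cvec D B \o f)| <=
                      `|minor (ZR Z) (cvec D B \o fs)|) ->
  `|minor (ZR Z) (cvec D B \o fs)| < 4^-1 ^+ (j * j) * mu ^+ j ->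
  exists2 x : 'rV[int]_j, x != 0 & vsmall (j.+1%:R * mu) D (x *m Z) B.
Proof.
move=> mu0 nsp X0 hmax hX.
pose emb (c : option 'I_n) : coord := omap (fun i => (false, i)) c.
pose Y i c := (ZR Z *m cvec D B (emb c)) i 0.
have combE x c : comb Y x c = (ZR (x *m Z) *m cvec D B (emb c)) 0 0.
  rewrite map_mxM -mulmxA [RHS]mxE; apply: eq_bigr => i _.
  by congr (_ * _); rewrite [RHS]mxE.
have [x x0 hx] : exists2 x : 'rV[int]_j, x != 0 & forall c, `|comb Y x c| < mu.
  apply: contrapT => h.
  have [|f] := minkowski mu0 (Y := Y).
    move=> x x0; apply: contrapT => h'; apply: h; exists x => // c.
    by rewrite ltNge; apply/negP => h; apply: h'; exists c.
  apply/negP; rewrite -ltNge; apply: le_lt_trans hX.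
  have -> : \det (\matrix_(i, k) Y i (f k)) = minor (ZR Z) (cvec D B \o (emb \o f)) by [].
  have [[k [k' [kk' e1 e2]]]|inj] := pselect (exists k k', [/\ k != k', f k = None & f k' = None]).
    rewrite /minor -det_tr (determinant_alternate kk') ?normr0 // => i.
    by rewrite !mxE /= e1 e2.
  apply: hmax => k k' /=; case E : (f k) => //; case E' : (f k') => // _ _.
  by apply: contrapT => /eqP h'; apply: inj; exists k, k'.
exists x => // c.
have j1 : mu <= j.+1%:R * mu by rewrite ler_peMl ?ler1n // ltW.
case: c => [[[] i]|]; last 2 first.
- by have := hx (Some i); rewrite combE => h; apply: lt_le_trans j1.
- by have := hx None; rewrite combE => h; apply: lt_le_trans j1.
set u := cvec D B _.
have := minor_cramer (ZR Z) (cvec D B \o fs) (ZR x) u.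
rewrite -map_mxM => /(congr1 Num.norm); rewrite normrM => e.
apply: le_lt_trans (_ : j%:R * mu < _); last by rewrite ltr_pM2r // ltr_nat.
rewrite -(ler_pM2l X0) e; apply: le_trans (ler_norm_sum _ _ _) _.
have -> : `|minor (ZR Z) (cvec D B \o fs)| * (j%:R * mu) =
   \sum_(k < j) (mu * `|minor (ZR Z) (cvec D B \o fs)|).
  by rewrite sumr_const card_ord -mulr_natl; ring.
apply: ler_sum => k _; rewrite normrM; apply: ler_pM => //.
- apply: ltW; have nk := nsp k; rewrite /=; case E : (fs k) nk => [[[] i']|] // _.
  by have := hx (Some i'); rewrite combE.
- rewrite -comp_upd; apply: hmax => k1 k2; rewrite /upd.
  case: eqP => [->|_]; case: eqP => [->|_] //=; rewrite ?(negbTE (nsp _)) //.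
Qed.

End Emission.

(** * The flag construction along a sequence of balls *)

Section Machine.
Context {R : realType} {n : nat}.
Notation ZR := (map_mx (intr : int -> R)).

Variables (w : 'I_n -> R) (i1 : 'I_n) (g lam C eta : R) (M : nat).
Hypotheses (w0 : forall i, 0 < w i) (w1 : \sum_i w i = 1)
  (wmax : forall i, w i <= w i1) (g0 : 0 < g) (lam01 : 0 < lam < 1)
  (C1 : 1 <= C) (eta0 : 0 < eta) (eta1 : 2 * eta * n.+1%:R <= 1).

Definition base_pow (x : R) : R := expR (g * x).
Definition max_rate : R := 1 + w i1.
(** Absorbs every change of ball: from a ball back to its predecessor ([small_step]), and forward to
    any later ball ([small_mono]). *)
Definition drift : R := (1 + n%:R * C) / lam.
(* At stage p a sublattice of rank j is called short when its admissible minors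
   are below (gauge p)^j; vectors are kept longer than margin p. *)
Definition gauge (p : nat) : R := base_pow (2 * eta * p%:R).
Definition margin (p : nat) : R := base_pow (eta * p%:R).
(** The bound obtained for the minors of rank [j] when a vector of length [margin p] is added to a
    member of rank [j.-1]; a member of rank [j] must never fall below it. *)
Definition eps (p j : nat) : R := n.+1%:R * drift * margin p * gauge p ^+ j.-1.
(** The inflation by [base_pow (p - w i1 * t)] makes the covolume at least [base_pow p], so that the
    full lattice is never short at stage [p]. It is harmless while the stage is alive, since the
    variation columns then dominate the inflated entries. *)
Definition flow_wts (t p : nat) : @wts R n :=
  (base_pow t%:R, fun i => Num.max (base_pow (- (w i * t%:R))) (base_pow (p%:R - w i1 * t%:R))).
(** [r * base_pow (max_rate * t)] is the ratio of the scale of the variation column to that of the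
    coefficient column for the largest weight [w i1]. It decreases along the play, so a time enters
    this window from above and leaves it below. *)
Definition stage_alive (t p : nat) (r : R) : bool :=
  base_pow p%:R <= r * base_pow (max_rate * t%:R) <= base_pow (M * p)%:R.

Lemma pw_gt0 x : 0 < base_pow x. Proof. exact: expR_gt0. Qed.
Lemma pwD x y : base_pow (x + y) = base_pow x * base_pow y. Proof. by rewrite /base_pow mulrDr expRD. Qed.
Lemma pwN x : base_pow (- x) = (base_pow x)^-1. Proof. by rewrite /base_pow mulrN expRN. Qed.
Lemma pw0 : base_pow 0 = 1. Proof. by rewrite /base_pow mulr0 expR0. Qed.
Lemma pw_le x y : (base_pow x <= base_pow y) = (x <= y).
Proof. by rewrite /base_pow ler_expR ler_pM2l. Qed.
Lemma pw_lt x y : (base_pow x < base_pow y) = (x < y).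
Proof. by rewrite /base_pow ltr_expR ltr_pM2l. Qed.
Lemma pwX x j : base_pow x ^+ j = base_pow (j%:R * x).
Proof. by rewrite /base_pow -expRM_natl; congr expR; ring. Qed.
Lemma pw_ge1 x : (1 <= base_pow x) = (0 <= x). Proof. by rewrite -pw0 pw_le. Qed.

Lemma n_gt0 : (0 < n)%N. Proof. by case: n i1 => // -[]. Qed.
Lemma n_ge1 : 1 <= n%:R :> R. Proof. by rewrite ler1n n_gt0. Qed.
Lemma lam_gt0 : 0 < lam. Proof. by case/andP: lam01. Qed.
Lemma nC_ge1 : 1 <= n%:R * C. Proof. exact: mulr_ege1 n_ge1 C1. Qed.
Lemma c0_gt1 : 1 < drift.
Proof.
have := nC_ge1; case/andP: lam01 => l0 l1; rewrite /drift ltr_pdivlMr // => h; lra.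
Qed.
Lemma c0_ge : 1 + n%:R * C <= drift.
Proof.
have := nC_ge1; case/andP: lam01 => l0 l1 h.
by rewrite /drift ler_pdivlMr // ler_piMr //; lra.
Qed.
Lemma c0_inv : lam^-1 <= drift.
Proof.
by have := nC_ge1; rewrite /drift => h; rewrite ler_peMl ?invr_ge0 ?(ltW lam_gt0) //; lra.
Qed.
Lemma c0_step : 1 + n%:R * C / lam <= drift.
Proof.
rewrite /drift mulrDl mul1r lerD2r -[leLHS]invr1 lef_pV2 ?posrE ?ltr01 ?lam_gt0 //.
by case/andP: lam01 => _ /ltW.
Qed.

Definition ext (X : R) D B (F : flag) : @flag n :=
  if pselect (flag_ok (R := R) F) is left ok then projT1 (cid (flag_extend X D B ok))
  else F.

Fixpoint state (t p : nat) (h : seq (@yball R n)) : @flag n :=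
  if h is B :: h' then
    if stage_alive t p B.2 then ext (gauge p) (flow_wts t p) B (state t p h') else @flag0 n
  else @flag0 n.

Lemma flag0_ok : flag_ok (R := R) (@flag0 n).
Proof. by []. Qed.

Lemma extP X D B (F : flag) : flag_ok (R := R) F ->
  let F' := ext X D B F in [/\ flag_ok (R := R) F', subflag F F',
    (forall j Z, F' j = Some Z -> F j = None -> small (X ^+ j) D Z B) &
    maximal_upto n X D B F'].
Proof. by rewrite /ext; case: pselect => // ok _; case: cid. Qed.

Lemma state_ok t p h : flag_ok (R := R) (state t p h).
Proof.
elim: h => [|B h IH] /=; first exact: flag0_ok.
by case: ifP => _; [have [] := extP (gauge p) (flow_wts t p) B IH|exact: flag0_ok].
Qed.

(** The announced form [x] is recorded through what it must detect later: on any ball where the new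
    member [Z] is shorter than [e], both the value and the variation of the form are below [e]. *)
Definition emits (t p j : nat) (h : seq yball) (x : 'rV[R]_n * R * 'I_n) : Prop :=
  if h is B :: h' then
    exists Z, [/\ state t p h' j = None, state t p h j = Some Z,
      gauge p ^+ j / drift / (2 * n%:R * C) <= B.2 * `|x.1.1 0 x.2| &
      forall e (B' : yball), 0 < B'.2 -> small e (flow_wts t p) Z B' ->
       `|dot x.1.1 B'.1 + x.1.2| < e /\ B'.2 * `|x.1.1 0 x.2| < e]
  else False.

Definition emission (t p j : nat) (h : seq yball) : option ('rV[R]_n * R * 'I_n) :=
  if pselect (exists x, emits t p j h x) is left ex then Some (projT1 (cid ex)) else None.

Lemma emissionP t p j h x : emission t p j h = Some x -> emits t p j h x.
Proof. by rewrite /emission; case: pselect => // ex [<-]; case: cid. Qed.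

Variable B : nat -> @yball R n.
Hypotheses (r_gt0 : forall m, 0 < (B m).2)
  (r_lam : forall m, lam * (B m).2 <= (B m.+1).2)
  (r_half : forall m, (B m.+1).2 <= 2^-1 * (B m).2)
  (y_near : forall m m' i, (m <= m')%N ->
     `|(B m').1 0 i - (B m).1 0 i| <= C * (B m).2).

Fixpoint hist (m : nat) : seq yball :=
  B m :: (if m is m'.+1 then hist m' else [::]).

Definition prev (m : nat) : seq yball := if m is m'.+1 then hist m' else [::].

Lemma histE m : hist m = B m :: prev m. Proof. by case: m. Qed.

Variable p0 : nat.
(** What the potential game delivers: the centre of a later ball can lie in the slab only while the
    form still varies by at least the width of the slab on that ball. *)
Hypothesis promise : forall t p j m x, (p0 <= p)%N -> (0 < j <= n)%N ->
  stage_alive t p (B m).2 -> emission t p j (hist m) = Some x ->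
  forall m', (m <= m')%N -> `|dot x.1.1 (B m').1 + x.1.2| < eps p j ->
    eps p j <= (B m').2 * `|x.1.1 0 x.2|.

Hypothesis big_A : forall p, (p0 <= p)%N -> 2 * n.+1%:R * drift ^+ 2 <= margin p.

Definition start_unobstructed t p m : Prop :=
  stage_alive t p (B m).2 -> (if m is m'.+1 then ~~ stage_alive t p (B m').2 else true) ->
  forall j (Z : 'M[int]_(j, n.+1)), (0 < j <= n)%N -> row_free (ZR Z) ->
    ~ small (gauge p ^+ j) (flow_wts t p) Z (B m).

Definition inv t p m : Prop :=
  forall j Z, state t p (hist m) j = Some Z -> exists m0, [/\ (m0 <= m)%N,
    stage_alive t p (B m0).2, state t p (prev m0) j = None,
    state t p (hist m0) j = Some Z & (small (gauge p ^+ j) (flow_wts t p) Z (B m0) /\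
    ~ small (gauge p ^+ j / drift) (flow_wts t p) Z (B m0))].

Lemma K_gt0 p : 0 < gauge p. Proof. exact: pw_gt0. Qed.
Lemma Kj_gt0 p j : 0 < gauge p ^+ j. Proof. by rewrite exprn_gt0 // K_gt0. Qed.
Lemma K_eq p : gauge p = margin p ^+ 2.
Proof. by rewrite /gauge /margin pwX; congr base_pow; ring. Qed.

Lemma r_le m m' : (m <= m')%N -> (B m').2 <= (B m).2.
Proof.
move=> /subnKC <-; elim: (m' - m)%N => [|k IH]; first by rewrite addn0.
rewrite addnS (le_trans (r_half _)) // (le_trans _ IH) // ler_piMl ?ltW //.
by rewrite invf_lt1 // ltr1n.
Qed.

Lemma small_step t p X j (Z : 'M[int]_(j, n.+1)) m :
  small (X / drift) (flow_wts t p) Z (B m.+1) -> small X (flow_wts t p) Z (B m).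
Proof.
have c00 : drift != 0 by rewrite gt_eqF // (lt_trans _ c0_gt1).
have hr : (B m).2 / (B m.+1).2 <= lam^-1.
  by rewrite ler_pdivrMr // mulrC ler_pdivlMr ?lam_gt0 // mulrC.
move=> s; rewrite -(divfK c00 X) mulrC.
apply: (small_chg (Delta := C * (B m).2)) s => //.
- by move=> i; rewrite distrC; exact: y_near.
- apply: le_trans c0_step; rewrite lerD2l.
  rewrite mulrA -mulrA; apply: ler_wpM2l => //.
  by rewrite (le_trans ler01) // nC_ge1.
- exact: le_trans hr c0_inv.
exact: ltW c0_gt1.
Qed.

Lemma small_mono t p X j (Z : 'M[int]_(j, n.+1)) m m' : (m <= m')%N ->
  small X (flow_wts t p) Z (B m) -> small (drift * X) (flow_wts t p) Z (B m').
Proof.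
move=> mm'; apply: (small_chg (Delta := C * (B m).2)) => //.
- by move=> i; exact: y_near.
- by rewrite mulrA mulfK ?gt_eqF // c0_ge.
- by rewrite (le_trans _ (ltW c0_gt1)) // ler_pdivrMr // mul1r r_le.
exact: ltW c0_gt1.
Qed.

Lemma alive_state t p m : stage_alive t p (B m).2 ->
  state t p (hist m) = ext (gauge p) (flow_wts t p) (B m) (state t p (prev m)).
Proof. by rewrite histE /= => ->. Qed.

(** A member that joins at [m.+1] is comparable with the flag at [m], which was maximal, so it was
    not short at [m]; one step changes minors by at most [drift], whence the lower bound at the
    moment of joining. At the ball that opens the window nothing can join, by
    [start_unobstructed]. *)
Lemma inv_starts t p m : stage_alive t p (B m).2 ->
  (forall m', (m' <= m)%N -> start_unobstructed t p m') -> inv t p m.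
Proof.
elim: m => [|m IH] al st.
  move=> j Z hZ; exfalso.
  have [ok _ sm _] := extP (gauge p) (flow_wts t p) (B 0) flag0_ok.
  have hZ' := hZ; rewrite alive_state // in hZ'.
  have [jn rf _] := ok.1 _ _ hZ'.
  by apply: (st 0%N (leqnn _) al isT j Z jn rf); apply: sm hZ' erefl.
have [ok sub sm _] := extP (gauge p) (flow_wts t p) (B m.+1) (state_ok t p (hist m)).
move=> j Z hZ; have hZ' := hZ; rewrite alive_state // in hZ'.
have [jn rf _] := ok.1 _ _ hZ'.
have [alm|nal] := boolP (stage_alive t p (B m).2); last first.
  exfalso; apply: (st m.+1 (leqnn _) al nal j Z jn rf).
  by apply: sm hZ' _ => /=; rewrite histE /= (negbTE nal).
case E : (state t p (hist m) j) => [Z0|].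
  have e : Some Z0 = Some Z by rewrite -hZ' (sub _ _ E).
  case: e => e; rewrite {}e in E.
  have [|m0 [h1 h2 h3 h4 h5]] := IH alm _ j Z E.
    by move=> m' hm'; apply: st; exact: leqW.
  by exists m0; split => //; exact: leqW.
exists m.+1; split => //; split; first exact: sm hZ' E.
move=> /small_step; have [okm _ _ mx] := extP (gauge p) (flow_wts t p) (B m) (state_ok t p (prev m)).
rewrite -alive_state // in mx; apply: (mx _ _ jn E rf).
move=> i Zi Fi; have Fi' := sub _ _ Fi.
by split => h; [apply: ok.2 Fi' hZ' h|apply: ok.2 hZ' Fi' h].
Qed.

Lemma c0_gt0 : 0 < drift. Proof. exact: lt_trans ltr01 c0_gt1. Qed.

(** A member shorter than [eps] would bring both the value and the variation of its announced form
    below [eps], against [promise]. If the dichotomy provided no form, the member cannot even halve.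
    The hypotheses of [flag_vector_bound] are thus met. *)
Lemma protected_inv t p m : (p0 <= p)%N -> stage_alive t p (B m).2 -> inv t p m ->
  forall v : 'rV[int]_n.+1, v != 0 -> ~ vsmall (margin p) (flow_wts t p) v (B m).
Proof.
move=> pp0 al iv.
have [ok _ _ mx] := extP (gauge p) (flow_wts t p) (B m) (state_ok t p (prev m)).
rewrite -alive_state // in ok mx.
have LA := big_A pp0.
have L0 : 0 < margin p := pw_gt0 _.
have c01 := c0_gt1.
have n10 : 0 < n.+1%:R :> R by [].
have c02 : drift <= drift ^+ 2 by rewrite expr2 ler_pMl ?c0_gt0 // ltW.
have KA : 2 * n.+1%:R * drift ^+ 2 * margin p <= gauge p by rewrite K_eq expr2 ler_wpM2r // ltW.
have KA' : n.+1%:R * drift * margin p <= gauge p.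
  apply: le_trans KA; apply: ler_wpM2r; first exact: ltW.
  apply: le_trans (_ : _ <= n.+1%:R * drift ^+ 2) _; first by rewrite ler_wpM2l.
  apply: ler_wpM2r; first exact/exprn_ge0/ltW/c0_gt0.
  by rewrite ler_peMl // ler1n.
apply: (flag_vector_bound (K := gauge p) (c0 := drift) (F := state t p (hist m))) => //.
- exact: K_gt0.
- exact: pw_gt0.
- by move=> i; rewrite lt_max pw_gt0.
- move=> j Z /iv[m0 [h1 h2 h3 h4 [h5 h6]]].
  exact: small_mono h1 h5.
- move=> j Z hZ s; have [m0 [h1 h2 h3 h4 [h5 h6]]] := iv j Z hZ.
  have [jn _ _] := ok.1 _ _ hZ; have j0 : (0 < j)%N by case/andP: jn.
  have X0 : 0 < gauge p ^+ j / drift by rewrite divr_gt0 ?Kj_gt0 // c0_gt0.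
  have [[a [b [i [ha hb]]]]|nsm] :=
      emission_dichotomy n_gt0 X0 C1 (r_gt0 m0) h6.
    have ex : exists x, emits t p j (hist m0) x.
      by exists (a, b, i); rewrite histE; exists Z; split => //; rewrite -histE.
    have [x hx] : exists x, emission t p j (hist m0) = Some x.
      by rewrite /emission; case: pselect => // ex'; eexists.
    have := emissionP hx; rewrite {1}histE => -[Z' []].
    rewrite -histE h4 => _ [e] _ hs; rewrite -{Z'}e in hs.
    have [q1 q2] := hs (eps p j) (B m) (r_gt0 m) s.
    have := promise pp0 jn h2 hx h1 q1; by rewrite leNgt q2.
  apply: (nsm (B m)) => //; first by move=> i; exact: y_near.
  apply: small_le s; rewrite ler_pdivlMr // ler_pdivlMr ?c0_gt0 //.
  rewrite -(prednK j0) exprS.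
  apply: le_trans (_ : _ <= (2 * n.+1%:R * drift ^+ 2 * margin p) * gauge p ^+ j.-1) _.
    by rewrite le_eqVlt; apply/orP; left; apply/eqP; ring.
  by rewrite ler_wpM2r // ltW // Kj_gt0.
(* As the weights add up to 1, the uninflated covolume is 1; inflating the single entry [i1] already
   raises it to [base_pow p], and [eta1] puts [gauge p ^+ n.+1] below that. *)
have PE : \prod_i base_pow (- (w i * t%:R)) = base_pow (- t%:R).
  rewrite /base_pow -expR_sum; congr expR; rewrite -mulr_sumr sumrN -mulr_suml w1 mul1r.
  by rewrite mulrN.
rewrite /gauge pwX.
apply: le_trans (_ : _ <= base_pow p%:R) _.
  by rewrite pw_le mulrA mulrC ler_piMr //; move: eta1; rewrite mulrC.
have -> : base_pow p%:R = base_pow t%:R * (base_pow (p%:R - w i1 * t%:R) * base_pow (w i1 * t%:R) * base_pow (- t%:R)).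
  by rewrite -!pwD; congr base_pow; ring.
apply: ler_wpM2l; first exact/ltW/pw_gt0.
rewrite /= -PE (bigD1 i1) //= [leRHS](bigD1 i1) //=.
rewrite mulrA -[base_pow _ * base_pow _ * base_pow _]mulrA -pwD subrr pw0 mulr1.
apply: ler_pM; [exact/ltW/pw_gt0| |by rewrite le_max lexx orbT|].
  by apply: prodr_ge0 => *; exact/ltW/pw_gt0.
by apply: ler_prod => i _; rewrite ltW ?pw_gt0 //= le_max lexx.
Qed.

End Machine.

(** * Following a short sublattice backwards in time *)

Section Crossing.
Context {R : realType} {n : nat}.
Notation ZR := (map_mx (intr : int -> R)).
Variables (w : 'I_n -> R) (g wmin : R).
Hypotheses (n0 : (0 < n)%N) (w1 : \sum_i w i = 1) (g0 : 0 < g) (wmin0 : 0 < wmin)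
  (wminP : forall i, wmin <= w i).

Local Notation pw := (base_pow g).

(** The flow without inflation: a change of time multiplies each column by an exact factor. *)
Definition plain_wts (t : nat) : @wts R n := (pw t%:R, fun i => pw (- (w i * t%:R))).
Local Notation plain := plain_wts.

Lemma w_gt0 i : 0 < w i. Proof. exact: lt_le_trans (wminP i). Qed.

Lemma sum_inj j (P : pred 'I_j) (h : 'I_j -> 'I_n) i :
  {in P &, injective h} -> (forall k, P k -> h k != i) ->
  \sum_(k | P k) w (h k) <= 1 - w i.
Proof.
move=> inj hi; rewrite -w1 (bigD1 i) //= addrC addrK.
rewrite -(big_imset w inj) /=; set A := imset _ _.
rewrite [leRHS](bigID (fun i' => i' \in A)) /=.
rewrite -[leLHS]addr0 lerD //; last by apply: sumr_ge0 => i' _; exact/ltW/w_gt0.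
rewrite le_eqVlt; apply/orP; left; apply/eqP; apply: eq_bigl => i'.
case i'A : (i' \in A); rewrite ?andbF ?andbT //.
by have /imsetP[k Pk ->] := i'A; rewrite hi.
Qed.

Lemma sum_inj1 j (h : 'I_j -> 'I_n) : injective h -> \sum_k w (h k) <= 1.
Proof.
case: j h => [|j] h inj; first by rewrite big_ord0.
rewrite (bigD1 ord0) //= -lerBrDl; apply: sum_inj => [x y _ _|k k0]; first exact: inj.
by apply: contra_neq k0; apply: inj.
Qed.

Lemma minor_eq_col j m (Z : 'M[R]_(j, m)) F k k' :
  k != k' -> F k = F k' -> minor Z F = 0.
Proof.
move=> kk' e; rewrite /minor -det_tr (determinant_alternate kk') // => i.
by rewrite !mxE e.
Qed.

Definition scl (s : nat) (c : @coord n) : R :=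
  if c is Some (false, i) then pw (w i * s%:R) else pw (- s%:R).

Lemma scl_gt0 s c : 0 < scl s c.
Proof. by rewrite /scl; case: c => [[[] i]|]; exact: pw_gt0. Qed.

Lemma cvec_plain t s (B : @yball R n) c :
  cvec (plain t) B c = scl s c *: cvec (plain (t + s)) B c.
Proof.
case: c => [[[] i]|]; rewrite /= ?scalerA; congr (_ *: _).
- by rewrite mulrA -pwD; congr (pw _ * _); rewrite natrD; ring.
- by rewrite -pwD; congr (pw _); rewrite natrD; ring.
- by rewrite -pwD; congr (pw _); rewrite natrD; ring.
Qed.

Lemma minor_plain t s j (Z : 'M[R]_(j, n.+1)) (B : @yball R n) (f : 'I_j -> coord) :
  minor Z (cvec (plain t) B \o f) =
  (\prod_k scl s (f k)) * minor Z (cvec (plain (t + s)) B \o f).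
Proof.
rewrite -minor_scale; congr minor; apply/funext => k /=; exact: cvec_plain.
Qed.

Lemma nspecial_fun j (P : pred 'I_j) (f : 'I_j -> @coord n) :
  (forall k, P k -> ~~ special (f k)) ->
  exists h : 'I_j -> 'I_n, forall k, P k -> f k = Some (false, h k).
Proof.
move=> nsp; have i0 : 'I_n := Ordinal n0.
exists (fun k => if f k is Some (_, i) then i else i0) => k /nsp.
by case: (f k) => [[[] i]|].
Qed.

(** Going back by [s] multiplies the special column by [pw (- s)] and a column [(false, i)] by
    [pw (w i * s)]. Besides the special column at most [n - 1] distinct indices occur (a repetition
    makes the minor vanish), so some weight, at least [wmin], is missing from the exponent. *)
Lemma special_decay t s j (Z : 'M[R]_(j, n.+1)) (B : @yball R n) (f : 'I_j -> coord) k :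
  (j <= n)%N -> adm f -> special (f k) ->
  `|minor Z (cvec (plain t) B \o f)| <=
  pw (- (s%:R * wmin)) * `|minor Z (cvec (plain (t + s)) B \o f)|.
Proof.
move=> jn af sk; rewrite (minor_plain t s) normrM.
have [[a [c [ac e]]]|inj] := pselect (exists a c, a != c /\ f a = f c).
  by rewrite (minor_eq_col _ ac) ?normr0 ?mulr0 //= e.
rewrite ler_wpM2r // ger0_norm; last first.
  by apply: prodr_ge0 => *; exact/ltW/scl_gt0.
have [h hE] : exists h : 'I_j -> 'I_n, forall k', k' != k -> f k' = Some (false, h k').
  apply: nspecial_fun => k' kk'; apply: contra kk' => sk'; apply/eqP; exact: af.
have [i hi] : exists i, forall k', k' != k -> h k' != i.
  apply: contrapT => H.
  have : (#|'I_n| <= #|[set h k' | k' in [set~ k]]%SET|)%N.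
    apply: subset_leq_card; apply/fintype.subsetP => i _; apply: contrapT => Hi; apply: H.
    exists i => k' kk'; apply/eqP => e; apply: Hi; apply/imsetP; exists k' => //.
    by rewrite !inE.
  rewrite card_ord => H1; have := leq_trans H1 (leq_imset_card _ _).
  have j0 : (0 < j)%N := leq_ltn_trans (leq0n k) (ltn_ord k).
  by rewrite cardsC1 card_ord => H2; move: jn j0 H2; lia.
rewrite (bigD1 k) //=.
have -> : scl s (f k) = pw (- s%:R).
  by case: (f k) sk => [[[] ?]|].
rewrite (eq_bigr (fun k' => expR (g * (w (h k') * s%:R)))); last first.
  by move=> k' /hE ->.
rewrite -expR_sum -mulr_sumr -mulr_suml -/(pw _) -pwD pw_le //.
have : \sum_(k' | k' != k) w (h k') <= 1 - w i.
  apply: sum_inj => [a c ha hc e|]; last exact: hi.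
  apply: contrapT => /eqP ac; apply: inj; exists a, c; split => //.
  by rewrite !hE // e.
have := wminP i => h1 h2.
have : (1 - \sum_(k' | k' != k) w (h k')) * s%:R >= wmin * s%:R.
  by rewrite ler_wpM2r //; lra.
lra.
Qed.

Lemma nspecial_growth t s j (Z : 'M[R]_(j, n.+1)) (B : @yball R n) (f : 'I_j -> coord) :
  (forall k, ~~ special (f k)) ->
  `|minor Z (cvec (plain t) B \o f)| <=
  pw s%:R * `|minor Z (cvec (plain (t + s)) B \o f)|.
Proof.
move=> nsp; rewrite (minor_plain t s) normrM.
have [[a [c [ac e]]]|inj] := pselect (exists a c, a != c /\ f a = f c).
  by rewrite (minor_eq_col _ ac) ?normr0 ?mulr0 //= e.
rewrite ler_wpM2r // ger0_norm; last first.
  by apply: prodr_ge0 => *; exact/ltW/scl_gt0.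
have [h hE] := @nspecial_fun j predT f (fun k _ => nsp k).
rewrite (eq_bigr (fun k' => expR (g * (w (h k') * s%:R)))); last first.
  by move=> k' _; rewrite hE.
rewrite -expR_sum -mulr_sumr -mulr_suml -/(pw _) pw_le //.
rewrite ler_piMl // sum_inj1 // => a c e.
apply: contrapT => /eqP ac; apply: inj; exists a, c; split => //.
by rewrite !hE // e.
Qed.

Lemma minor_delta j m (Z : 'M[R]_(j, m)) (h : 'I_j -> 'I_m) :
  minor Z (fun k => delta_mx (h k) 0) = \det (\matrix_(i, k) Z i (h k)).
Proof.
rewrite /minor; congr (\det _); apply/matrixP => i k; rewrite 2!mxE [RHS]mxE.
rewrite (bigD1 (h k)) //= mxE !eqxx mulr1 big1 ?addr0 // => l /negbTE lk.
by rewrite mxE lk mulr0.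
Qed.

Lemma int_minor_ge1 j (Z : 'M[int]_(j, n.+1)) (h : 'I_j -> 'I_n.+1) :
  \det (\matrix_(i, k) ZR Z i (h k)) != 0 ->
  1 <= `|\det (\matrix_(i, k) ZR Z i (h k))|.
Proof.
have -> : \matrix_(i, k) ZR Z i (h k) = ZR (\matrix_(i, k) Z i (h k)).
  by apply/matrixP => i k; rewrite !mxE.
rewrite det_map_mx intr_eq0 -intr_norm ler1z => h0.
by rewrite -gtz0_ge1 normr_gt0.
Qed.

Lemma det_inj j (Z : 'M[R]_(j, n.+1)) (h : 'I_j -> 'I_n.+1) :
  \det (\matrix_(i, k) Z i (h k)) != 0 -> injective h.
Proof.
rewrite -minor_delta => h0 a c e; apply: contrapT => /eqP ac.
by move: h0; rewrite (minor_eq_col _ ac) ?eqxx // e.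
Qed.

(** If all minors of the coefficient part vanish, a minor with the column [None] does not feel the
    centre; at time 0 it is an integer, nonzero for a suitable choice of columns, and
    [special_decay] read forwards makes it grow. *)
Lemma integral_minors j (Z : 'M[int]_(j, n.+1)) : (0 < j <= n)%N -> row_free (ZR Z) ->
  (exists h : 'I_j -> 'I_n, \det (\matrix_(i, k) ZR Z i (lift 0 (h k))) != 0) \/
  (forall t (B : @yball R n), exists2 f, adm f &
     pw (t%:R * wmin) <= `|minor (ZR Z) (cvec (plain t) B \o f)|).
Proof.
move=> /andP[j0 jn] rf; have [f hf] := row_free_minor rf.
have i0 : 'I_n := Ordinal n0.
have [hA|hA] := pselect (exists h : 'I_j -> 'I_n,
   \det (\matrix_(i, k) ZR Z i (lift 0 (h k))) != 0); first by left.
right => t B.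
have {}hA (h : 'I_j -> 'I_n) : \det (\matrix_(i, k) ZR Z i (lift 0 (h k))) = 0.
  by apply/eqP; apply: contrapT => /negP h0; apply: hA; exists h.
have finj := det_inj hf.
pose h k := odflt i0 (unlift 0 (f k)).
have hE k : f k != 0 -> f k = lift 0 (h k).
  by rewrite /h; case: unliftP => [a ->//|->]; rewrite eqxx.
have [k0 fk0] : exists k0, f k0 = 0.
  apply: contrapT => H; have := hA h; apply/eqP.
  have -> // : \matrix_(i, k) ZR Z i (lift 0 (h k)) = \matrix_(i, k) ZR Z i (f k).
  apply/matrixP => i k; rewrite mxE [RHS]mxE -hE //.
  by apply/eqP => e; apply: H; exists k.
have fk k : k != k0 -> f k = lift 0 (h k).
  move=> kk0; apply: hE; apply: contra_neq kk0 => e; apply: finj.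
  by rewrite e fk0.
pose F := upd (fun k => Some (false, h k) : @coord n) k0 None.
have aF : adm F.
  by move=> k k'; rewrite /F /upd; case: eqP => [->|_] //; case: eqP => [->|_].
exists F => //.
have e1 : minor (ZR Z) (cvec (plain 0) B \o F) = \det (\matrix_(i, k) ZR Z i (f k)).
  have e2 k : cvec (plain 0) B (Some (false, h k)) = delta_mx (lift 0 (h k)) 0.
    by rewrite /= mulr0 oppr0 pw0 scale1r.
  have e3 : cvec (plain 0) B None = delta_mx 0 0 + \sum_i B.1 0 i *: delta_mx (lift 0 i) 0.
    by rewrite /= pw0 scale1r.
  rewrite /F comp_upd e3 minor_updD big1 ?addr0; last first.
    move=> i _; rewrite -[X in _ * X]/(minor _ _).
    suff -> : upd (cvec (plain 0) B \o (fun k => Some (false, h k))) k0 (delta_mx (lift 0 i) 0)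
      = (fun k => delta_mx (lift 0 (upd h k0 i k)) 0) by rewrite minor_delta hA mulr0.
    by apply/funext => k; rewrite /upd; case: eqP => // _; rewrite -e2.
  rewrite -minor_delta; congr minor; apply/funext => k; rewrite /upd.
  by case: eqP => [->|/eqP kk0]; rewrite ?fk0 // fk // -e2.
have := @special_decay 0 t j (ZR Z) B F k0 jn aF; rewrite /F {1}/upd eqxx => /(_ isT).
rewrite -/F add0n e1 pwN => h1.
have h2 := int_minor_ge1 hf.
rewrite -[leLHS]mulr1 -ler_pdivlMl ?pw_gt0 //; exact: le_trans h1.
Qed.

Lemma not_small_plain t j (Z : 'M[int]_(j, n.+1)) (B : @yball R n) (X : R) :
  (0 < j <= n)%N -> row_free (ZR Z) -> 0 < B.2 <= 1 ->
  X <= pw (t%:R * wmin) * B.2 -> ~ small X (plain t) Z B.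
Proof.
move=> jn rf /andP[r0 r1] hX s.
have p0 : 0 < pw (t%:R * wmin) := pw_gt0 _ _.
have [[h hh]|] := integral_minors jn rf; last first.
  case/(_ t B) => f af hf; have := lt_le_trans (s f af) hX.
  apply/negP; rewrite -leNgt; apply: le_trans hf; rewrite ler_piMr // ltW //.
have /andP[j0 jn'] := jn.
pose k0 : 'I_j := Ordinal j0.
pose F := upd (fun k => Some (false, h k) : @coord n) k0 (Some (true, h k0)).
have aF : adm F.
  by move=> k k'; rewrite /F /upd; case: eqP => [->|_] //; case: eqP => [->|_].
have := s F aF; apply/negP; rewrite -leNgt; apply: le_trans hX _.
have sF : special (F k0) by rewrite /F /upd eqxx.
have := @special_decay 0 t j (ZR Z) B F k0 jn' aF sF; rewrite add0n pwN.
apply: contraLR; rewrite -!ltNge => hl.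
rewrite -ltr_pdivlMl ?invr_gt0 ?pw_gt0 // invrK in hl *.
apply: lt_le_trans hl _; rewrite ler_pM2l //.
have e2 k : cvec (plain 0) B (Some (false, h k)) = delta_mx (lift 0 (h k)) 0.
  by rewrite /= mulr0 oppr0 pw0 scale1r.
have e3 : cvec (plain 0) B (Some (true, h k0)) =
   0 + \sum_(l : 'I_1) B.2 *: delta_mx (lift 0 (h k0)) 0.
  by rewrite add0r big_ord1 /= pw0 mul1r.
rewrite /F comp_upd e3 minor_updD minor_upd big1; last first.
  by move=> i _; rewrite mulmx0 mxE mul0r.
rewrite add0r big_ord1 normrM gtr0_norm //; apply: ler_peMr; first exact: ltW.
suff -> : upd (cvec (plain 0) B \o (fun k => Some (false, h k))) k0
   (delta_mx (lift 0 (h k0)) 0) = (fun k => delta_mx (lift 0 (h k)) 0).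
  by rewrite minor_delta int_minor_ge1.
by apply/funext => k; rewrite /upd; case: eqP => [->//|_]; rewrite -e2.
Qed.

Lemma exists_argmax j (Z : 'M[int]_(j, n.+1)) D (B : @yball R n) :
  exists2 fm, adm fm & forall f, adm f ->
   `|minor (ZR Z) (cvec D B \o f)| <= `|minor (ZR Z) (cvec D B \o fm)|.
Proof.
have i0 : 'I_n := Ordinal n0.
pose f0 : {ffun 'I_j -> @coord n} := [ffun _ => Some (false, i0)].
pose P (f : {ffun 'I_j -> @coord n}) := `[< adm f >].
have Pf0 : P f0 by apply/asboolP => k k'; rewrite ffunE.
case: (@Order.TotalTheory.arg_maxP _ _ _ f0 P
  (fun f => `|minor (ZR Z) (cvec D B \o f)|) Pf0) => fm /asboolP afm hm.
exists fm => // f af.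
have e : f = [ffun k => f k] by apply/funext => k; rewrite ffunE.
by rewrite e; apply: hm; apply/asboolP; rewrite -e.
Qed.

(** Time runs back to the first moment at which some maximal minor has no special column; time 0 is
    such a moment. Until then every minor decays by [special_decay], and at that moment
    [short_vector] applies. The root of order [j] turns the decay of minors into that of a vector,
    hence the division by [n] in the exponent. *)
Lemma short_vector_crossing (t j : nat) (Z : 'M[int]_(j, n.+1)) (B : @yball R n) (X : R) :
  (0 < j <= n)%N -> row_free (ZR Z) -> 0 < B.2 <= 1 -> wmin <= 1 -> 0 < X ->
  X ^+ j <= pw (t%:R * wmin) -> small (X ^+ j) (plain t) Z B ->
  exists (s : nat) (v : 'rV[int]_n.+1), [/\ (s <= t)%N, v != 0 &
    vsmall (n.+1%:R * (4 ^+ n * pw 2 * X * pw (- (s%:R * wmin / n%:R))))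
      (plain (t - s)) v B].
Proof.
move=> jn rf rB wm1 X0 hX sm.
have /andP[j0 jn'] := jn.
have p0 x : 0 < pw x := pw_gt0 _ _.
pose E s := `[< (s <= t)%N /\ exists fs, (forall k, ~~ special (fs k)) /\
  forall f, adm f -> `|minor (ZR Z) (cvec (plain (t - s)) B \o f)| <=
                     `|minor (ZR Z) (cvec (plain (t - s)) B \o fs)| >].
have decay s f k : (s <= t)%N -> adm f -> special (f k) ->
  `|minor (ZR Z) (cvec (plain (t - s)) B \o f)| < pw (- (s%:R * wmin)) * X ^+ j.
  move=> st af sf.
  apply: le_lt_trans (@special_decay (t - s) s j (ZR Z) B f k jn' af sf) _.
  by rewrite ltr_pM2l // subnK //; exact: sm.
have Et : E t.
  apply/asboolP; split => //; rewrite subnn.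
  have [fm afm hm] := exists_argmax Z (plain 0) B; exists fm; split => // k.
  apply/negP => sk; have := decay t fm k (leqnn _) afm sk; rewrite subnn pwN.
  have [[h hh]|] := integral_minors jn rf; last first.
    by case/(_ t B) => f af hf; have := lt_le_trans (sm f af) (le_trans hX hf); rewrite ltxx.
  move=> lt1; pose F k := Some (false, h k) : @coord n.
  have aF : adm F by [].
  have := hm F aF.
  have -> : minor (ZR Z) (cvec (plain 0) B \o F) = \det (\matrix_(i, k) ZR Z i (lift 0 (h k))).
    rewrite -minor_delta; congr minor; apply/funext => k'.
    by rewrite /= mulr0 oppr0 pw0 scale1r.
  move=> /(le_trans (int_minor_ge1 hh)) /le_lt_trans /(_ lt1).
  by rewrite ltNge ler_pdivrMl // mulr1 hX.
have exE : exists s, E s by exists t.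
case: (ex_minnP exE) => s /asboolP[st [fs [nsp hfs]]] smin.
(* One unit before the stopping moment the maximum is special and has decayed. The last unit costs
   at most [pw 1], and a second [pw 1] makes up for the missing [wmin <= 1] in the exponent. *)
have bound : `|minor (ZR Z) (cvec (plain (t - s)) B \o fs)| <
    pw 2 * pw (- (s%:R * wmin)) * X ^+ j.
  have Xj : 0 < X ^+ j by rewrite exprn_gt0.
  case: s st smin hfs => [|s] st smin hfs.
    rewrite subn0; apply: lt_le_trans (sm fs _) _; first by move=> k; rewrite (negbTE (nsp k)).
    rewrite mul0r oppr0 pw0 mulr1; apply: ler_peMl; first exact: ltW.
    by rewrite pw_ge1.
  have nE : ~ E s by move=> /smin; rewrite ltnn.
  have [fm afm hm] := exists_argmax Z (plain (t - s)) B.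
  have [k sk] : exists k, special (fm k).
    apply: contrapT => H; apply: nE; apply/asboolP; split; first exact: ltnW.
    by exists fm; split => // k; apply/negP => sk; apply: H; exists k.
  clear nE.
  have h1 := decay s fm k (ltnW st) afm sk.
  have h2 := @nspecial_growth (t - s.+1) 1 j (ZR Z) B fs nsp.
  rewrite addn1 -subSn // subSS in h2.
  apply: le_lt_trans h2 _.
  apply: le_lt_trans (_ : _ <= pw 1 * `|minor (ZR Z) (cvec (plain (t - s)) B \o fm)|) _.
    apply: ler_wpM2l; first exact/ltW/p0.
    by apply: hm => k'; rewrite (negbTE (nsp k')).
  apply: lt_le_trans (_ : pw 1 * (pw (- (s%:R * wmin)) * X ^+ j) <= _).
    by rewrite ltr_pM2l.
  rewrite mulrA ler_pM2r // -!pwD pw_le // -natr1.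
  lra.
have pos : 0 < `|minor (ZR Z) (cvec (plain (t - s)) B \o fs)|.
  have rB' := rB; case/andP: rB' => r0 _.
  have := @not_small_plain (t - s) j Z B (pw ((t - s)%:R * wmin) * B.2) jn rf rB (lexx _).
  case/not_small_minor => f af hf; apply: lt_le_trans (hfs f af).
  by apply: lt_le_trans hf; rewrite mulr_gt0.
set mu := 4 ^+ n * pw 2 * X * pw (- (s%:R * wmin / n%:R)).
have mu0 : 0 < mu by rewrite !mulr_gt0 // exprn_gt0.
have [|x x0 hx] := short_vector mu0 nsp pos hfs.
  apply: lt_le_trans bound _.
  rewrite /mu !exprMn -exprM !pwX.
  have h4 : 1 <= 4^-1 ^+ (j * j) * 4 ^+ (n * j) :> R.
    rewrite exprVn ler_pdivlMl ?exprn_gt0 // mulr1 ler_weXn2l ?ler1n //.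
    by rewrite leq_mul2r jn' orbT.
  apply: le_trans (_ : _ <= (4^-1 ^+ (j * j) * 4 ^+ (n * j)) *
     (pw (j%:R * 2) * pw (j%:R * - (s%:R * wmin / n%:R)) * X ^+ j)) _; last first.
    by rewrite le_eqVlt; apply/orP; left; apply/eqP; ring.
  apply: le_trans (_ : _ <= pw (j%:R * 2) * pw (j%:R * - (s%:R * wmin / n%:R)) * X ^+ j) _; last first.
    by apply: ler_peMl => //; rewrite ltW // !mulr_gt0 // exprn_gt0.
  rewrite ler_pM2r ?exprn_gt0 // -!pwD pw_le //.
  have j1 : 1 <= j%:R :> R by rewrite ler1n.
  have jn1 : j%:R / n%:R <= 1 :> R by rewrite ler_pdivrMr ?ltr0n // mul1r ler_nat.
  have sw : 0 <= s%:R * wmin by rewrite mulr_ge0 // ltW.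
  have -> : j%:R * - (s%:R * wmin / n%:R) = - ((j%:R / n%:R) * (s%:R * wmin)) by ring.
  have : (j%:R / n%:R) * (s%:R * wmin) <= s%:R * wmin by rewrite ler_piMl.
  lra.
exists s, (x *m Z); split => //.
  apply: contra_neq x0 => e.
  have : ZR x *m ZR Z = 0 *m ZR Z.
    by rewrite mul0mx -map_mxM e; apply/matrixP => a c; rewrite !mxE.
  move=> /(row_free_inj rf) ex; apply/matrixP => a c; move/matrixP: ex => /(_ a c).
  by rewrite !mxE => /eqP; rewrite intr_eq0 => /eqP.
move=> c; apply: lt_le_trans (hx c) _.
by rewrite ler_pM2r // ler_nat ltnS.
Qed.

End Crossing.

(** * No sublattice is short when a window opens *)

Section Starts.
Context {R : realType} {n : nat}.
Notation ZR := (map_mx (intr : int -> R)).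

Variables (w : 'I_n -> R) (i1 : 'I_n) (g lam C eta wmin rlow : R) (M p0 : nat).
Hypotheses (w1 : \sum_i w i = 1) (wmin0 : 0 < wmin) (wminP : forall i, wmin <= w i)
  (wmax : forall i, w i <= w i1) (g0 : 0 < g) (lam01 : 0 < lam < 1)
  (C1 : 1 <= C) (eta0 : 0 < eta) (eta1 : 2 * eta * n.+1%:R <= 1)
  (eta2 : 8 * eta * n%:R <= wmin) (M_big : 16 * n%:R <= (M%:R - 1) * wmin).

Local Notation pw := (base_pow g).
Local Notation W := (max_rate w i1).
Local Notation c0 := (@drift R n lam C).
Local Notation K := (gauge g eta).
Local Notation L := (margin g eta).
Local Notation wt := (flow_wts w i1 g).
Local Notation alive := (stage_alive w i1 g M).
Local Notation plain := (plain_wts w g).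

Hypotheses (rlow0 : 0 < rlow) (p01 : (0 < p0)%N)
  (big_A : forall p, (p0 <= p)%N -> 2 * n.+1%:R * c0 ^+ 2 <= L p)
  (big_C : 1 <= pw (2 * eta * n%:R * p0%:R) * rlow)
  (big_l : 1 <= pw p0%:R * lam)
  (big_E : n.+1%:R * 4 ^+ n * pw 2 <= pw (eta * p0%:R))
  (big_F : c0 <= pw p0%:R).

Variable B : nat -> @yball R n.
Hypotheses (r_gt0 : forall m, 0 < (B m).2)
  (r_lam : forall m, lam * (B m).2 <= (B m.+1).2)
  (r_half : forall m, (B m.+1).2 <= 2^-1 * (B m).2)
  (y_near : forall m m' i, (m <= m')%N ->
     `|(B m').1 0 i - (B m).1 0 i| <= C * (B m).2)
  (r_low : rlow <= (B 0).2) (r_le1 : (B 0).2 <= 1).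

Local Notation start_ok := (start_unobstructed w i1 g eta M B).

Hypothesis promise : forall t p j m x, (p0 <= p)%N -> (0 < j <= n)%N ->
  alive t p (B m).2 -> emission w i1 g lam C eta M t p j (hist B m) = Some x ->
  forall m', (m <= m')%N ->
    `|dot x.1.1 (B m').1 + x.1.2| < eps (n := n) g lam C eta p j ->
    eps (n := n) g lam C eta p j <= (B m').2 * `|x.1.1 0 x.2|.

Let w_pos i : 0 < w i. Proof. exact: lt_le_trans (wminP i). Qed.
Let n0 : (0 < n)%N. Proof. exact: n_gt0 i1. Qed.
Let n1 : 1 <= n%:R :> R. Proof. by rewrite ler1n. Qed.
Let pgt0 x : 0 < pw x. Proof. exact: pw_gt0. Qed.
Let ple x y : (pw x <= pw y) = (x <= y). Proof. exact: pw_le. Qed.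
Let plt x y : (pw x < pw y) = (x < y). Proof. exact: pw_lt. Qed.
Let pD x y : pw (x + y) = pw x * pw y. Proof. exact: pwD. Qed.
Let lam0 : 0 < lam. Proof. by case/andP: lam01. Qed.

Lemma w_le1 i : w i <= 1.
Proof. by rewrite -w1 (bigD1 i) //= lerDl; apply: sumr_ge0 => *; exact: ltW. Qed.

Lemma wmin_le1 : wmin <= 1. Proof. exact: le_trans (wminP i1) (w_le1 i1). Qed.
Lemma W_le2 : W <= 2. Proof. by rewrite /max_rate; have := w_le1 i1; lra. Qed.
Lemma W_ge1 : 1 <= W. Proof. by rewrite /max_rate; have := w_pos i1; lra. Qed.
Lemma eta_le : 4 * eta <= 1.
Proof.
have : 2 <= n.+1%:R :> R by rewrite -natr1; have := n1; lra.
by move=> h; have := ler_wpM2l (ltW eta0) h; move: eta1; lra.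
Qed.
Lemma M_ge17 : 17 <= M%:R :> R.
Proof.
have h1 := M_big; have h4 := n1; have h3 := wmin_le1.
have h : 0 <= M%:R - 1 :> R.
  by rewrite -(pmulr_lge0 _ wmin0); apply: le_trans h1; lra.
have : (M%:R - 1) * wmin <= (M%:R - 1) * 1 by rewrite ler_wpM2l.
lra.
Qed.

Lemma ent_a D (v : 'rV[int]_n.+1) (y : @yball R n) i :
  (ZR v *m cvec D y (Some (false, i))) 0 0 = D.2 i * (v 0 (lift 0 i))%:~R.
Proof.
rewrite /= -scalemxAr mxE; congr (_ * _); rewrite mxE (bigD1 (lift 0 i)) //=.
rewrite !mxE !eqxx mulr1 big1 ?addr0 // => l /negbTE h.
by rewrite !mxE h mulr0.
Qed.

Lemma ent_g D (v : 'rV[int]_n.+1) (y : @yball R n) i :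
  (ZR v *m cvec D y (Some (true, i))) 0 0 = D.1 * y.2 * (v 0 (lift 0 i))%:~R.
Proof. exact: (ent_a (D.1, fun _ => D.1 * y.2) v y i). Qed.

Definition form (v : 'rV[int]_n.+1) (y : 'rV[R]_n) : R :=
  (v 0 0)%:~R + \sum_i y 0 i * (v 0 (lift 0 i))%:~R.

Lemma ent_f D (v : 'rV[int]_n.+1) (y : @yball R n) :
  (ZR v *m cvec D y None) 0 0 = D.1 * form v y.1.
Proof.
rewrite /= -scalemxAr mxE; congr (_ * _); rewrite mulmxDr mxE; congr (_ + _).
  rewrite mxE (bigD1 0) //= !mxE !eqxx mulr1 big1 ?addr0 // => l /negbTE h.
  by rewrite !mxE h mulr0.
rewrite mulmx_sumr summxE; apply: eq_bigr => i _; rewrite -scalemxAr mxE.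
by have := ent_a (0, fun _ => 1) v y i; rewrite /= scale1r mul1r => ->.
Qed.

(** The hypothesis says exactly that the inflated scale [pw (p - w i1 * t)] is at most the scale
    [pw t * y.2] of the variation column. *)
Lemma vsmall_wt_plain x t p v (y : @yball R n) :
  pw p%:R <= y.2 * pw (W * t%:R) -> vsmall x (plain t) v y -> vsmall x (wt t p) v y.
Proof.
move=> h s [[[] i]|]; [by have := s (Some (true, i)); rewrite !ent_g| |
  by have := s None; rewrite !ent_f].
rewrite ent_a normrM ger0_norm /=; last by rewrite le_max ltW.
have s1 := s (Some (false, i)); rewrite ent_a normrM ger0_norm /= ?ltW // in s1.
have s2 := s (Some (true, i)).
rewrite ent_g normrM ger0_norm /= ?ltW // in s2; last first.
  have : 0 < y.2 * pw (W * t%:R) := lt_le_trans (pgt0 _) h.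
  by rewrite pmulr_lgt0 // => r0; rewrite mulr_gt0.
rewrite maxEle; case: ifP => // _; apply: le_lt_trans s2.
apply: ler_wpM2r => //.
have -> : pw (p%:R - w i1 * t%:R) = pw p%:R * pw (- (w i1 * t%:R)) by rewrite -pD.
have -> : pw t%:R * y.2 = y.2 * pw (W * t%:R) * pw (- (w i1 * t%:R)).
  by rewrite -mulrA -pD mulrC; congr (_ * pw _); rewrite /max_rate; ring.
by rewrite ler_wpM2r // ltW.
Qed.

(** Transports shortness from a deep ball with centre [y] to an earlier ball [(y', r)] on which time
    [t] has just about reached stage [p0]. The upper bound on [r] controls the variation of the
    form, and the loss is [pw p0 * c0]. *)
Lemma vsmall_unshrink mu t (v : 'rV[int]_n.+1) (y y' : 'rV[R]_n) (r : R) :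
  0 < r -> r * pw (W * t%:R) <= pw p0%:R / lam ->
  (forall i, `|y 0 i - y' 0 i| <= C * r) ->
  (forall i, pw (- (w i * t%:R)) * `|(v 0 (lift 0 i))%:~R| < mu) ->
  pw t%:R * `|form v y| < mu ->
  vsmall (mu * pw p0%:R * c0) (wt t p0) v (y', r).
Proof.
move=> r0 hr hy ha hf.
have mu0 : 0 < mu by apply: le_lt_trans hf; rewrite mulr_ge0 // ltW.
have c01 : 1 < c0 by exact: c0_gt1.
have P1 : 1 <= pw p0%:R by rewrite pw_ge1.
have big1' : mu <= mu * pw p0%:R * c0.
  by rewrite -mulrA; apply: ler_peMr; rewrite ?(ltW mu0) // mulr_ege1 // ltW.
have hai i : `|(v 0 (lift 0 i))%:~R : R| < mu * pw (w i1 * t%:R).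
  apply: lt_le_trans (_ : mu * pw (w i * t%:R) <= _); last first.
    by rewrite ler_wpM2l ?(ltW mu0) // ple ler_wpM2r.
  by have := ha i; rewrite pwN ltr_pdivrMl // mulrC.
have hg i : pw t%:R * r * `|(v 0 (lift 0 i))%:~R| < mu * pw p0%:R / lam.
  apply: lt_le_trans (_ : pw t%:R * r * (mu * pw (w i1 * t%:R)) <= _).
    by rewrite ltr_pM2l ?mulr_gt0.
  have -> : pw t%:R * r * (mu * pw (w i1 * t%:R)) = mu * (r * pw (W * t%:R)).
    by rewrite /max_rate mulrDl mul1r pD; ring.
  by rewrite -mulrA ler_wpM2l // ltW.
have hg' i : pw t%:R * r * `|(v 0 (lift 0 i))%:~R| < mu * pw p0%:R * c0.
  apply: lt_le_trans (hg i) _; apply: ler_wpM2l; first by rewrite ltW // mulr_gt0.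
  exact: c0_inv.
move=> [[[] i]|].
- by rewrite ent_g normrM ger0_norm /= ?hg' // ltW // mulr_gt0.
- rewrite ent_a normrM ger0_norm /=; last by rewrite le_max ltW.
  rewrite maxEle; case: ifP => _; last exact: lt_le_trans (ha i) _.
  apply: lt_le_trans (_ : pw (p0%:R - w i1 * t%:R) * (mu * pw (w i1 * t%:R)) <= _).
    by rewrite ltr_pM2l.
  have -> : pw (p0%:R - w i1 * t%:R) * (mu * pw (w i1 * t%:R)) = mu * pw p0%:R.
    by rewrite mulrCA -pD; congr (_ * pw _); ring.
  by apply: ler_peMr; [rewrite ltW // mulr_gt0|exact: ltW].
rewrite ent_f normrM ger0_norm /= ?ltW //.
have -> : form v y' = form v y - \sum_i (y 0 i - y' 0 i) * (v 0 (lift 0 i))%:~R.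
  rewrite /form -addrA -sumrB; congr (_ + _); apply: eq_bigr => i _; ring.
have hsum : pw t%:R * `|\sum_i (y 0 i - y' 0 i) * (v 0 (lift 0 i))%:~R| <=
    n%:R * C * (mu * pw p0%:R / lam).
  apply: le_trans (ler_wpM2l (ltW (pgt0 _)) (ler_norm_sum _ _ _)) _.
  rewrite mulr_sumr; have -> : n%:R * C * (mu * pw p0%:R / lam) =
     \sum_(i < n) (C * (mu * pw p0%:R / lam)).
    by rewrite sumr_const card_ord -[RHS]mulr_natl; ring.
  apply: ler_sum => i _; rewrite normrM.
  apply: le_trans (_ : _ <= pw t%:R * ((C * r) * `|(v 0 (lift 0 i))%:~R|)) _.
    by rewrite ler_pM2l //; apply: ler_wpM2r => //; exact: hy.
  rewrite (_ : pw t%:R * _ = C * (pw t%:R * r * `|(v 0 (lift 0 i))%:~R|)); last by ring.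
  by apply: ler_wpM2l; [exact: le_trans C1|exact: ltW].
have h1 := ler_wpM2l (ltW (pgt0 t%:R)) (ler_normB (form v y)
   (\sum_i (y 0 i - y' 0 i) * (v 0 (lift 0 i))%:~R)).
apply: le_lt_trans h1 _; rewrite mulrDr.
have -> : mu * pw p0%:R * c0 = mu * pw p0%:R / lam + n%:R * C * (mu * pw p0%:R / lam).
  by rewrite /drift; ring.
apply: ltr_leD => //; apply: lt_le_trans hf _; rewrite -mulrA; apply: ler_peMr.
  exact: ltW.
by rewrite mulr_ege1 // -[leLHS]invr1 lef_pV2 ?posrE // ltW //; case/andP: lam01.
Qed.


Lemma pw_unbounded x : exists q : nat, x < pw q%:R.
Proof.
have xg : 0 <= `|x| / g by rewrite divr_ge0 // ltW.
exists (Num.bound (`|x| / g)); have := archi_boundP xg.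
rewrite ltr_pdivrMr // => h; apply: le_lt_trans (ler_norm x) _; apply: lt_le_trans h _.
rewrite /base_pow mulrC; apply: le_trans (expR_ge1Dx _); lra.
Qed.

Lemma pw_bracket x : pw p0%:R <= x ->
  exists p : nat, [/\ (p0 <= p)%N, pw p%:R <= x & x < pw p.+1%:R].
Proof.
move=> hx; have exq : exists q : nat, x < pw q%:R := pw_unbounded x.
case: (ex_minnP exq) => -[|q] hq qmin.
  by have := le_lt_trans hx hq; rewrite plt ltNge ler0n.
exists q; split => //; last by rewrite leNgt; apply/negP => /qmin; rewrite ltnn.
by have := le_lt_trans hx hq; rewrite plt ltr_nat ltnS.
Qed.

Lemma protected (t p m : nat) : (p0 <= p)%N -> alive t p (B m).2 ->
  (forall m', (m' <= m)%N -> start_ok t p m') ->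
  forall v : 'rV[int]_n.+1, v != 0 -> ~ vsmall (L p) (wt t p) v (B m).
Proof.
move=> pp al st.
apply: (protected_inv w1 g0 lam01 C1 eta1 r_gt0 r_half y_near promise big_A pp al).
by move=> j Z hZ; exact: (inv_starts lam01 C1 r_gt0 r_lam y_near al st hZ).
Qed.

Lemma plain_wt t p j (Z : 'M[int]_(j, n.+1)) X y : small X (wt t p) Z y -> small X (plain t) Z y.
Proof.
by apply: small_wt => //= i; rewrite pw_gt0 le_max lexx.
Qed.

(** Strong induction on [m], over all times and stages at once. A window that opens at [m.+1] is
    entered from above. A short sublattice there yields a vector [v] that is short at the earlier
    time [t' = t - s], the shorter the larger [s] is. Depending on how far time went back, [v] is
    excluded by protection at [m.+1] at another stage, by protection at an earlier ball, or by
    integrality. *)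
Lemma starts m : forall t p, (p0 <= p)%N -> start_ok t p m.
Proof.
elim/ltn_ind: m => m IH t p pp al nal j Z jn rf sm.
have p1 : 1 <= p%:R :> R by rewrite ler1n; exact: leq_trans pp.
have p0p : p0%:R <= p%:R :> R by rewrite ler_nat.
have /andP[al1 al2] := al.
have rm1 : (B m).2 <= 1.
  by apply: le_trans r_le1; apply: (r_le r_gt0 r_half (leq0n m)).
have W2 := W_le2; have W1 := W_ge1; have e4 := eta_le; have wm1 := wmin_le1.
have t0 : 0 <= t%:R :> R by [].
have pWt : p%:R <= W * t%:R.
  rewrite -ple; apply: le_trans al1 _; by rewrite ler_piMl // ltW.
have pt : p%:R <= 2 * t%:R :> R by apply: le_trans pWt _; rewrite ler_wpM2r.
have tw : 4 * eta * n%:R * p%:R <= t%:R * wmin.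
  have h1 : p%:R * wmin <= 2 * t%:R * wmin by rewrite ler_wpM2r // ltW.
  have h2 : p%:R * (8 * eta * n%:R) <= p%:R * wmin by rewrite ler_wpM2l.
  lra.
have Kj : K p ^+ j <= pw (2 * eta * n%:R * p%:R).
  rewrite /gauge pwX ple.
  rewrite (_ : 2 * eta * n%:R * p%:R = n%:R * (2 * eta * p%:R)); last by ring.
  rewrite ler_wpM2r ?mulr_ge0 ?(ltW eta0) // ler_nat; by case/andP: jn.
have smp := plain_wt sm.
have enp : 0 <= eta * n%:R * p%:R by rewrite !mulr_ge0 // ltW.
case: m IH al nal sm al1 al2 rm1 smp => [|m] IH al nal sm al1 al2 rm1 smp.
  (* No earlier ball exists: the a priori bound [pw (t * wmin)] times the radius beats the gauge,
     because [t * wmin] is at least [4 * eta * n * p] and half of this pays for [rlow]. *)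
  apply: (not_small_plain n0 w1 g0 wmin0 wminP jn rf _ _ smp); first by rewrite r_gt0.
  apply: le_trans Kj _.
  apply: le_trans (_ : _ <= pw (4 * eta * n%:R * p%:R) * rlow) _; last first.
    by apply: ler_pM => //; rewrite ?ple // ltW.
  have -> : 4 * eta * n%:R * p%:R = 2 * eta * n%:R * p%:R + 2 * eta * n%:R * p%:R by ring.
  rewrite pD -[_ * _ * rlow]mulrA ler_pMr //; apply: le_trans big_C _.
  by rewrite ler_pM2r // ple ler_wpM2l // !mulr_ge0 // (ltW eta0).
have r01 : 0 < (B m.+1).2 <= 1 by rewrite r_gt0.
have KX : K p ^+ j <= pw (t%:R * wmin).
  apply: le_trans Kj _; rewrite ple; lra.
have [s [v [st v0 sv]]] := short_vector_crossing n0 w1 g0 wmin0 wminP jn rf r01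
   wm1 (pw_gt0 _ _) KX smp.
set mu := (X in vsmall X) in sv.
pose t' := (t - s)%N.
have tE : t%:R = t'%:R + s%:R :> R by rewrite -natrD subnK.
pose P' := (B m.+1).2 * pw (W * t'%:R).
have M17 := M_ge17.
have P'_ge : pw ((M%:R - 1) * p%:R - W * s%:R) <= P'.
  have h1 : pw (M * p)%:R < (B m).2 * pw (W * t%:R).
    move: nal; rewrite /stage_alive negb_and -ltNge -ltNge => /orP[|//].
    rewrite ltNge => /negP[]; apply: le_trans al1 _; rewrite ler_pM2r //.
    by apply: (r_le r_gt0 r_half).
  have h2 : pw (M * p)%:R * pw (- p%:R) <= (B m.+1).2 * pw (W * t%:R).
    apply: le_trans (_ : _ <= lam * ((B m).2 * pw (W * t%:R))) _; last first.
      by rewrite mulrA ler_pM2r.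
    rewrite mulrC; apply: ler_pM => //; try exact: ltW.
    rewrite pwN -[leLHS]mul1r ler_pdivrMr // mulrC; apply: le_trans big_l _.
    by rewrite ler_pM2r // ple.
  rewrite /P' (_ : W * t'%:R = W * t%:R + - (W * s%:R)); last by rewrite tE; ring.
  rewrite !pD mulrA ler_pM2r //; apply: le_trans h2.
  by rewrite -pD natrM ple; lra.
have E1 : mu <= pw (eta * p%:R + 2 * eta * p%:R - s%:R * wmin / n%:R).
  rewrite (pD (eta * p%:R + 2 * eta * p%:R)) (pD (eta * p%:R)) /mu !mulrA.
  apply: ler_wpM2r; first exact: ltW.
  rewrite /gauge; apply: ler_wpM2r; first exact: ltW.
  by apply: le_trans big_E _; rewrite ple ler_wpM2l // ltW.
have mu0 : 0 < mu by rewrite /mu !mulr_gt0 // exprn_gt0.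
have n00 : 0 < n%:R :> R by rewrite ltr0n.
(* If the flow had to go back far, then v is very short. *)
have far q : (M%:R - 1) * p%:R - W * s%:R < q -> q <= 4 * p%:R ->
    mu <= pw (- (4 * p%:R)).
  move=> hq1 hq2; apply: le_trans E1 _; rewrite ple.
  have hs : (M%:R - 5) * p%:R <= 2 * s%:R :> R.
    have : W * s%:R <= 2 * s%:R :> R by rewrite ler_wpM2r.
    lra.
  have h1 : 12 * n%:R <= (M%:R - 5) * wmin.
    have : 3 / 4 * (M%:R - 1) * wmin <= (M%:R - 5) * wmin by rewrite ler_wpM2r ?(ltW wmin0) //; lra.
    by move: M_big; lra.
  have h2 : 12 * n%:R * p%:R <= 2 * (s%:R * wmin).
    apply: le_trans (_ : _ <= (M%:R - 5) * wmin * p%:R) _; first by rewrite ler_wpM2r.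
    have := ler_wpM2r (ltW wmin0) hs; lra.
  have h3 : 6 * p%:R <= s%:R * wmin / n%:R by rewrite ler_pdivlMr //; lra.
  have : 4 * eta * p%:R <= 1 * p%:R by rewrite ler_wpM2r.
  lra.
have Lge1 q : 1 <= L q by rewrite /margin pw_ge1 // mulr_ge0 // ltW.
have [hP|hP] := leP (pw p0%:R) P'.
  (* [p'] is the largest stage that [m.+1] reaches at time [t']. Its window contains [m] too, so
     nothing has to be shown about a start at [m.+1] and the induction hypothesis covers the rest.
     If [p'] is at least [4 * p] its margin exceeds [mu]; otherwise [s] is large and [mu] is
     tiny. *)
  have [p' [pp' hp1 hp2]] := pw_bracket hP.
  have p'1 : 1 <= p'%:R :> R by rewrite ler1n; exact: leq_trans pp'.
  have Mp : 2 * p'%:R + 1 <= M%:R * p'%:R :> R.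
    have : 17 * p'%:R <= M%:R * p'%:R :> R by rewrite ler_wpM2r. lra.
  have al' : alive t' p' (B m.+1).2.
    rewrite /stage_alive hp1 /=; apply: ltW; apply: lt_le_trans hp2 _.
    by rewrite ple natrM -natr1; lra.
  have alm : alive t' p' (B m).2.
    apply/andP; split.
      apply: le_trans hp1 _; rewrite ler_pM2r //.
      by apply: (r_le r_gt0 r_half).
    apply: le_trans (_ : _ <= P' / lam) _.
      by rewrite ler_pdivlMr // mulrC mulrA ler_pM2r.
    rewrite ler_pdivrMr //; apply: ltW; apply: lt_le_trans hp2 _.
    apply: le_trans (_ : _ <= pw (M * p')%:R * pw (- p'%:R)) _.
      by rewrite -pD ple natrM -natr1; lra.
    rewrite ler_pM2l // pwN -[leLHS]mul1r ler_pdivrMr // mulrC.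
    by apply: le_trans big_l _; rewrite ler_pM2r // ple ler_nat.
  have := @protected t' p' m.+1 pp' al'.
  case/(_ _ v v0) => [m'|].
    rewrite leq_eqVlt => /orP[/eqP->|]; last by move=> h; exact: IH.
    by move=> _; rewrite alm.
  suff hh : vsmall (L p') (plain t') v (B m.+1) by exact: (vsmall_wt_plain hp1 hh).
  have [h4|h4] := leP (4 * p%:R : R) p'%:R.
    move=> c; apply: lt_le_trans (sv c) _; apply: le_trans E1 _; rewrite /margin ple.
    have := ler_wpM2l (ltW eta0) h4; have : 0 <= s%:R * wmin / n%:R by rewrite divr_ge0 ?mulr_ge0 // ltW.
    have : 0 <= eta * p%:R by rewrite mulr_ge0 // ltW.
    lra.
  move=> c; apply: lt_le_trans (sv c) _; apply: le_trans (Lge1 _).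
  apply: le_trans (far p'.+1%:R _ _) _.
  - by rewrite -plt; exact: le_lt_trans P'_ge _.
  - have : (p' < 4 * p)%N by rewrite -(ltr_nat R) natrM.
    by rewrite -(ler_nat R) natrM.
  - rewrite -[leRHS](pw0 g) ple; lra.
have mu_tiny : mu <= pw (- (4 * p%:R)).
  apply: (@far p0%:R); last by lra.
  by rewrite -plt; exact: le_lt_trans P'_ge _.
have va i : pw (- (w i * t'%:R)) * `|(v 0 (lift 0 i))%:~R| < mu.
  by have := sv (Some (false, i)); rewrite ent_a normrM ger0_norm /= ?ltW.
have vf : pw t'%:R * `|form v (B m.+1).1| < mu.
  by have := sv None; rewrite ent_f normrM ger0_norm /= ?ltW.
(* The ball [m.+1] is now below stage [p0] at time [t']. If the play passed through this stage, the
   last ball [k] above it serves, the loss of [vsmall_unshrink] being paid by the tiny [mu]. *)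
have [hr|hr] := leP (pw p0%:R) ((B 0).2 * pw (W * t'%:R)).
  have exm : exists k, (B k).2 * pw (W * t'%:R) < pw p0%:R by exists m.+1.
  case: (ex_minnP exm) => -[|k] hk kmin; first by move: hk; rewrite ltNge hr.
  have km : (k.+1 <= m.+1)%N by exact: kmin.
  have hk1 : pw p0%:R <= (B k).2 * pw (W * t'%:R).
    by rewrite leNgt; apply/negP => /kmin; rewrite ltnn.
  have hk2 : (B k).2 * pw (W * t'%:R) <= pw p0%:R / lam.
    rewrite ler_pdivlMr // mulrC mulrA; apply: ltW; apply: le_lt_trans hk.
    by rewrite ler_pM2r.
  have al' : alive t' p0 (B k).2.
    rewrite /stage_alive hk1 /=; apply: le_trans hk2 _.
    rewrite ler_pdivrMr //; apply: le_trans (_ : _ <= pw (M * p0)%:R * pw (- p0%:R)) _.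
      rewrite -pD ple natrM; have : 17 * p0%:R <= M%:R * p0%:R :> R by rewrite ler_wpM2r.
      have : 1 <= p0%:R :> R by rewrite ler1n. lra.
    rewrite ler_pM2l // pwN -[leLHS]mul1r ler_pdivrMr // mulrC //.
  have := @protected t' p0 k (leqnn _) al'.
  case/(_ _ v v0) => [m' hm'|]; first by apply: IH => //; exact: leq_ltn_trans hm' km.
  have hs := @vsmall_unshrink mu t' v (B m.+1).1 (B k).1 (B k).2 (r_gt0 k) hk2
     (fun i => y_near i (ltnW km)) va vf.
  have -> : B k = ((B k).1, (B k).2) by case: (B k).
  move=> c; apply: lt_le_trans (hs c) _; apply: le_trans (Lge1 _).
  apply: le_trans (_ : _ <= pw (- (4 * p%:R)) * pw p0%:R * pw p0%:R) _.
    have c00 : 0 < c0 by exact: c0_gt0.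
    apply: ler_pM; [|exact: ltW| |exact: big_F].
      by apply: mulr_ge0; exact: ltW.
    by rewrite ler_pM2r.
  rewrite -!pD -[leRHS](pw0 g) ple; lra.
(* Even [B 0] is below stage [p0], so [pw (W * t')] is bounded by [pw p0 / rlow], and the integral
   entries of [v] have modulus below 1. *)
have v_eq0 i : v 0 (lift 0 i) = 0.
  have h1 : `|(v 0 (lift 0 i))%:~R : R| < 1.
    have h2 : `|(v 0 (lift 0 i))%:~R : R| < mu * pw (W * t'%:R).
      have := va i; rewrite pwN ltr_pdivrMl // mulrC => h.
      apply: lt_le_trans h _; rewrite ler_wpM2l ?(ltW mu0) // ple ler_wpM2r //.
      by apply: le_trans (wmax i) _; rewrite /max_rate; lra.
    apply: lt_le_trans h2 _; rewrite -(ler_pM2r rlow0) mul1r -mulrA.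
    apply: le_trans (_ : _ <= mu * pw p0%:R) _.
      rewrite ler_wpM2l ?(ltW mu0) //; apply: ltW; apply: le_lt_trans hr.
      by rewrite mulrC ler_pM2r.
    apply: le_trans (_ : _ <= pw (- (4 * p%:R)) * pw p0%:R) _; first by rewrite ler_pM2r.
    rewrite -pD.
    apply: le_trans (_ : _ <= pw (- p0%:R)) _; first by rewrite ple; lra.
    rewrite pwN -[leLHS]mul1r ler_pdivrMr // mulrC; apply: le_trans big_C _.
    rewrite ler_pM2r // ple.
    have : 2 * eta * n%:R * p0%:R <= 1 * p0%:R.
      rewrite ler_wpM2r //; apply: le_trans eta1; rewrite ler_wpM2l // ?ler_nat //.
      by rewrite mulr_ge0 // ltW.
    lra.
  apply/eqP; rewrite -[_ == 0]negbK -normr_gt0 gtz0_ge1 -(ler1z R) intr_norm.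
  by rewrite -ltNge.
have v00 : v 0 0 = 0.
  have h1 : `|(v 0 0)%:~R : R| < 1.
    have : form v (B m.+1).1 = (v 0 0)%:~R.
      by rewrite /form big1 ?addr0 // => i _; rewrite v_eq0 mulr0.
    move=> e; move: vf; rewrite e => h.
    apply: le_lt_trans (_ : _ <= pw t'%:R * `|(v 0 0)%:~R|) _.
      by rewrite ler_peMl // pw_ge1.
    apply: lt_le_trans h _; apply: le_trans mu_tiny _; rewrite -[leRHS](pw0 g) ple; lra.
  apply/eqP; rewrite -[_ == 0]negbK -normr_gt0 gtz0_ge1 -(ler1z R) intr_norm.
  by rewrite -ltNge.
move/negP: v0; apply; apply/eqP/matrixP => a c; rewrite mxE (ord1 a).
by have [->|[i ->]] : c = 0 \/ exists i, c = lift 0 i;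
  [case: (unliftP 0 c) => [i ->|->]; [right; exists i|left]| |].
Qed.


(** The outcome of the homogeneous part in a form free of stages: [m] may lie arbitrarily deep,
    because shortness is carried back to the last ball at or above stage [p0]. *)
Lemma no_short_dual (t m : nat) :
  pw p0%:R <= (B 0).2 * pw (W * t%:R) -> (B m).2 * pw (W * t%:R) < pw p0%:R ->
  forall v : 'rV[int]_n.+1, v != 0 ->
  (forall i, pw (- (w i * t%:R)) * `|(v 0 (lift 0 i))%:~R| < (pw p0%:R * c0)^-1) ->
  ~ pw t%:R * `|form v (B m).1| < (pw p0%:R * c0)^-1.
Proof.
move=> hr hm v v0 va vf.
have exm : exists k, (B k).2 * pw (W * t%:R) < pw p0%:R by exists m.
case: (ex_minnP exm) => -[|k] hk kmin; first by move: hk; rewrite ltNge hr.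
have km : (k.+1 <= m)%N by exact: kmin.
have hk1 : pw p0%:R <= (B k).2 * pw (W * t%:R).
  by rewrite leNgt; apply/negP => /kmin; rewrite ltnn.
have hk2 : (B k).2 * pw (W * t%:R) <= pw p0%:R / lam.
  rewrite ler_pdivlMr // mulrC mulrA; apply: ltW; apply: le_lt_trans hk.
  by rewrite ler_pM2r.
have M17 := M_ge17.
have al' : alive t p0 (B k).2.
  rewrite /stage_alive hk1 /=; apply: le_trans hk2 _.
  rewrite ler_pdivrMr //; apply: le_trans (_ : _ <= pw (M * p0)%:R * pw (- p0%:R)) _.
    rewrite -pD ple natrM; have : 17 * p0%:R <= M%:R * p0%:R :> R by rewrite ler_wpM2r.
    have : 1 <= p0%:R :> R by rewrite ler1n. lra.
  rewrite ler_pM2l // pwN -[leLHS]mul1r ler_pdivrMr // mulrC //.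
have := @protected t p0 k (leqnn _) al'.
case/(_ _ v v0) => [m' hm'|]; first exact: starts.
have hs := @vsmall_unshrink _ t v (B m).1 (B k).1 (B k).2 (r_gt0 k) hk2
   (fun i => y_near i (ltnW km)) va vf.
have -> : B k = ((B k).1, (B k).2) by case: (B k).
move=> c; apply: lt_le_trans (hs c) _.
have c00 : 0 < c0 by exact: c0_gt0.
rewrite -mulrA mulVf; last by rewrite gt_eqF // mulr_gt0.
by rewrite /margin pw_ge1 // mulr_ge0 // (ltW eta0).
Qed.

End Starts.

(** * Transference and the inhomogeneous step *)

Section Transference.
Context {R : realType} {n : nat}.

Lemma abszE_or (z : int) : `|z|%N%:Z = z \/ `|z|%N%:Z = - z.
Proof. by lia. Qed.

Lemma pigeonhole_mod (N : 'I_n -> nat) (P : 'I_n -> int) (q : nat) :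
  (0 < q)%N -> (q < \prod_i N i)%N ->
  exists a : 'I_n -> int, [/\ exists i, a i != 0,
    forall i, (`|a i| < N i)%N & (q%:Z %| \sum_i a i * P i)%Z].
Proof.
move=> q0 qN.
pose T := {dffun forall i : 'I_n, 'I_(N i)}.
pose F (f : T) : int := \sum_i (f i : nat)%:Z * P i.
have F_lt f : (`|(F f %% q%:Z)%Z| < q)%N.
  rewrite -ltz_nat gez0_abs ?modz_ge0 ?ltz_pmod //; lia.
pose G (f : T) : 'I_q := Ordinal (F_lt f).
have cT : #|T| = (\prod_i N i)%N.
  rewrite card_dep_ffun foldrE big_map big_enum /=.
  by apply: eq_bigr => i _; rewrite card_ord.
have nG : ~ injective G.
  by move=> /leq_card; rewrite cT card_ord leqNgt qN.
have [f [f' [ff' e]]] : exists f f', f != f' /\ G f = G f'.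
  apply: contrapT => H; apply: nG => f f' e; apply: contrapT => /eqP ff'.
  by apply: H; exists f, f'.
exists (fun i => (f i : nat)%:Z - (f' i : nat)%:Z); split.
- apply: contrapT => H; move/eqP: ff'; apply; apply/ffunP => i; apply/val_inj.
  apply: contrapT => /eqP h; apply: H; exists i; move: h => /=; lia.
- move=> i; have := ltn_ord (f i); have := ltn_ord (f' i).
  lia.
have -> : \sum_i ((f i : nat)%:Z - (f' i : nat)%:Z) * P i = F f - F f'.
  by rewrite -sumrB; apply: eq_bigr => i _; rewrite mulrBl.
rewrite -eqz_mod_dvd; apply/eqP.
have e' : `|(F f %% q%:Z)%Z|%N = `|(F f' %% q%:Z)%Z|%N by move/(congr1 val): e.
have q0' : q%:Z != 0 by lia.
by rewrite -[LHS]gez0_abs ?modz_ge0 // e' gez0_abs ?modz_ge0.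
Qed.

Variables (w : 'I_n -> R) (g wmin : R).
Hypotheses (w1 : \sum_i w i = 1) (g0 : 0 < g) (wmin0 : 0 < wmin)
  (wminP : forall i, wmin <= w i) (g2 : 2 <= base_pow g 1).
Local Notation pw := (base_pow g).

(** With [pw h = 2 * |Q|], the box of integers [a] with sides about [pw (w i * h)] has more than
    [|Q|] points, so some nonzero difference has [a.P = b * Q]. Then [a.y - b] is the sum of the
    [a_i * (Q * y_i - P_i)] divided by [Q]. The [s] further units of time make the coefficients
    small, at the price of [pw s] in the value of the form. *)
Lemma transference (Q : int) (P : 'rV[int]_n) (y : 'rV[R]_n) (k s : nat) (e mu : R) :
  Q != 0 -> `|Q|%:~R <= pw (k%:R + 2) ->
  (forall i, `|Q%:~R * y 0 i - (P 0 i)%:~R| <= e * pw (- (w i * k%:R))) ->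
  0 <= e -> pw (- (wmin * s%:R)) <= mu -> 2 * n%:R * e * pw (s%:R + 4) < mu ->
  exists (t : nat) (v : 'rV[int]_n.+1), [/\ (s <= t <= k + 4 + s)%N, v != 0,
    (forall i, pw (- (w i * t%:R)) * `|(v 0 (lift 0 i))%:~R| < mu) &
    pw t%:R * `|form v y| < mu].
Proof.
move=> Q0 Qk hQ e0 hmu1 hmu2.
have w_gt0 i : 0 < w i by exact: lt_le_trans (wminP i).
have w_le1 i : w i <= 1.
  by rewrite -w1 (bigD1 i) //= lerDl; apply: sumr_ge0 => *; exact: ltW.
have pgt0 x : 0 < pw x by exact: pw_gt0.
have ple a c : (pw a <= pw c) = (a <= c) by exact: pw_le.
set q := `|Q|%N.
have qE : q%:R = `|Q|%:~R :> R by rewrite /q natr_absz.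
have q1 : 1 <= q%:R :> R by rewrite ler1n /q absz_gt0.
have q0 : 0 < q%:R :> R by lra.
pose h := ln (2 * q%:R) / g.
have hE : pw h = 2 * q%:R by rewrite /pw /h mulrC divfK ?gt_eqF // lnK // posrE mulr_gt0.
have h0 : 0 <= h by rewrite -(pw_ge1 g0) hE; lra.
have hk : h <= k%:R + 3.
  rewrite -ple hE (_ : k%:R + 3 = 1 + (k%:R + 2)); last by ring.
  by rewrite pwD ler_pM // qE.
pose N i := (Num.truncn (pw (w i * h))).+1.
have N_gt i : pw (w i * h) < (N i)%:R.
  by have /andP[] := truncn_itv (ltW (pgt0 (w i * h))).
have N_le i : (N i).-1%:R <= pw (w i * h).
  by have /andP[] := truncn_itv (ltW (pgt0 (w i * h))).
have hq0 : (0 < q)%N by rewrite absz_gt0.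
have hqN : (q < \prod_i N i)%N.
  rewrite -(ltr_nat R) natr_prod; apply: lt_le_trans (_ : pw h <= _).
    by rewrite hE; lra.
  have -> : pw h = \prod_i pw (w i * h).
    by rewrite /pw -expR_sum -mulr_sumr -mulr_suml w1 mul1r.
  by apply: ler_prod => i _; rewrite ltW //= ltW.
have [a [[i0 ai0] aN aP]] := pigeonhole_mod (P 0) hq0 hqN.
have [b hb] : exists b, \sum_i a i * P 0 i = b * Q.
  have /dvdzP[b0 hb0] := aP; have [qQ|qQ] := abszE_or Q.
    by exists b0; rewrite hb0 -/q qQ.
  by exists (- b0); rewrite hb0 -/q qQ mulrN mulNr.
pose v : 'rV[int]_n.+1 := \row_c (if unlift 0 c is Some i then a i else - b).
have va i : v 0 (lift 0 i) = a i by rewrite /v mxE liftK.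
have vb : v 0 0 = - b by rewrite /v mxE unlift_none.
pose t := (Num.truncn h + s).+1.
have /andP[th1 th2] := truncn_itv h0.
have tE : t%:R = (Num.truncn h)%:R + s%:R + 1 :> R by rewrite /t -natr1 natrD.
have n00 : 0 <= n%:R :> R by [].
exists t, v; split.
- apply/andP; split; first by rewrite /t leqW // leq_addl.
  rewrite -(ler_nat R) tE !natrD; have := hk; lra.
- by apply: contra_neq ai0 => v0; rewrite -va v0 mxE.
- move=> i; apply: lt_le_trans hmu1; rewrite va.
  have h1 : `|(a i)%:~R : R| <= pw (w i * h).
    apply: le_trans (N_le i); rewrite -intr_norm -natr_absz ler_nat.
    exact: aN i.
  apply: le_lt_trans (_ : _ <= pw (- (w i * t%:R)) * pw (w i * h)) _.
    by rewrite ler_pM2l.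
  rewrite -pwD pw_lt // tE.
  have : w i * h < w i * ((Num.truncn h)%:R + 1) by rewrite ltr_pM2l // natr1.
  have : wmin * s%:R <= w i * s%:R by rewrite ler_wpM2r.
  lra.
have Qr0 : (Q%:~R : R) != 0 by rewrite intr_eq0.
have formE : form v y = (\sum_i (a i)%:~R * (Q%:~R * y 0 i - (P 0 i)%:~R)) / Q%:~R.
  rewrite /form vb.
  have -> : \sum_i (a i)%:~R * (Q%:~R * y 0 i - (P 0 i)%:~R) =
     Q%:~R * (\sum_i y 0 i * (a i)%:~R) - (b * Q)%:~R.
    rewrite -hb rmorph_sum mulr_sumr -sumrB; apply: eq_bigr => i _.
    by rewrite rmorphM; ring.
  rewrite (eq_bigr (fun i => y 0 i * (a i)%:~R)); last by move=> i _; rewrite va.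
  by rewrite rmorphM rmorphN /=; field.
have fle : `|form v y| <= n%:R * e * pw 3 / q%:R.
  rewrite formE normrM normfV -intr_norm -qE ler_pM2r ?invr_gt0 //.
  apply: le_trans (ler_norm_sum _ _ _) _.
  have -> : n%:R * e * pw 3 = \sum_(i < n) (e * pw 3).
    by rewrite sumr_const card_ord -[RHS]mulr_natl mulrA.
  apply: ler_sum => i _; rewrite normrM.
  have h1 : `|(a i)%:~R : R| <= pw (w i * h).
    apply: le_trans (N_le i); rewrite -intr_norm -natr_absz ler_nat.
    exact: aN i.
  apply: le_trans (_ : _ <= pw (w i * h) * (e * pw (- (w i * k%:R)))) _.
    exact: ler_pM.
  rewrite mulrCA -pwD; apply: ler_wpM2l => //; rewrite ple.
  have : w i * (h - k%:R) <= w i * 3 by rewrite ler_pM2l //; lra.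
  have := w_le1 i; lra.
apply: le_lt_trans hmu2.
apply: le_trans (_ : _ <= pw t%:R * (n%:R * e * pw 3 / q%:R)) _; first by rewrite ler_pM2l.
have tle : pw t%:R <= pw (s%:R + 1) * (2 * q%:R).
  by rewrite -hE -pwD ple tE; lra.
apply: le_trans (_ : _ <= pw (s%:R + 1) * (2 * q%:R) * (n%:R * e * pw 3 / q%:R)) _.
  by apply: ler_wpM2r => //; rewrite !mulr_ge0 ?invr_ge0 // ltW.
rewrite (_ : s%:R + 4 = (s%:R + 1) + 3); last by ring.
rewrite [in leRHS]pwD le_eqVlt; apply/orP; left; apply/eqP; field.
by rewrite gt_eqF.
Qed.

End Transference.

(** * At most one inhomogeneous solution per ball *)

Section Inhomogeneous.
Context {R : realType} {n : nat}.

Lemma intr_lt1 (z : int) : `|z%:~R : R| < 1 -> z = 0.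
Proof.
rewrite -intr_norm ltrz1 => h; apply/eqP; rewrite -normr_eq0 eq_le normr_ge0 andbT.
by rewrite -ltzD1 add0r.
Qed.

Definition removal : Type := ('rV[R]_n * R * 'I_n * R)%type.

Variables (w : 'I_n -> R) (i1 : 'I_n) (theta : 'rV[R]_n) (g lam C wmin : R)
  (mu Rr c : R) (s p0 : nat).
Hypotheses (w1 : \sum_i w i = 1) (wmin0 : 0 < wmin) (wminP : forall i, wmin <= w i)
  (wmax : forall i, w i <= w i1) (g0 : 0 < g) (g2 : 2 <= base_pow g 1)
  (lam01 : 0 < lam < 1) (lamg : lam^-1 < base_pow g 1) (C1 : 1 <= C).
Local Notation pw := (base_pow g).
Local Notation W := (max_rate w i1).
Definition inhom_err : R := 2 * c + 2 * C * pw 1 * (Rr / lam).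
Hypotheses (Rr0 : 0 < Rr) (cc0 : 0 < c) (err1 : inhom_err < 1)
  (hmu1 : pw (- (wmin * s%:R)) <= mu)
  (hmu2 : 2 * n%:R * inhom_err * pw (s%:R + 4) < mu)
  (hRr : Rr / lam * pw (2 * (s%:R + 4)) < 1).

(* Vectors with |q| about exp (g k) are treated at the balls whose radius is
   about exp (- g W k). *)
Definition inhom_hit (B : @yball R n) (k : nat) (q : int) (P : 'rV[int]_n) : Prop :=
  [/\ Rr <= B.2 * pw (W * k%:R) <= Rr / lam,
      pw k%:R <= `|q|%:~R <= pw (k%:R + 1) &
      forall i, `|q%:~R * B.1 0 i - (P 0 i)%:~R - theta 0 i| <=
        c * pw (- (w i * k%:R)) + C * `|q|%:~R * B.2].

(** The coordinate of largest weight suffices. There the variation [B.2 * |q|] over the ball is at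
    least [Rr * pw (- (w i1 * k))], so the slab has relative width at most [c / Rr], and a point
    that violates the bound in all coordinates violates it in this one. *)
Definition inhom_removal (k : nat) (q : int) (P : 'rV[int]_n) : removal :=
  (q%:~R *: delta_mx 0 i1, - ((P 0 i1)%:~R + theta 0 i1), i1, c * pw (- (w i1 * k%:R))).

Definition inhom_emission (h : seq (@yball R n)) : option removal :=
  if h is B :: _ then
    if pselect (exists x : nat * int * 'rV[int]_n, inhom_hit B x.1.1 x.1.2 x.2)
    is left ex then
      let x := projT1 (cid ex) in Some (inhom_removal x.1.1 x.1.2 x.2)
    else None
  else None.

Let w_pos i : 0 < w i. Proof. exact: lt_le_trans (wminP i). Qed.
Let w_le1 i : w i <= 1.
Proof. by rewrite -w1 (bigD1 i) //= lerDl; apply: sumr_ge0 => *; exact: ltW. Qed.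
Let W_le2 : W <= 2. Proof. by rewrite /max_rate; have := w_le1 i1; lra. Qed.
Let W_ge1 : 1 <= W. Proof. by rewrite /max_rate; have := w_pos i1; lra. Qed.
Let pgt0 x : 0 < pw x. Proof. exact: pw_gt0. Qed.
Let ple x y : (pw x <= pw y) = (x <= y). Proof. exact: pw_le. Qed.
Let plt x y : (pw x < pw y) = (x < y). Proof. exact: pw_lt. Qed.
Let pD x y : pw (x + y) = pw x * pw y. Proof. exact: pwD. Qed.
Let lam0 : 0 < lam. Proof. by case/andP: lam01. Qed.

Lemma dot_removal q P k (y : 'rV[R]_n) :
  let e := inhom_removal k q P in
  dot e.1.1.1 y + e.1.1.2 = q%:~R * y 0 i1 - (P 0 i1)%:~R - theta 0 i1.
Proof.
rewrite /= /dot (bigD1 i1) //= !mxE !eqxx mulr1 big1 ?addr0; first by ring.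
by move=> i /negbTE h; rewrite !mxE h mulr0 mul0r.
Qed.

Lemma removal_coef q P k : (inhom_removal k q P).1.1.1 0 i1 = q%:~R.
Proof. by rewrite /= !mxE !eqxx mulr1. Qed.

Lemma inhom_size h B x : inhom_emission (B :: h) = Some x -> 0 < B.2 ->
  0 < x.2 /\ x.2 <= c / Rr * (B.2 * `|x.1.1.1 0 x.1.2|).
Proof.
rewrite /inhom_emission; case: pselect => // ex [<-]; case: cid => -[[k q] P] /= hit r0.
have [/andP[h1 h2] /andP[h3 h4] _] := hit; split; first by rewrite mulr_gt0.
have e : `|(q%:~R *: delta_mx 0 i1 : 'rV[R]_n) 0 i1| = `|q|%:~R :> R.
  by rewrite !mxE !eqxx mulr1 intr_norm.
rewrite e {e}.
rewrite [leRHS](_ : _ = c * (B.2 * `|q|%:~R / Rr)); last by ring.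
rewrite ler_pM2l // ler_pdivlMr //.
apply: le_trans (_ : _ <= pw (- (w i1 * k%:R)) * (B.2 * pw (W * k%:R))) _.
  by rewrite ler_pM2l.
rewrite mulrCA -pD ler_pM2l //; apply: le_trans h3; rewrite ple /max_rate; lra.
Qed.

Variable B : nat -> @yball R n.
Hypotheses (r_gt0 : forall m, 0 < (B m).2)
  (r_lam : forall m, lam * (B m).2 <= (B m.+1).2)
  (r_half : forall m, (B m.+1).2 <= 2^-1 * (B m).2)
  (big_r0 : pw p0%:R <= (B 0).2 * pw s%:R) (Rr_r0 : Rr <= (B 0).2).

Hypothesis nsd : forall t m : nat,
  pw p0%:R <= (B 0).2 * pw (W * t%:R) -> (B m).2 * pw (W * t%:R) < pw p0%:R ->
  forall v : 'rV[int]_n.+1, v != 0 ->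
  (forall i, pw (- (w i * t%:R)) * `|(v 0 (lift 0 i))%:~R| < mu) ->
  ~ pw t%:R * `|form v (B m).1| < mu.

(** The level [k] is determined by the ball because [lam^-1 < pw W]. The difference of two hits no
    longer contains [theta]: for [q != q'] transference gives a dual vector excluded by [nsd], and
    for [q = q'] the integral vector [P - P'] has entries below 1. *)
Lemma inhom_unique m k k' q q' P P' :
  inhom_hit (B m) k q P -> inhom_hit (B m) k' q' P' -> [/\ k = k', q = q' & P = P'].
Proof.
have pW1 : lam^-1 < pw W by apply: lt_le_trans lamg _; rewrite ple.
have klt k1 k2 : Rr <= (B m).2 * pw (W * k1%:R) ->
    (B m).2 * pw (W * k2%:R) <= Rr / lam -> (k2 <= k1)%N.
  move=> h1 h2; rewrite leqNgt; apply/negP => kk.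
  have : Rr * pw W <= Rr / lam.
    apply: le_trans h2; apply: le_trans (_ : _ <= (B m).2 * pw (W * k1%:R) * pw W) _.
      by rewrite ler_pM2r.
    rewrite -mulrA -pD ler_pM2l // ple -{2}[W]mulr1 -mulrDr ler_pM2l ?natr1 ?ler_nat //.
    by apply: lt_le_trans W_ge1.
  by rewrite ler_pM2l // leNgt pW1.
case=> /andP[h1 h2] /andP[h3 h4] h5 [/andP[h1' h2'] /andP[h3' h4'] h5'].
have kk : k = k' by apply/eqP; rewrite eqn_leq (klt _ _ h1 h2') (klt _ _ h1' h2).
rewrite -{k'}kk in h1' h2' h3' h4' h5' *.
have hD i : `|(q - q')%:~R * (B m).1 0 i - ((P - P') 0 i)%:~R| <=
    inhom_err * pw (- (w i * k%:R)).
  have -> : (q - q')%:~R * (B m).1 0 i - ((P - P') 0 i)%:~R =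
    (q%:~R * (B m).1 0 i - (P 0 i)%:~R - theta 0 i) -
    (q'%:~R * (B m).1 0 i - (P' 0 i)%:~R - theta 0 i).
    by rewrite !mxE !intrB; ring.
  apply: le_trans (ler_normB _ _) _.
  apply: le_trans (lerD (h5 i) (h5' i)) _.
  have e1 : (B m).2 * pw (k%:R + 1) <= Rr / lam * pw 1 * pw (- (w i * k%:R)).
    apply: le_trans (_ : _ <= (B m).2 * pw (W * k%:R) * (pw 1 * pw (- (w i * k%:R)))) _.
      rewrite -mulrA ler_pM2l // -!pD ple /max_rate.
      have : w i * k%:R <= w i1 * k%:R by rewrite ler_wpM2r.
      lra.
    by rewrite -[leRHS]mulrA ler_pM2r // mulr_gt0.
  have e2 x : x <= pw (k%:R + 1) -> C * x * (B m).2 <= C * (Rr / lam * pw 1 * pw (- (w i * k%:R))).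
    move=> hx; rewrite -mulrA ler_wpM2l ?(le_trans _ C1) //.
    by apply: le_trans e1; rewrite mulrC ler_pM2l.
  have := e2 _ h4; have := e2 _ h4'; rewrite /inhom_err; lra.
have e0 : 0 <= inhom_err.
  have : 0 <= C * pw 1 * (Rr / lam).
    by rewrite !mulr_ge0 ?invr_ge0 ?(ltW Rr0) ?(ltW lam0) ?(ltW (pgt0 _)) // (le_trans _ C1).
  by rewrite /inhom_err; have := cc0; lra.
have [Q0|Q0] := eqVneq (q - q') 0.
  split => //; first by apply/eqP; rewrite -subr_eq0 Q0.
  apply/matrixP => a i; rewrite (ord1 a); apply/eqP; rewrite -subr_eq0; apply/eqP.
  apply: intr_lt1.
  have := hD i; rewrite Q0 mul0r sub0r normrN !mxE => h.
  apply: le_lt_trans h _; apply: le_lt_trans err1; rewrite ler_piMr //.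
  by rewrite -[leRHS](pw0 g) ple oppr_le0 mulr_ge0 // (ltW (w_pos i)).
exfalso.
have Qk : `|q - q'|%:~R <= pw (k%:R + 2).
  rewrite intr_norm intrB; apply: le_trans (ler_normB _ _) _; rewrite -!intr_norm.
  apply: le_trans (lerD h4 h4') _.
  rewrite (_ : k%:R + 2 = k%:R + 1 + 1); last by ring.
  apply: le_trans (_ : _ <= pw (k%:R + 1) * 2) _; first by lra.
  by rewrite (pD (k%:R + 1)) ler_pM2l.
have [t [v [/andP[t1 t2] v0 va vf]]] :=
  transference w1 g0 wmin0 wminP g2 Q0 Qk hD e0 hmu1 hmu2.
apply: (nsd _ _ v0 va vf).
  apply: le_trans big_r0 _; rewrite ler_pM2l // ple.
  apply: le_trans (_ : _ <= t%:R) _; first by rewrite ler_nat.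
  by rewrite ler_peMl.
apply: lt_le_trans (_ : 1 <= _); last by rewrite pw_ge1.
apply: le_lt_trans hRr.
apply: le_trans (_ : _ <= (B m).2 * pw (W * k%:R) * pw (2 * (s%:R + 4))) _; last first.
  by rewrite ler_pM2r.
rewrite -mulrA ler_pM2l // -pD ple.
have : t%:R <= k%:R + 4 + s%:R :> R by rewrite -!natrD ler_nat.
move=> h; apply: le_trans (_ : _ <= W * (k%:R + 4 + s%:R)) _.
  by rewrite ler_pM2l //; apply: lt_le_trans W_ge1.
have : W * (4 + s%:R) <= 2 * (4 + s%:R) by rewrite ler_wpM2r // addr_ge0.
lra.
Qed.

Hypothesis promise : forall m x, inhom_emission (hist B m) = Some x ->
  forall m', (m <= m')%N -> `|dot x.1.1.1 (B m').1 + x.1.1.2| < x.2 ->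
    x.2 <= (B m').2 * `|x.1.1.1 0 x.1.2|.

Lemma r_exp m : (B m).2 <= (B 0).2 * 2^-1 ^+ m.
Proof.
elim: m => [|m IH]; first by rewrite expr0 mulr1.
by apply: le_trans (r_half m) _; rewrite exprS mulrCA ler_pM2l.
Qed.

Lemma r_small e : 0 < e -> exists m, forall m', (m <= m')%N -> (B m').2 < e.
Proof.
move=> e0; pose m := Num.bound ((B 0).2 / e).
have hm : (B 0).2 / e < m%:R by apply: archi_boundP; rewrite divr_ge0 // ltW.
exists m => m' mm'; apply: le_lt_trans (r_le r_gt0 r_half mm') _.
apply: le_lt_trans (r_exp m) _.
rewrite exprVn ltr_pdivrMr ?exprn_gt0 // mulrC -ltr_pdivrMr //.
by apply: lt_le_trans hm _; rewrite -natrX ler_nat ltnW // ltn_expl.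
Qed.

Lemma exists_level (k : nat) : exists m, Rr <= (B m).2 * pw (W * k%:R) <= Rr / lam.
Proof.
have pW0 := pgt0 (W * k%:R).
have exm : exists m, (B m).2 * pw (W * k%:R) < Rr.
  have [|m hm] := @r_small (Rr / pw (W * k%:R)); first exact: divr_gt0.
  by exists m; rewrite -ltr_pdivlMr //; exact: hm.
case: (ex_minnP exm) => -[|m] hm mmin.
  exfalso; move: hm; rewrite ltNge => /negP; apply; apply: le_trans Rr_r0 _.
  rewrite ler_peMr //; first exact/ltW.
  by rewrite pw_ge1 // mulr_ge0 // (le_trans _ W_ge1).
exists m; apply/andP; split.
  by rewrite leNgt; apply/negP => /mmin; rewrite ltnn.
rewrite ler_pdivlMr // mulrC mulrA; apply: ltW; apply: le_lt_trans hm.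
by rewrite ler_pM2r.
Qed.

Lemma nat_bracket (x : R) : 1 <= x -> exists k : nat, pw k%:R <= x <= pw (k%:R + 1).
Proof.
move=> x1; have exk : exists k : nat, x < pw k%:R := pw_unbounded g0 x.
case: (ex_minnP exk) => -[|k] hk kmin.
  by have := le_lt_trans x1 hk; rewrite pw0 ltxx.
exists k; rewrite natr1 (ltW hk) andbT leNgt; apply/negP => /kmin; by rewrite ltnn.
Qed.

(** A violating [q] hits the ball of its level, and by uniqueness its slab is the announced one. The
    point [y] lies strictly inside the slab, hence so do the late centres, while [|q|] times the
    radius tends to 0; this breaks [promise]. *)
Lemma inhom_final (y : 'rV[R]_n) :
  (forall m i, `|y 0 i - (B m).1 0 i| <= C * (B m).2) ->
  forall (q : int) (P : 'rV[int]_n), q != 0 ->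
  exists i, c <= `|q%:~R * y 0 i - (P 0 i)%:~R - theta 0 i| * expR (w i * ln `|q%:~R|).
Proof.
move=> hy q P q0; apply: contrapT => H.
have q1 : 1 <= `|q|%:~R :> R by rewrite ler1z -gtz0_ge1 normr_gt0.
have qn0 : 0 < `|q|%:~R :> R by apply: lt_le_trans q1.
have [k hk] := nat_bracket q1.
have [m hm] := exists_level k.
have hlt i : `|q%:~R * y 0 i - (P 0 i)%:~R - theta 0 i| < c * pw (- (w i * k%:R)).
  rewrite ltNge; apply/negP => h; apply: H; exists i.
  apply: le_trans (ler_wpM2r (expR_ge0 _) h).
  rewrite -mulrA; apply: ler_peMr; first exact: ltW.
  rewrite /base_pow -expRD -[leLHS]expR0 ler_expR mulrN addrC subr_ge0 mulrCA ler_pM2l //.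
  rewrite -ler_expR -intr_norm lnK ?posrE //.
  by case/andP: hk.
have hit : inhom_hit (B m) k q P.
  split => // i.
  have -> : q%:~R * (B m).1 0 i - (P 0 i)%:~R - theta 0 i =
    (q%:~R * y 0 i - (P 0 i)%:~R - theta 0 i) - q%:~R * (y 0 i - (B m).1 0 i) by ring.
  apply: le_trans (ler_normB _ _) _; apply: lerD; first exact: ltW.
  rewrite normrM -intr_norm [leRHS]mulrAC mulrC; apply: ler_wpM2r; first exact: ltW.
  exact: hy.
have [x hx] : exists x, inhom_emission (hist B m) = Some x /\ x = inhom_removal k q P.
  rewrite histE /inhom_emission; case: pselect => [ex|[]]; last by exists (k, q, P).
  eexists; split; first reflexivity; case: cid => -[[k' q'] P'] /= hit'.
  by have [-> -> ->] := inhom_unique hit' hit.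
case: hx => hx xE; have := promise hx; rewrite xE => pr.
pose ee := c * pw (- (w i1 * k%:R)).
have e0 : 0 < ee by rewrite mulr_gt0.
pose d := ee - `|q%:~R * y 0 i1 - (P 0 i1)%:~R - theta 0 i1|.
have d0 : 0 < d by rewrite subr_gt0 hlt.
have C0 : 0 < C by apply: lt_le_trans C1.
have [|m1 hm1] := @r_small (Num.min (d / (C * `|q|%:~R)) (ee / `|q|%:~R)).
  by rewrite lt_min !divr_gt0 // mulr_gt0.
have := hm1 (maxn m1 m) (leq_maxl _ _); rewrite lt_min => /andP[h1 h2].
have := pr (maxn m1 m) (leq_maxr _ _); rewrite dot_removal removal_coef.
move=> /(_ _); set B' := B (maxn m1 m) in h1 h2 *; have hyB := hy (maxn m1 m) i1.
rewrite -/B' in hyB; move=> pr'.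
have : ee <= B'.2 * `|q%:~R|.
  apply: pr'; rewrite -[ltRHS]/ee.
  have -> : q%:~R * B'.1 0 i1 - (P 0 i1)%:~R - theta 0 i1 =
    (q%:~R * y 0 i1 - (P 0 i1)%:~R - theta 0 i1) - q%:~R * (y 0 i1 - B'.1 0 i1) by ring.
  apply: le_lt_trans (ler_normB _ _) _.
  rewrite addrC -ltrBrDr -/d normrM -intr_norm.
  apply: le_lt_trans (_ : _ <= `|q|%:~R * (C * B'.2)) _; first by rewrite ler_pM2l.
  rewrite ltr_pdivlMr ?mulr_gt0 // in h1.
  by rewrite [ltLHS](_ : _ = B'.2 * (C * `|q|%:~R)) //; ring.
by apply/negP; rewrite -ltNge -intr_norm -ltr_pdivlMr.
Qed.

End Inhomogeneous.

(** * The homogeneous and inhomogeneous removals combined *)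

Section LatticeMachine.
Context {R : realType} {n : nat}.

Lemma pw_large (g c X : R) : 0 < g -> 0 < c -> exists p : nat, (0 < p)%N /\ X <= base_pow g (c * p%:R).
Proof.
move=> g0 c0; have gc0 : 0 < g * c by rewrite mulr_gt0.
have [q hq] := pw_unbounded gc0 X; exists q.+1; split => //.
apply: le_trans (ltW hq) _.
have -> : base_pow g (c * q.+1%:R) = base_pow (g * c) q.+1%:R by rewrite /base_pow mulrA.
by rewrite pw_le // ler_nat.
Qed.

Definition first_time (w : 'I_n -> R) i1 g (r : R) (p : nat) : nat :=
  if pselect (exists t : nat, base_pow g p%:R <= r * base_pow g (max_rate w i1 * t%:R)) is left ex
  then ex_minn ex else 0%N.

(* Index (_, _, 0) is reserved for the inhomogeneous removal.  Otherwise
   (p', u, j) stands for the stage p0 + p', the u-th time of this stage, and the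
   rank j of the sublattice that has just joined the flag. *)
Definition machine (w : 'I_n -> R) i1 theta g lam C eta M Rr c p0
    (h : seq (@yball R n)) (idx : nat * nat * nat) : option removal :=
  if idx.2 == 0%N then
    (if idx.1 == (0%N, 0%N) then inhom_emission w i1 theta g lam C Rr c h else None)
  else if h is B :: _ then
    let p := (p0 + idx.1.1)%N in
    let t := (first_time w i1 g B.2 p + idx.1.2)%N in
    if stage_alive w i1 g M t p B.2 && (idx.2 <= n)%N then
      omap (fun x => (x, eps (n := n) g lam C eta p idx.2))
        (emission w i1 g lam C eta M t p idx.2 h)
    else None
  else None.

(** The relative width at stage [p] is at most [c6 / margin p]. Half of the exponent [eta * p]
    absorbs the constants and [tau ^+ n] by the choice of [p0]; the other half absorbs
    [tau ^+ (p' + u)], as [u <= M * p] bounds the index by a multiple of [p]. *)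
Lemma machine_size (w : 'I_n -> R) i1 theta g lam C eta M Rr c p0 delta tau :
  (forall i, 0 < w i) -> 0 < g -> 0 < lam < 1 -> 1 <= C -> 0 < eta -> 0 < delta ->
  0 < tau -> tau < 1 -> 0 < Rr -> 0 < c -> c / Rr <= delta ->
  base_pow g (- (eta / 2)) <= tau ^+ M.+2 ->
  2 * n%:R * n.+1%:R * C * drift (n := n) lam C ^+ 2 / (delta * tau ^+ n) <=
    base_pow g (eta / 2 * p0%:R) ->
  forall h (B : @yball R n) idx x, 0 < B.2 ->
    machine w i1 theta g lam C eta M Rr c p0 (B :: h) idx = Some x ->
    0 < x.2 /\ x.2 <= delta * tau ^+ (idx.1.1 + idx.1.2 + idx.2) *
         (B.2 * `|x.1.1.1 0 x.1.2|).
Proof.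
move=> w_pos g0 lam01 C1 eta0 d0 tau0 tau1 Rr0 cc0 cRr taug.
set c0 := drift lam C; set c6 := 2 * n%:R * n.+1%:R * C * c0 ^+ 2 => hX.
have c00 : 0 < c0 by rewrite (lt_trans ltr01) // (c0_gt1 i1).
have n0 : 0 < n%:R :> R by rewrite ltr0n (n_gt0 i1).
have C0 : 0 < C by rewrite (lt_le_trans ltr01).
have c60 : 0 < c6.
  by rewrite /c6; apply: mulr_gt0; [do 3!apply: mulr_gt0 => //|exact: exprn_gt0].
move=> h B [[p' u] j] x r0; rewrite /machine /=; have [->|j0] := eqVneq j 0%N.
  have [[-> ->]|_] := eqVneq (p', u) (0%N, 0%N); last by [].
  move=> hx.
  have [h1 h2] := @inhom_size _ _ _ _ _ _ _ _ _ _ g0 Rr0 cc0 h B x hx r0; split => //.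
  rewrite addn0 expr0 mulr1; apply: le_trans h2 _; apply: ler_wpM2r => //.
  by rewrite mulr_ge0 // ltW.
set t := (_ + u)%N; set p := (p0 + p')%N.
case: ifP => // /andP[al jn].
case E : emission => [x'|] //= -[<-] /=.
have := emissionP E => -[Zm [_ _ hK _]].
have L0 : 0 < margin g eta p := pw_gt0 _ _.
have Kp : 0 < gauge g eta p ^+ j.-1 by rewrite exprn_gt0 // pw_gt0.
split; first by rewrite /eps; apply: mulr_gt0 => //; do 2!apply: mulr_gt0 => //.
have KE := K_eq g eta p.
have jp : (0 < j)%N by rewrite lt0n.
have hr : eps (n := n) g lam C eta p j <= c6 / margin g eta p * (B.2 * `|x'.1.1 0 x'.2|).
  apply: le_trans (_ : _ <= c6 / margin g eta p * (gauge g eta p ^+ j / c0 / (2 * n%:R * C))) _; last first.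
    by apply: ler_wpM2l => //; rewrite divr_ge0 // ltW.
  have Kj : gauge g eta p ^+ j = margin g eta p ^+ 2 * gauge g eta p ^+ j.-1.
    by rewrite -[in LHS](prednK jp) exprS [X in X * _]KE.
  rewrite /eps -/c0 /c6 Kj le_eqVlt; apply/orP; left; apply/eqP.
  move: (gauge g eta p ^+ j.-1) (margin g eta p) (c0) (n.+1%:R : R) c00 L0 => kk ll cc nn cc0' ll0.
  by field; rewrite !gt_eqF.
apply: le_trans hr _; apply: ler_wpM2r; first by rewrite mulr_ge0 // ltW.
have uM : (u <= M * p)%N.
  have /andP[al1 al2] := al.
  have ft : base_pow g p%:R <= B.2 * base_pow g (max_rate w i1 * (first_time w i1 g B.2 p)%:R).
    rewrite /first_time; case: pselect => [ex|[]]; last by exists t.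
    by case: ex_minnP.
  rewrite -(ler_nat R); have W1 : 1 <= max_rate w i1 by rewrite /max_rate; have := w_pos i1; lra.
  apply: le_trans (_ : _ <= max_rate w i1 * u%:R) _; first by rewrite ler_peMl.
  rewrite -(pw_le g0); apply: le_trans al2.
  rewrite /t natrD mulrDr pwD mulrA; apply: ler_peMl; first exact/ltW/pw_gt0.
  by apply: le_trans ft; rewrite pw_ge1.
rewrite ler_pdivrMr // /margin (_ : eta * p%:R = eta / 2 * p%:R + eta / 2 * p%:R); last by field.
have q1 : c6 / (delta * tau ^+ n) <= base_pow g (eta / 2 * p%:R).
  apply: le_trans hX _; rewrite pw_le // ler_pM2l ?divr_gt0 // ler_nat; exact: leq_addr.
have q2 : (tau ^+ (p' + u))^-1 <= base_pow g (eta / 2 * p%:R).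
  have -> : eta / 2 * p%:R = - (p%:R * (- (eta / 2))) by ring.
  rewrite pwN lef_pV2 ?posrE ?pw_gt0 ?exprn_gt0 // -pwX.
  apply: le_trans (_ : _ <= (tau ^+ M.+2) ^+ p) _.
    by apply: lerXn2r => //; rewrite nnegrE; [exact/ltW/pw_gt0|exact/ltW/exprn_gt0].
  rewrite -exprM; apply: ler_wiXn2l; [exact: ltW|exact: ltW|].
  have : (p' <= p)%N by apply: leq_addl.
  move: uM; clear; lia.
have tj : tau ^+ n <= tau ^+ j by apply: ler_wiXn2l => //; exact: ltW.
rewrite pwD // exprD.
have tp : 0 < tau ^+ (p' + u) by rewrite exprn_gt0.
have tn : 0 < tau ^+ n by rewrite exprn_gt0.
have dtn : 0 < delta * tau ^+ n by rewrite mulr_gt0.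
have x6 : 0 < c6 / (delta * tau ^+ n) by exact: divr_gt0.
have tv : 0 <= (tau ^+ (p' + u))^-1 by rewrite invr_ge0 ltW.
apply: le_trans (_ : _ <= delta * (tau ^+ (p' + u) * tau ^+ n) *
    (c6 / (delta * tau ^+ n) * (tau ^+ (p' + u))^-1)) _.
  by rewrite le_eqVlt; apply/orP; left; apply/eqP; field; rewrite !gt_eqF.
apply: ler_pM.
+ by rewrite !mulr_ge0 ?(ltW d0) ?(ltW tp) ?(ltW tn).
+ by apply: mulr_ge0 => //; exact: ltW.
+ by rewrite ler_pM2l // ler_pM2l.
+ by apply: ler_pM => //; exact: ltW.
Qed.


End LatticeMachine.

Section LatticeMachine.
Context {R : realType} {n : nat}.

(** The prescribed rates [delta] and [tau] come first. Then [eta] and [M] depend on the weights, [g]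
    on [lam], [tau], [M] and [eta]; next come [p0], the resulting lower bound [mu] for dual vectors,
    the delay [s], and last [Rr] and [c]. *)
Theorem lattice_machine (w : 'I_n -> R) (theta : 'rV[R]_n) (lam C delta tau rlow : R) :
  (forall i, 0 < w i) -> \sum_i w i = 1 -> 0 < lam < 1 -> 1 <= C -> 0 < delta ->
  0 < tau < 1 -> 0 < rlow ->
  exists Em : seq (@yball R n) -> nat * nat * nat -> option removal,
    (forall h B idx x, 0 < B.2 -> Em (B :: h) idx = Some x ->
       0 < x.2 /\ x.2 <= delta * tau ^+ (idx.1.1 + idx.1.2 + idx.2) *
         (B.2 * `|x.1.1.1 0 x.1.2|)) /\
    forall B : nat -> @yball R n,
      (forall m, 0 < (B m).2) -> (forall m, lam * (B m).2 <= (B m.+1).2) ->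
      (forall m, (B m.+1).2 <= 2^-1 * (B m).2) ->
      (forall m m' i, (m <= m')%N -> `|(B m').1 0 i - (B m).1 0 i| <= C * (B m).2) ->
      rlow <= (B 0).2 <= 1 ->
      (forall m idx x, Em (hist B m) idx = Some x -> forall m', (m <= m')%N ->
         `|dot x.1.1.1 (B m').1 + x.1.1.2| < x.2 ->
         x.2 <= (B m').2 * `|x.1.1.1 0 x.1.2|) ->
      forall y : 'rV[R]_n, (forall m i, `|y 0 i - (B m).1 0 i| <= C * (B m).2) ->
      exists2 c, 0 < c & forall (q : int) (P : 'rV[int]_n), q != 0 ->
        exists i, c <= `|q%:~R * y 0 i - (P 0 i)%:~R - theta 0 i| *
                       expR (w i * ln `|q%:~R|).
Proof.
move=> w_pos w1 lam01 C1 d0 /andP[tau0 tau1] rlow0.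
have [lam0 _] := andP lam01.
have n0 : (0 < n)%N.
  case: n w w_pos w1 => // w' _; rewrite big_ord0 => /esym/eqP; by rewrite oner_eq0.
have i0 : 'I_n := Ordinal n0.
have [i1 wmax] : exists i1, forall i, w i <= w i1.
  case: (@Order.TotalTheory.arg_maxP _ _ _ i0 predT w isT) => i1 _ h.
  by exists i1 => i; exact: h.
have [i2 wminP] : exists i2, forall i, w i2 <= w i.
  case: (@Order.TotalTheory.arg_minP _ _ _ i0 predT w isT) => i2 _ h.
  by exists i2 => i; exact: h.
set wmin := w i2; have wmin0 : 0 < wmin := w_pos i2.
have wmin1 : wmin <= 1.
  by rewrite -w1 (bigD1 i2) //= lerDl; apply: sumr_ge0 => *; exact/ltW.
have n1 : 1 <= n%:R :> R by rewrite ler1n.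
have n10 : 0 < n.+1%:R :> R by [].
have nn : n%:R + 1 = n.+1%:R :> R by rewrite natr1.
pose eta := wmin / (16 * n.+1%:R).
have eta0 : 0 < eta by rewrite divr_gt0 // mulr_gt0.
have etaE : eta * n.+1%:R = wmin / 16.
  by rewrite /eta; field; rewrite gt_eqF.
have eta1 : 2 * eta * n.+1%:R <= 1 by rewrite -mulrA etaE; lra.
have eta2 : 8 * eta * n%:R <= wmin.
  apply: le_trans (_ : _ <= 8 * eta * n.+1%:R) _.
    by rewrite ler_wpM2l ?ler_nat // mulr_ge0 // (ltW eta0).
  by rewrite -mulrA etaE; lra.
pose M := (Num.bound (16 * n%:R / wmin)).+1.
have M_big : 16 * n%:R <= (M%:R - 1) * wmin.
  have -> : M%:R - 1 = (Num.bound (16 * n%:R / wmin))%:R :> R.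
    by rewrite /M -[X in X - 1]natr1 addrK.
  rewrite -ler_pdivrMr //; apply: ltW; apply: archi_boundP.
  by rewrite divr_ge0 ?mulr_ge0 // ltW.
(* The summands give [base_pow g 1 >= 2], [base_pow g 1 > lam^-1], strictness, and
   [base_pow g (- (eta / 2)) <= tau ^+ M.+2]. *)
pose g := ln 2 + ln lam^-1 + 1 + 2 * (M%:R + 2) * ln tau^-1 / eta.
have ln2 : 0 <= ln 2 :> R by rewrite ln_ge0 // ler1n.
have lnl : 0 <= ln lam^-1 by rewrite ln_ge0 // invf_ge1 // ltW //; case/andP: lam01.
have lnt : 0 <= ln tau^-1 by rewrite ln_ge0 // invf_ge1 // ltW.
have lnt' : 0 <= 2 * (M%:R + 2) * ln tau^-1 / eta.
  by rewrite divr_ge0 ?(ltW eta0) // !mulr_ge0 // addr_ge0.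
have g0 : 0 < g by rewrite /g; lra.
have g2 : 2 <= base_pow g 1.
  rewrite /base_pow mulr1 -[leLHS]lnK ?posrE // ler_expR /g; lra.
have lamg : lam^-1 < base_pow g 1.
  rewrite /base_pow mulr1 -[ltLHS]lnK ?posrE ?invr_gt0 // ltr_expR /g; lra.
have taug : base_pow g (- (eta / 2)) <= tau ^+ M.+2.
  have -> : tau ^+ M.+2 = expR (M.+2%:R * ln tau) by rewrite expRM_natl lnK ?posrE.
  rewrite /base_pow ler_expR /g; move: lnt'; set Y := _ / eta => _.
  have e1 : Y * eta = - (2 * ((M%:R + 2) * ln tau)).
    by rewrite /Y divfK ?gt_eqF // lnV ?posrE //; ring.
  have e2 : 0 <= (ln 2 + ln lam^-1 + 1) * eta by rewrite mulr_ge0 ?(ltW eta0) //; lra.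
  have -> : M.+2%:R = M%:R + 2 :> R by rewrite -addn2 natrD.
  have e3 : (M%:R + 2) * ln tau = - (Y * eta / 2) by rewrite e1; field.
  rewrite e3; lra.
pose c0 := @drift R n lam C.
have c01 : 1 < c0 by exact: (c0_gt1 i1).
have c00 : 0 < c0 by lra.
have C0 : 0 < C by lra.
have n00 : 0 < n%:R :> R by lra.
have c0sq : 0 < c0 ^+ 2 by exact: exprn_gt0.
pose c6 := 2 * n%:R * n.+1%:R * C * c0 ^+ 2.
have c60 : 0 < c6 by apply: mulr_gt0 => //; do 3!apply: mulr_gt0 => //.
(* The sum of everything that a power at [p0] has to exceed; each requirement then drops the other,
   positive, summands. The same device is used for [Z] and [Z'] below, of which [Rr] and [c] are
   essentially the inverses. *)
pose X := 2 * n.+1%:R * c0 ^+ 2 + rlow^-1 + lam^-1 + n.+1%:R * 4 ^+ n * base_pow g 2 + c0 +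
  c6 / (delta * tau ^+ n).
have [p0 [p01 hX]] := @pw_large R g (eta / 2) X g0 (divr_gt0 eta0 (ltr0Sn _ _)).
have x1 : 0 < 2 * n.+1%:R * c0 ^+ 2 by do 2!apply: mulr_gt0 => //.
have x2 : 0 < rlow^-1 by rewrite invr_gt0.
have x3 : 0 < lam^-1 by rewrite invr_gt0.
have x4 : 0 < n.+1%:R * 4 ^+ n * base_pow g 2 by rewrite !mulr_gt0 ?exprn_gt0 ?pw_gt0.
have x6 : 0 < c6 / (delta * tau ^+ n) by rewrite divr_gt0 // mulr_gt0 // exprn_gt0.
have P0 : 0 <= p0%:R :> R by [].
have etap : 0 <= eta * p0%:R by rewrite mulr_ge0 // ltW.
have etan : eta <= 1 / 16.
  have : eta * 1 <= eta * n.+1%:R by rewrite ler_pM2l // ler1n.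
  by rewrite etaE; clear - wmin1; lra.
have Xle e : eta / 2 * p0%:R <= e -> X <= base_pow g e.
  by move=> he; apply: le_trans hX _; rewrite pw_le.
have etap' : eta * p0%:R <= 1 * p0%:R by rewrite ler_wpM2r //; clear - etan; lra.
have big_A p : (p0 <= p)%N -> 2 * n.+1%:R * c0 ^+ 2 <= margin g eta p.
  move=> pp; apply: le_trans (_ : X <= _); first by rewrite /X; clear - x2 x3 x4 x6 c00; lra.
  apply: Xle; have : eta * p0%:R <= eta * p%:R by rewrite ler_pM2l // ler_nat.
  clear - etap; lra.
have big_C : 1 <= base_pow g (2 * eta * n%:R * p0%:R) * rlow.
  rewrite -ler_pdivrMr // mul1r; apply: le_trans (_ : X <= _); first by rewrite /X; clear - x1 x3 x4 x6 c00; lra.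
  apply: Xle; have : eta * p0%:R * 1 <= eta * p0%:R * n%:R by rewrite ler_wpM2l.
  clear - etap; lra.
have big_l : 1 <= base_pow g p0%:R * lam.
  rewrite -ler_pdivrMr // mul1r; apply: le_trans (_ : X <= _); first by rewrite /X; clear - x1 x2 x4 x6 c00; lra.
  apply: Xle; clear - etap etap' P0; lra.
have big_E : n.+1%:R * 4 ^+ n * base_pow g 2 <= base_pow g (eta * p0%:R).
  apply: le_trans (_ : X <= _); first by rewrite /X; clear - x1 x2 x3 x6 c00; lra.
  apply: Xle; clear - etap; lra.
have big_F : c0 <= base_pow g p0%:R.
  apply: le_trans (_ : X <= _); first by rewrite /X; clear - x1 x2 x3 x4 x6; lra.
  apply: Xle; clear - etap etap' P0; lra.
pose mu := (base_pow g p0%:R * c0)^-1.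
have mu0 : 0 < mu by rewrite invr_gt0; apply: mulr_gt0 => //; exact: pw_gt0.
have [s [s0 hs]] := @pw_large R g wmin (mu^-1 + base_pow g p0%:R / rlow) g0 wmin0.
have y1 : 0 < mu^-1 by rewrite invr_gt0.
have y2 : 0 < base_pow g p0%:R / rlow by rewrite divr_gt0 ?pw_gt0.
have hmu1 : base_pow g (- (wmin * s%:R)) <= mu.
  rewrite pwN -[leRHS]invrK lef_pV2 ?posrE ?pw_gt0 //; clear - hs y2; lra.
have hs' : base_pow g p0%:R / rlow <= base_pow g s%:R.
  apply: le_trans (_ : _ <= base_pow g (wmin * s%:R)) _; first by clear - hs y1; lra.
  by rewrite pw_le // ler_piMl.
pose Z := base_pow g (2 * (s%:R + 4)) + 8 * n%:R * C * base_pow g 1 * base_pow g (s%:R + 4) / mu +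
  8 * C * base_pow g 1 + rlow^-1.
have z1 : 0 < base_pow g (2 * (s%:R + 4)) by exact: pw_gt0.
have z0 : 0 < base_pow g (s%:R + 4) by exact: pw_gt0.
have z2 : 0 < 8 * n%:R * C * base_pow g 1 * base_pow g (s%:R + 4) / mu.
  by rewrite divr_gt0 // !mulr_gt0 ?pw_gt0.
have z3 : 0 < 8 * C * base_pow g 1 by rewrite !mulr_gt0 ?pw_gt0.
have Z0 : 0 < Z by rewrite /Z; clear - z1 z2 z3 x2; lra.
pose Rr := lam / (2 * Z).
have Rr0 : 0 < Rr by rewrite divr_gt0 // mulr_gt0.
have RrE : Rr / lam = (2 * Z)^-1 by rewrite /Rr; field; rewrite !gt_eqF.
have ZV x : 0 < x -> x <= Z -> x * (2 * Z)^-1 <= 1 / 2.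
  move=> x0 xZ; rewrite invfM mulrCA.
  have : x / Z <= 1 by rewrite ler_pdivrMr // mul1r.
  clear; lra.
have hRr : Rr / lam * base_pow g (2 * (s%:R + 4)) < 1.
  have h : base_pow g (2 * (s%:R + 4)) <= Z by rewrite /Z; clear - z2 z3 x2; lra.
  by rewrite RrE mulrC; have := ZV _ z1 h; clear; lra.
pose Z' := 16 * n%:R * base_pow g (s%:R + 4) / mu + 8 + (delta * Rr)^-1.
have u1 : 0 < 16 * n%:R * base_pow g (s%:R + 4) / mu by rewrite divr_gt0 // !mulr_gt0.
have u2 : 0 < (delta * Rr)^-1 by rewrite invr_gt0 mulr_gt0.
have Z'0 : 0 < Z' by rewrite /Z'; clear - u1 u2; lra.
pose c := Z'^-1.
have cc0 : 0 < c by rewrite invr_gt0.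
have ZV' x : x <= Z' -> x * c <= 1 by move=> xZ; rewrite ler_pdivrMr // mul1r.
have err1 : inhom_err g lam C Rr c < 1.
  rewrite /inhom_err RrE.
  have h1 : 8 * C * base_pow g 1 <= Z by rewrite /Z; clear - z1 z2 x2; lra.
  have h2 : 8 <= Z' by rewrite /Z'; clear - u1 u2; lra.
  by have := ZV _ z3 h1; have := ZV' _ h2; clear; lra.
have hmu2 : 2 * n%:R * inhom_err g lam C Rr c * base_pow g (s%:R + 4) < mu.
  rewrite /inhom_err RrE.
  have h1 : 16 * n%:R * base_pow g (s%:R + 4) * c <= mu.
    have h : 16 * n%:R * base_pow g (s%:R + 4) / mu <= Z' by rewrite /Z'; clear - u2; lra.
    by have := ZV' _ h; rewrite mulrAC ler_pdivrMr // mul1r.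
  have h2 : 8 * n%:R * C * base_pow g 1 * base_pow g (s%:R + 4) * (2 * Z)^-1 <= mu / 2.
    have h : 8 * n%:R * C * base_pow g 1 * base_pow g (s%:R + 4) / mu <= Z by rewrite /Z; clear - z1 z3 x2; lra.
    have := ZV _ z2 h; rewrite mulrAC ler_pdivrMr // => h'.
    by apply: le_trans h' _; rewrite mul1r mulrC.
  clear - h1 h2 mu0; lra.
have cRr : c / Rr <= delta.
  have h : (delta * Rr)^-1 <= Z' by rewrite /Z'; clear - u1; lra.
  have dR : 0 < delta * Rr by exact: mulr_gt0.
  rewrite ler_pdivrMr // -[leRHS]mul1r -ler_pdivrMr // mulrC; exact: ZV'.
have Rr_low : Rr <= rlow.
  have h : rlow^-1 <= Z by rewrite /Z; clear - z1 z2 z3; lra.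
  have h1 := ZV _ x2 h; rewrite mulrC ler_pdivrMr // in h1.
  rewrite /Rr; apply: le_trans (_ : _ <= 1 * (2 * Z)^-1) _; last by clear - h1 rlow0; lra.
  apply: ler_wpM2r; first by rewrite invr_ge0 mulr_ge0 // ltW.
  by rewrite ltW //; case/andP: lam01.
exists (machine w i1 theta g lam C eta M Rr c p0); split.
- apply: machine_size => //.
  by apply: le_trans hX; rewrite /X -/c0 -/c6; clear - x1 x2 x3 x4 c00; lra.
move=> B r_gt0 r_lam r_half y_near /andP[r_low r_le1] pr y hy; exists c => // q P q0.
have promise : forall t p j m x, (p0 <= p)%N -> (0 < j <= n)%N ->
  stage_alive w i1 g M t p (B m).2 -> emission w i1 g lam C eta M t p j (hist B m) = Some x ->
  forall m', (m <= m')%N ->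
    `|dot x.1.1 (B m').1 + x.1.2| < eps (n := n) g lam C eta p j ->
    eps (n := n) g lam C eta p j <= (B m').2 * `|x.1.1 0 x.2|.
  move=> t p j m x pp /andP[j0 jn] al hx m' mm'.
  apply: (pr m ((p - p0)%N, (t - first_time w i1 g (B m).2 p)%N, j) (x, _)) => //.
  rewrite histE /machine [(_, j).2]/= (gtn_eqF j0) /= subnKC //.
  have -> : (first_time w i1 g (B m).2 p + (t - first_time w i1 g (B m).2 p))%N = t.
    apply: subnKC; rewrite /first_time; case: pselect => // ex; case: ex_minnP => k _; apply.
    by case/andP: al.
  by rewrite al jn /= -histE hx.
have nsd := @no_short_dual R n w i1 g lam C eta wmin rlow M p0 w1 wmin0 wminP wmax g0 lam01 C1
   eta0 eta1 eta2 M_big rlow0 p01 big_A big_C big_l big_E big_F B r_gt0 r_lam r_half y_near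
   r_low r_le1 promise.
apply: (@inhom_final R n w i1 theta g lam C wmin mu Rr c s p0 w1 wmin0 wminP wmax g0 g2 lam01
   lamg C1 Rr0 cc0 err1 hmu1 hmu2 hRr B r_gt0 r_lam r_half) => //.
- apply: le_trans (_ : _ <= rlow * base_pow g s%:R) _.
    by rewrite -ler_pdivrMl // mulrC.
  by rewrite ler_pM2r ?pw_gt0.
- exact: le_trans Rr_low r_low.
- move=> m x hx m' mm'; apply: (pr m (0%N, 0%N, 0%N) x) => //.
Qed.

End LatticeMachine.

(** * Euclidean geometry and the simplex lemma *)

Section Euclidean.
Context {R : realType} {d : nat}.
Implicit Types (a x y c : 'rV[R]_d).

Lemma dotC a x : dot a x = dot x a.
Proof. by apply: eq_bigr => i _; rewrite mulrC. Qed.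
Lemma dotDr a x y : dot a (x + y) = dot a x + dot a y.
Proof. by rewrite -big_split; apply: eq_bigr => i _; rewrite mxE mulrDr. Qed.
Lemma dotZr a k x : dot a (k *: x) = k * dot a x.
Proof. by rewrite mulr_sumr; apply: eq_bigr => i _; rewrite mxE mulrCA. Qed.
Lemma dotNr a x : dot a (- x) = - dot a x.
Proof. by rewrite -scaleN1r dotZr mulN1r. Qed.
Lemma dotBr a x y : dot a (x - y) = dot a x - dot a y.
Proof. by rewrite dotDr dotNr. Qed.
Lemma dotZl a k x : dot (k *: a) x = k * dot a x.
Proof. by rewrite dotC dotZr dotC. Qed.

Lemma dot_ge0 x : 0 <= dot x x.
Proof. by apply: sumr_ge0 => i _; rewrite -expr2 sqr_ge0. Qed.

Lemma enormE x : enorm x = Num.sqrt (dot x x).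
Proof. by rewrite /enorm; congr Num.sqrt; apply: eq_bigr => i _; rewrite expr2. Qed.

Lemma enorm_ge0 x : 0 <= enorm x. Proof. exact: sqrtr_ge0. Qed.
Lemma enorm_sqr x : enorm x ^+ 2 = dot x x.
Proof. by rewrite enormE sqr_sqrtr // dot_ge0. Qed.
Lemma coord_le x i : `|x 0 i| <= enorm x.
Proof.
rewrite enormE -sqrtr_sqr ler_sqrt ?dot_ge0 //.
rewrite /dot (bigD1 i) //= -expr2 lerDl; apply: sumr_ge0 => j _.
by rewrite -expr2 sqr_ge0.
Qed.
Lemma enorm0 : enorm (0 : 'rV[R]_d) = 0.
Proof. by rewrite enormE /dot big1 ?sqrtr0 // => i _; rewrite mxE mul0r. Qed.
Lemma enorm_eq0 x : enorm x = 0 -> x = 0.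
Proof.
move=> h; apply/rowP => i; rewrite mxE; apply/eqP; rewrite -normr_eq0 eq_le normr_ge0.
by rewrite -h coord_le.
Qed.
Lemma enorm_gt0 x : x != 0 -> 0 < enorm x.
Proof. by move=> x0; rewrite lt_def enorm_ge0 andbT; apply: contra_neq x0; exact: enorm_eq0. Qed.
Lemma enormZ k x : enorm (k *: x) = `|k| * enorm x.
Proof.
by rewrite !enormE dotZl dotZr mulrA -expr2 sqrtrM ?sqr_ge0 // sqrtr_sqr.
Qed.
Lemma enormN x : enorm (- x) = enorm x.
Proof. by rewrite -scaleN1r enormZ normrN1 mul1r. Qed.
Lemma enormB x y : enorm (x - y) = enorm (y - x).
Proof. by rewrite -enormN opprB. Qed.

Lemma cauchy_schwarz a x : `|dot a x| <= enorm a * enorm x.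
Proof.
have [->|x0] := eqVneq x 0.
  by rewrite /dot big1 ?normr0 ?enorm0 ?mulr0 // => i _; rewrite mxE mulr0.
have X0 : 0 < dot x x by rewrite -enorm_sqr exprn_gt0 // enorm_gt0.
have h : 0 <= dot x x * (dot x x * dot a a - dot a x ^+ 2).
  have := dot_ge0 (dot x x *: a - dot a x *: x).
  rewrite dotBr !dotZr ![dot (_ - _) _]dotC !dotBr !dotZr (dotC x a).
  by congr (_ <= _); ring.
rewrite pmulr_rge0 // subr_ge0 in h.
rewrite -ler_sqr ?nnegrE ?mulr_ge0 ?enorm_ge0 //.
by rewrite real_normK ?num_real // exprMn !enorm_sqr mulrC.
Qed.

Lemma ler_enormD x y : enorm (x + y) <= enorm x + enorm y.
Proof.
rewrite -ler_sqr ?nnegrE ?addr_ge0 ?enorm_ge0 //.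
rewrite sqrrD !enorm_sqr dotDr ![dot (_ + _) _]dotC !dotDr (dotC y x).
have := le_trans (ler_norm _) (cauchy_schwarz x y); lra.
Qed.

Lemma ler_enorm_dist x y z : enorm (x - z) <= enorm (x - y) + enorm (y - z).
Proof. by have := ler_enormD (x - y) (y - z); rewrite addrA subrK. Qed.

Lemma enorm_le_coord x e : (forall i, `|x 0 i| <= e) -> enorm x <= d%:R * e.
Proof.
move=> h; have [->|x0] := eqVneq x 0.
  rewrite enorm0; case: d x h => [|n] x h; first by rewrite mul0r.
  by rewrite mulr_ge0 // (le_trans _ (h 0)).
have n0 := enorm_gt0 x0.
rewrite -(ler_pM2r n0) -expr2 enorm_sqr.
have -> : d%:R * e * enorm x = \sum_(i < d) (e * enorm x).
  by rewrite sumr_const card_ord -[RHS]mulr_natl mulrA.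
apply: ler_sum => i _; apply: le_trans (ler_norm _) _; rewrite normrM.
by apply: ler_pM => //; exact: coord_le.
Qed.

(** The point of [B'] farthest from [B.1] lies on the ray through the two centres. When the centres
    coincide any direction will do, and [0 < d] supplies one. *)
Lemma ball_center (B B' : @ball_pair R d) : (0 < d)%N -> 0 < B'.2 ->
  pball B' `<=` pball B -> enorm (B'.1 - B.1) <= B.2 - B'.2.
Proof.
case: B B' => [c r] [c' r'] /= d0 r0 sub.
have i0 : 'I_d := Ordinal d0.
have e1 : enorm (delta_mx 0 i0 : 'rV[R]_d) = 1.
  rewrite enormE /dot (bigD1 i0) //= !mxE !eqxx mul1r big1 ?addr0 ?sqrtr1 //.
  by move=> i /negbTE h; rewrite !mxE h mul0r.
have [v0|v0] := eqVneq (c' - c) 0.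
  rewrite v0 enorm0 subr_ge0.
  have : pball (c, r) (c' + r' *: delta_mx 0 i0).
    by apply: sub; rewrite /pball /eball /= addrC addKr enormZ e1 mulr1 ger0_norm // ltW.
  by rewrite /pball /eball /= addrAC v0 add0r enormZ e1 mulr1 ger0_norm // ltW.
have n0 := enorm_gt0 v0.
have k0 : 0 <= r' / enorm (c' - c) by rewrite divr_ge0 // ltW.
have : pball (c, r) (c' + (r' / enorm (c' - c)) *: (c' - c)).
  apply: sub; rewrite /pball /eball /= addrC addKr enormZ ger0_norm //.
  by rewrite divfK // gt_eqF.
rewrite /pball /eball /= addrAC -{1}[c' - c]scale1r -scalerDl enormZ.
by rewrite ger0_norm ?addr_ge0 // mulrDl mul1r divfK ?gt_eqF // lerBrDr.
Qed.

Lemma pball_sub (B B' : @ball_pair R d) : enorm (B'.1 - B.1) <= B.2 - B'.2 ->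
  pball B' `<=` pball B.
Proof.
move=> h x; rewrite /pball /eball /= => hx.
have := ler_enorm_dist x B'.1 B.1; lra.
Qed.

Definition hplane a (b : R) : set 'rV[R]_d := [set x | \sum_(i < d) a 0 i * x 0 i = b].

Lemma hplane_foot a b x : a != 0 ->
  hplane a b (x - ((dot a x - b) / enorm a ^+ 2) *: a).
Proof.
move=> a0; rewrite /hplane /= -/(dot a _) dotBr dotZr -enorm_sqr divfK; first by ring.
by rewrite gt_eqF // exprn_gt0 // enorm_gt0.
Qed.

Lemma edist_hplane_ge a b x : a != 0 ->
  `|dot a x - b| / enorm a <= edist_set (hplane a b) x.
Proof.
move=> a0; apply: lb_le_inf.
  by eexists; eexists; [exact: (hplane_foot b x a0)|reflexivity].
move=> _ [y hy <-]; rewrite ler_pdivrMr ?enorm_gt0 //.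
have -> : b = dot a y by rewrite -hy.
by rewrite -dotBr mulrC cauchy_schwarz.
Qed.

Lemma edist_hplane_le a b x : a != 0 ->
  edist_set (hplane a b) x <= `|dot a x - b| / enorm a.
Proof.
move=> a0; have := hplane_foot b x a0; set y := x - _ => hy.
apply: le_trans (_ : enorm (x - y) <= _).
  apply: ge_inf; last by exists y.
  by exists 0 => _ [z _ <-]; exact: enorm_ge0.
rewrite /y subKr enormZ normrM normfV (ger0_norm (exprn_ge0 2 (enorm_ge0 a))).
by rewrite expr2 invfM mulrA divfK // gt_eqF // enorm_gt0.
Qed.

Lemma disjoint_hplane a b (B : @ball_pair R d) e : a != 0 -> 0 <= B.2 ->
  pball B `&` open_nbhd (hplane a b) e = set0 -> e * enorm a <= `|dot a B.1 - b|.
Proof.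
move=> a0 r0 h; rewrite -ler_pdivlMr ?enorm_gt0 //.
apply: le_trans (edist_hplane_le b B.1 a0); rewrite leNgt; apply/negP => h'.
have : (pball B `&` open_nbhd (hplane a b) e) B.1.
  by split => //; rewrite /pball /eball /= subrr enorm0.
by rewrite h.
Qed.

Lemma hplane_disjoint a b (B : @ball_pair R d) e : a != 0 ->
  (e + B.2) * enorm a <= `|dot a B.1 - b| ->
  pball B `&` open_nbhd (hplane a b) e = set0.
Proof.
move=> a0 h; rewrite -subset0 => x [hx]; rewrite /open_nbhd /= ltNge => /negP; apply.
apply: le_trans (edist_hplane_ge b x a0); rewrite ler_pdivlMr ?enorm_gt0 //.
have h1 : `|dot a (B.1 - x)| <= enorm a * B.2.
  apply: le_trans (cauchy_schwarz _ _) _; rewrite ler_pM2l ?enorm_gt0 //.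
  by rewrite enormB.
have := ler_normD (dot a (B.1 - x)) (dot a x - b).
rewrite dotBr addrA subrK; rewrite dotBr in h1; lra.
Qed.

End Euclidean.

Section Simplex.
Context {R : realType} {d : nat}.

(** Comes from Cramer's rule for [d] edges of length at most [2 * r]: their determinant is at least
    [(beta * r) ^+ d] over [d!], the cofactors are at most [(d-1)! * (2 * r) ^+ d.-1], and
    differences of values are at most [2 * V]. *)
Definition simplex_const (beta : R) : R :=
  2 * (d`!)%:R ^+ 2 * 2 ^+ d.-1 / beta ^+ d.

Lemma ortho_vector (k : nat) (u : nat -> 'rV[R]_d) : (k < d)%N ->
  exists a : 'rV[R]_d, enorm a = 1 /\ forall l, (l < k)%N -> dot a (u l) = 0.
Proof.
move=> kd; pose Mx : 'M[R]_(d, k) := \matrix_(i, l) u l 0 i.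
have : (kermx Mx != 0).
  rewrite -mxrank_eq0 mxrank_ker -lt0n subn_gt0.
  exact: leq_ltn_trans (rank_leq_col _) kd.
case/rowV0Pn => v /sub_kermxP hv v0.
have n0 := enorm_gt0 v0.
exists ((enorm v)^-1 *: v); split.
  by rewrite enormZ normfV ger0_norm ?enorm_ge0 // mulVf // gt_eqF.
move=> l lk; rewrite dotZl; have := congr1 (fun A : 'rV_k => A 0 (Ordinal lk)) hv.
rewrite mxE [X in _ = X]mxE => h; rewrite -[X in _ * X](_ : 0 = _) ?mulr0 //.
by rewrite -h; apply: eq_bigr => i _; rewrite mxE.
Qed.

(** Points are picked greedily, each at distance at least [beta * r] from a hyperplane through the
    earlier ones. The matrix of edges times unit normals is then triangular with diagonal at least
    [beta * r]. *)
Lemma simplex (beta r : R) (c : 'rV[R]_d) (A : set 'rV[R]_d) :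
  (0 < d)%N -> 0 < beta -> 0 < r -> (forall x, A x -> enorm (x - c) <= r) ->
  (forall (a : 'rV[R]_d) b, enorm a = 1 -> exists2 x, A x & beta * r <= `|dot a x - b|) ->
  exists x : 'I_d.+1 -> 'rV[R]_d, (forall i, A (x i)) /\
    forall a b V, (forall i, `|dot a (x i) - b| <= V) ->
      forall j, r * `|a 0 j| <= simplex_const beta * V.
Proof.
move=> d0 beta0 r0 Ac hA.
have [a1 [a11 _]] := @ortho_vector 0 (fun _ => 0) d0.
have [x0 Ax0 _] := hA a1 0 a11.
have [u [nv hu]] : exists u nv : nat -> 'rV[R]_d, forall i, (i < d)%N ->
    [/\ A (x0 + u i), enorm (nv i) = 1, beta * r <= `|dot (nv i) (u i)| &
     forall l, (l < i)%N -> dot (nv i) (u l) = 0].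
  suff : forall k, (k <= d)%N -> exists u nv : nat -> 'rV[R]_d, forall i, (i < k)%N ->
    [/\ A (x0 + u i), enorm (nv i) = 1, beta * r <= `|dot (nv i) (u i)| &
     forall l, (l < i)%N -> dot (nv i) (u l) = 0] by apply.
  elim=> [_|k IH kd]; first by exists (fun _ => 0), (fun _ => 0).
  have [u [nv hu]] := IH (ltnW kd).
  have [a [a1' au]] := ortho_vector u kd.
  have [x Ax hx] := hA a (dot a x0) a1'.
  exists (fun i => if i == k then x - x0 else u i), (fun i => if i == k then a else nv i).
  move=> i; rewrite ltnS leq_eqVlt => /orP[/eqP->|ik].
    rewrite eqxx addrC subrK; split => //; first by rewrite dotBr.
    by move=> l lk; rewrite (ltn_eqF lk) au.
  rewrite (ltn_eqF ik); have [h1 h2 h3 h4] := hu i ik; split => // l li.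
  by rewrite (ltn_eqF (ltn_trans li ik)) h4.
pose x (i : 'I_d.+1) := if unlift 0 i is Some i' then x0 + u i' else x0.
exists x; split.
  move=> i; rewrite /x; case: unliftP => [i' _|_] //.
  by have [] := hu i' (ltn_ord i').
move=> a b V hV j.
have V0 : 0 <= V by apply: le_trans (hV 0).
pose U : 'M[R]_d := \matrix_(i, l) u i 0 l.
pose N : 'M[R]_d := \matrix_(i, l) nv i 0 l.
have UN i l : (U *m N^T) i l = dot (nv l) (u i).
  by rewrite mxE; apply: eq_bigr => k _; rewrite !mxE mulrC.
have dUN : (beta * r) ^+ d <= `|\det U| * `|\det N|.
  rewrite -(det_tr N) -normrM -det_mulmx det_trig; last first.
    apply/is_trig_mxP => i l il; rewrite UN.
    by have [_ _ _] := hu l (ltn_ord l); apply.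
  rewrite normr_prod -[X in _ ^+ X]card_ord -prodr_const; apply: ler_prod => i _.
  rewrite mulr_ge0 ?(ltW beta0) ?(ltW r0) //= UN.
  by have [] := hu i (ltn_ord i).
have dN : `|\det N| <= (d`!)%:R.
  apply: le_trans (@det_le R d N 1 _) _; last by rewrite expr1n mulr1.
  move=> i k; rewrite mxE; apply: le_trans (coord_le _ _) _.
  by have [_ -> _ _] := hu i (ltn_ord i).
have br0 : 0 < (beta * r) ^+ d by rewrite exprn_gt0 // mulr_gt0.
have f0 : 0 < (d`!)%:R :> R by rewrite ltr0n fact_gt0.
have dU : (beta * r) ^+ d / (d`!)%:R <= `|\det U|.
  rewrite ler_pdivrMr //; apply: le_trans dUN _; exact: ler_wpM2l.
have Ule i l : `|U i l| <= 2 * r.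
  rewrite mxE; apply: le_trans (coord_le _ _) _.
  have [h1 _ _ _] := hu i (ltn_ord i).
  have := ler_enorm_dist (x0 + u i) c x0; rewrite addrC addKr.
  have := Ac _ h1; have := Ac _ Ax0; rewrite (enormB c x0) addrC => q1 q2; lra.
have valE (i : 'I_d) : `|dot a (u i)| <= 2 * V.
  have h1 := hV (lift 0 i); have h2 := hV 0.
  rewrite /x liftK dotDr in h1; rewrite /x unlift_none in h2.
  have := ler_normB (dot a x0 + dot a (u i) - b) (dot a x0 - b).
  by rewrite (_ : _ - b - _ = dot a (u i)); [lra|ring].
have key : \det U * a 0 j = \sum_k \adj U j k * dot a (u k).
  have : (\adj U *m (U *m a^T)) j 0 = \det U * a 0 j.
    by rewrite mulmxA mul_adj_mx mul_scalar_mx !mxE.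
  move=> <-; rewrite mxE; apply: eq_bigr => k _; congr (_ * _).
  by rewrite mxE; apply: eq_bigr => l _; rewrite !mxE mulrC.
have adjle k : `|\adj U j k| <= (d.-1`!)%:R * (2 * r) ^+ d.-1.
  rewrite mxE /cofactor normrM normrX normrN1 expr1n mul1r.
  by apply: det_le => p q; rewrite !mxE; have := Ule (lift k p) (lift j q); rewrite mxE.
have h1 : `|\det U| * `|a 0 j| <= (d`!)%:R * (2 * r) ^+ d.-1 * (2 * V).
  rewrite -normrM key; apply: le_trans (ler_norm_sum _ _ _) _.
  have -> : (d`!)%:R * (2 * r) ^+ d.-1 * (2 * V) =
     \sum_(k < d) ((d.-1`!)%:R * (2 * r) ^+ d.-1 * (2 * V)).
    rewrite sumr_const card_ord -[RHS]mulr_natl -{1}(prednK d0) factS natrM.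
    by rewrite (prednK d0) !mulrA.
  by apply: ler_sum => k _; rewrite normrM; exact: ler_pM.
have h2 : (beta * r) ^+ d / (d`!)%:R * `|a 0 j| <= (d`!)%:R * (2 * r) ^+ d.-1 * (2 * V).
  by apply: le_trans h1; exact: ler_wpM2r.
have rd : r ^+ d = r * r ^+ d.-1 by rewrite -exprS prednK.
have bd0 : 0 < beta ^+ d by rewrite exprn_gt0.
have rd0 : 0 < r ^+ d.-1 by rewrite exprn_gt0.
rewrite /simplex_const -(ler_pM2r rd0) -(ler_pM2r bd0) -(ler_pM2r (_ : 0 < ((d`!)%:R : R)^-1)) ?invr_gt0 //.
have -> : r * `|a 0 j| * r ^+ d.-1 * beta ^+ d * ((d`!)%:R)^-1 =
   (beta * r) ^+ d / (d`!)%:R * `|a 0 j|.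
  by rewrite exprMn rd; ring.
apply: le_trans h2 _; rewrite exprMn le_eqVlt; apply/orP; left; apply/eqP.
by field; rewrite !gt_eqF.
Qed.

End Simplex.

(** * The potential game *)

Lemma succ_square n : (n.+1 * n.+1 <= n * n.+2)%N = false.
Proof. by apply/negbTE; lia. Qed.

Section Potential.
Context {R : realType} {d : nat} {I : choiceType}.
Notation ball := (@ball_pair R d).
Variables (beta gamma : R) (Em : seq ball -> I -> option (set 'rV[R]_d * R)).
Hypotheses (d0 : (0 < d)%N) (beta0 : 0 < beta) (beta1 : beta < 1) (gamma0 : 0 < gamma).

Definition flatness : R := (3 * d%:R * simplex_const beta (d:=d))^-1.
Notation iota := flatness.

Definition flat (N : set 'rV[R]_d) (B : ball) : Prop :=
  exists (a : 'rV[R]_d) (b : R), enorm a = 1 /\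
    forall x, N x -> pball B x -> `|dot a x - b| <= iota * B.2.

Definition cost (o : option (set 'rV[R]_d * R)) (B : ball) : \bar R :=
  if o is Some (N, s) then
    if `[< N `&` pball B !=set0 >] then (s `^ gamma)%:E else 0%E
  else 0%E.

(** A history lists the latest ball first, so its suffixes are the moments of announcement. *)
Fixpoint pot (H : seq ball) (B : ball) : \bar R :=
  if H is _ :: H' then (\esum_(i in setT) cost (Em H i) B + pot H' B)%E else 0%E.

(** Nothing is asked of a set wider than the ball: while the potential is at most [B.2 ^ gamma],
    such a set does not meet [B]. *)
Fixpoint flat_along (H : seq ball) (B : ball) : Prop :=
  if H is _ :: H' then (forall i N s, Em H i = Some (N, s) ->
     0 < s /\ (s <= B.2 -> flat N B)) /\ flat_along H' B else True.

Lemma cost_ge0 o B : (0 <= cost o B)%E.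
Proof. by case: o => [[N s]|] //=; case: ifP => // _; rewrite lee_fin powR_ge0. Qed.

Lemma pot_ge0 H B : (0 <= pot H B)%E.
Proof.
elim: H => //= B1 H IH; rewrite adde_ge0 // esum_ge0 // => i _; exact: cost_ge0.
Qed.

Lemma simplex_const_ge1 : 1 <= simplex_const beta (d:=d).
Proof.
rewrite /simplex_const ler_pdivlMr ?exprn_gt0 // mul1r.
have bd : beta ^+ d <= 1 by rewrite exprn_ile1 // ltW.
apply: le_trans bd _.
have f1 : 1 <= (d`!)%:R :> R by rewrite ler1n fact_gt0.
by apply: mulr_ege1; [apply: mulr_ege1|]; rewrite ?exprn_ege1 ?ler1n ?fact_gt0.
Qed.

Lemma flatness_den : 0 < 3 * d%:R * simplex_const beta (d:=d).
Proof.
apply: mulr_gt0; last exact: lt_le_trans ltr01 simplex_const_ge1.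
by apply: mulr_gt0; rewrite ltr0n.
Qed.

Lemma flatness_gt0 : 0 < iota.
Proof. by rewrite invr_gt0 flatness_den. Qed.

Lemma flatness_lt1 : iota <= 3^-1.
Proof.
rewrite /flatness lef_pV2 ?posrE ?flatness_den //.
have d1 : 1 <= d%:R :> R by rewrite ler1n.
by rewrite -mulrA ler_peMr // mulr_ege1 // simplex_const_ge1.
Qed.

Definition spread (B : ball) (Bs : 'I_d.+1 -> ball) : Prop :=
  (forall k, (Bs k).2 <= iota * B.2) /\
  forall a b V, (forall k, `|dot a (Bs k).1 - b| <= V) ->
      forall j, B.2 * `|a 0 j| <= simplex_const beta (d:=d) * V.

(* Flatness was chosen so that a set within iota r of a hyperplane which meets
   all the small balls would force its unit normal to have norm at most 2/3. *)
Lemma flat_misses N (B : ball) Bs : 0 < B.2 -> (forall k, pball (Bs k) `<=` pball B) ->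
  spread B Bs -> flat N B -> exists k, ~ (N `&` pball (Bs k) !=set0).
Proof.
move=> r0 sub [rk hs] [a [b [a1 hN]]]; apply/existsNP => h.
have C1 := simplex_const_ge1.
pose C := simplex_const beta (d:=d).
have C0 : 0 < C by rewrite (lt_le_trans ltr01).
have hV k : `|dot a (Bs k).1 - b| <= 2 * iota * B.2.
  have [y [Ny yB]] := h k.
  have h1 := hN y Ny (sub k y yB).
  have h2 : `|dot a ((Bs k).1 - y)| <= iota * B.2.
    apply: le_trans (cauchy_schwarz _ _) _; rewrite a1 mul1r enormB.
    by apply: le_trans (rk k); exact: yB.
  have -> : dot a (Bs k).1 - b = dot a ((Bs k).1 - y) + (dot a y - b).
    by rewrite dotBr; ring.
  by apply: le_trans (ler_normD _ _) _; lra.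
have /enorm_le_coord : forall j, `|a 0 j| <= 2 / (3 * d%:R).
  move=> j; have := hs _ _ _ hV j.
  have -> : C * (2 * iota * B.2) = B.2 * (2 / (3 * d%:R)).
    by rewrite /flatness -/C; field; rewrite ?pnatr_eq0 -?lt0n ?d0 gt_eqF.
  by rewrite ler_pM2l.
rewrite a1 (_ : d%:R * _ = 2 / 3); last by field; rewrite pnatr_eq0 -lt0n.
by lra.
Qed.

Lemma cost_spread o (B : ball) Bs : 0 < B.2 -> (forall k, pball (Bs k) `<=` pball B) ->
  spread B Bs -> (forall N s, o = Some (N, s) -> N `&` pball B !=set0 -> flat N B) ->
  (\sum_(k < d.+1) cost o (Bs k) <= \sum_(k < d) cost o B)%E.
Proof.
case: o => [[N s]|] r0 sub hs hf; last by rewrite !big1.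
have [mB|mB] := pselect (N `&` pball B !=set0); last first.
  rewrite !big1 //= => k _; first by rewrite asboolF.
  by rewrite asboolF // => -[y [Ny yB]]; apply: mB; exists y; split => //; exact: (sub k).
have [k0 mk] := flat_misses r0 sub hs (hf N s erefl mB).
rewrite (bigD1_ord k0) //= asboolF // add0e; apply: lee_sum => k _.
by rewrite (asboolT mB); case: ifP => // _; rewrite lee_fin powR_ge0.
Qed.

Lemma pot_spread H (B : ball) Bs : 0 < B.2 -> (forall k, pball (Bs k) `<=` pball B) ->
  spread B Bs -> flat_along H B -> (pot H B <= (B.2 `^ gamma)%:E)%E ->
  (\sum_(k < d.+1) pot H (Bs k) <= \sum_(k < d) pot H B)%E.
Proof.
move=> r0 sub hs; elim: H => [|B1 H IH] /=; first by rewrite !big1.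
move=> [hf fa] hp.
have l0 B' : (0 <= \esum_(i in setT) cost (Em (B1 :: H) i) B')%E.
  by apply: esum_ge0 => i _; exact: cost_ge0.
rewrite !big_split /=; apply: leeD; last first.
  by apply: IH => //; apply: le_trans hp; exact: leeDr.
rewrite -!esum_sum; try by move=> *; exact: cost_ge0.
apply: le_esum => i _; apply: cost_spread => // N s e mB.
have [s0 fl] := hf i N s e; apply: fl.
have : (cost (Em (B1 :: H) i) B <= (B.2 `^ gamma)%:E)%E.
  apply: le_trans hp; apply: le_trans (leeDl _ (pot_ge0 _ _)).
  apply: esum_ge; exists [set i]; first by split => //; exact: finite_set1.
  by rewrite fsbig_set1.
rewrite e /= asboolT // lee_fin => h; rewrite leNgt; apply/negP => h'.
by move: h; apply/negP; rewrite -ltNge gt0_ltr_powR // ?nnegrE ltW.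
Qed.

(** Chosen so that [d.+1 * kappa > d]: the potentials of [d.+1] spread balls add up to at most [d]
    times the potential of [B], so they cannot all exceed this fraction of it. *)
Definition kappa : R := d.+1%:R / d.+2%:R.

Definition good (H : seq ball) (B : ball) (ab : 'rV[R]_d * R) : Prop :=
  enorm ab.1 = 1 /\ forall B' : ball, enorm (B'.1 - B.1) <= B.2 -> pball B' `<=` pball B ->
    B'.2 <= iota * B.2 -> beta * B.2 <= `|dot ab.1 B'.1 - ab.2| ->
    (pot H B' <= kappa%:E * pot H B)%E.

(** If no hyperplane were good, the centres of balls with too much potential would leave the
    neighbourhood of every hyperplane; [simplex] would find [d.+1] of them that are spread, against
    [pot_spread]. *)
Lemma exists_good H (B : ball) : 0 < B.2 -> flat_along H B ->
  (pot H B <= (B.2 `^ gamma)%:E)%E -> exists ab, good H B ab.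
Proof.
move=> r0 fa hp.
pose bad x := exists r', [/\ enorm (x - B.1) <= B.2, pball (x, r') `<=` pball B,
  r' <= iota * B.2 & (kappa%:E * pot H B < pot H (x, r'))%E].
apply: contrapT => no.
have [||x [bx hx]] := @simplex R d beta B.2 B.1 bad d0 beta0 r0.
- by move=> x [r' []].
- move=> a b a1; apply: contrapT => h; apply: no; exists (a, b); split => // B' h1 h2 h3 h4.
  rewrite leNgt; apply/negP => h5; apply: h; exists B'.1 => //.
  by exists B'.2; split => //; rewrite -surjective_pairing.
have /choice[r' hr] : forall k, exists r', [/\ enorm (x k - B.1) <= B.2,
   pball (x k, r') `<=` pball B,
   r' <= iota * B.2 & (kappa%:E * pot H B < pot H (x k, r'))%E] by exact: bx.
pose Bs k : ball := (x k, r' k).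
have sp : spread B Bs by split => // k; have [] := hr k.
have sub k : pball (Bs k) `<=` pball B by have [] := hr k.
have := pot_spread r0 sub sp fa hp.
have [p pE] : exists p : R, pot H B = p%:E.
  exists (fine (pot H B)); rewrite fineK // ge0_fin_numE ?pot_ge0 //.
  exact: le_lt_trans hp (ltry _).
have p0 : 0 <= p by rewrite -lee_fin -pE pot_ge0.
rewrite pE sumEFin sumr_const card_ord => h.
have : (\sum_(k < d.+1) (kappa * p)%:E <= (p *+ d)%:E)%E.
  apply: le_trans h; apply: lee_sum => k _; apply: ltW.
  by have [_ _ _] := hr k; rewrite pE -EFinM.
have lt0 : (kappa%:E * pot H B < pot H (x ord0, r' ord0))%E by have [] := hr ord0.
have p1 : 0 < p.
  rewrite lt_def p0 andbT; apply/eqP => p00; move: h.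
  rewrite p00 mul0rn => h.
  have : (0 < pot H (x ord0, r' ord0))%E by move: lt0; rewrite pE p00 mule0.
  apply/negP; rewrite -leNgt; apply: le_trans h.
  by rewrite (bigD1 0) //= leeDl // sume_ge0 // => k _; exact: pot_ge0.
rewrite sumEFin sumr_const card_ord lee_fin -[leLHS]mulr_natl -[leRHS]mulr_natl mulrA ler_pM2r //.
rewrite /kappa mulrA ler_pdivrMr ?ltr0n // -!natrM ler_nat.
by rewrite succ_square.
Qed.

End Potential.

Section PotentialGame.
Context {R : realType} {d : nat} {I : choiceType}.
Notation ball := (@ball_pair R d).
Variables (beta gamma : R) (Em : seq ball -> I -> option (set 'rV[R]_d * R)).
Variable B0 : ball.
Hypotheses (d0 : (0 < d)%N) (beta0 : 0 < beta) (beta1 : beta < 1) (gamma0 : 0 < gamma).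
Notation iota := (@flatness R d beta).
Notation kappa := (@kappa R d).
Notation pot := (pot gamma Em).
Definition ratio : R := beta * iota.
Notation lam := ratio.
Definition budget : R := (1 - kappa) / 2.
Definition mass (o : option (set 'rV[R]_d * R)) : \bar R :=
  if o is Some (_, s) then (s `^ gamma)%:E else 0%E.

Lemma cost_le_mass o B : (cost gamma o B <= mass o)%E.
Proof.
by case: o => [[N s]|] //=; case: ifP => // _; rewrite lee_fin powR_ge0.
Qed.

(** Equivalent to [kappa <= (1 - budget) * lam ^ gamma]: what is left of the old potential and the
    new announcements together fit under [r ^ gamma] at the next major ball, whose radius has shrunk
    by at most [lam]. *)
Hypothesis hgamma : 2 * kappa / (kappa + 1) <= lam `^ gamma.
Hypothesis Em_flat : forall B H i N s, 0 < B.2 -> pball B `<=` pball B0 ->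
  Em (B :: H) i = Some (N, s) ->
  0 < s /\ forall B', pball B' `<=` pball B -> 0 < B'.2 -> s <= B'.2 -> flat beta N B'.
Hypothesis Em_mass : forall B H, 0 < B.2 -> pball B `<=` pball B0 ->
  (\esum_(i in setT) mass (Em (B :: H) i) <= (budget * B.2 `^ gamma)%:E)%E.

Definition select (H : seq ball) : 'rV[R]_d * R :=
  xget (const_mx 1, 0) [set ab | if H is B :: _ then good beta gamma Em H B ab else False].

Lemma select_neq0 H : (select H).1 != 0.
Proof.
have e1 : const_mx 1 != 0 :> 'rV[R]_d.
  apply/eqP => /rowP/(_ (Ordinal d0)); rewrite !mxE => /eqP; by rewrite oner_eq0.
rewrite /select; case: xgetP => [ab _|_] //=.
case: H => // B H [a1 _]; apply/eqP => a0.
by move: a1; rewrite a0 enorm0 => /esym/eqP; rewrite oner_eq0.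
Qed.

Lemma select_good B H ab : good beta gamma Em (B :: H) B ab ->
  good beta gamma Em (B :: H) B (select (B :: H)).
Proof. by move=> h; apply: (xgetI (P := [set ab | good beta gamma Em (B :: H) B ab]) _ h). Qed.

Definition majors_step (M : seq ball) (B : ball) : seq ball :=
  if M is B1 :: _ then if B.2 <= iota * B1.2 then B :: M else M else [:: B].
Definition majors (s : seq ball) : seq ball := foldl majors_step [::] s.

(** The hyperplane is chosen at a major ball and repeated until the next one. Only the move at the
    major ball itself counts, because Bob's reply to it contains all later balls. *)
Definition potential_strategy : @alice_strategy R d := fun h B =>
  let ab := select (majors (rcons h B)) in (hplane ab.1 ab.2, beta * B.2).

Lemma potential_strategy_legal : alice_legal beta potential_strategy.
Proof.
move=> h B B20; split; last by rewrite /= mulr_gt0 //=.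
by eexists; eexists; split; [exact: (select_neq0 (majors (rcons h B)))|].
Qed.

Lemma kappa_gt0 : 0 < kappa. Proof. by rewrite divr_gt0 ?ltr0n. Qed.
Lemma kappa_lt1 : kappa < 1.
Proof. by rewrite ltr_pdivrMr ?ltr0n // mul1r ltr_nat. Qed.
Lemma budget_gt0 : 0 < budget.
Proof. by rewrite divr_gt0 // subr_gt0 kappa_lt1. Qed.
Lemma iota_gt0 : 0 < iota. Proof. exact: flatness_gt0. Qed.
Lemma ratio_gt0 : 0 < lam. Proof. by rewrite mulr_gt0 ?iota_gt0. Qed.

Section Play.
Variable B : nat -> ball.
Hypotheses (B00 : B 0 = B0) (legal : bob_legal beta potential_strategy B)
  (shrink : forall e : R, 0 < e -> exists n, (B n).2 <= e).

Lemma play_gt0 n : 0 < (B n).2.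
Proof.
elim: n => [|n IH]; first by case: legal.
by have [_ h _] := legal.2 n; rewrite (lt_le_trans _ h) // mulr_gt0.
Qed.

Lemma play_step n : pball (B n.+1) `<=` pball (B n).
Proof. by have [h _ _] := legal.2 n. Qed.

Lemma play_avoids n : pball (B n.+1) `&`
  open_nbhd (alice_move potential_strategy B n).1 (alice_move potential_strategy B n).2 = set0.
Proof. by have [] := legal.2 n. Qed.

Lemma play_sub m n : (m <= n)%N -> pball (B n) `<=` pball (B m).
Proof.
move/subnK => <-; elim: (n - m)%N => [|k IH] //.
by apply: subset_trans IH; rewrite addSn; exact: play_step.
Qed.

Lemma play_radius m n : (m <= n)%N -> (B n).2 <= (B m).2.
Proof.
move=> mn; have := ball_center d0 (play_gt0 n) (play_sub mn).
by have := enorm_ge0 ((B n).1 - (B m).1); lra.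
Qed.

Lemma next_ex n : exists m, (n < m)%N && ((B m).2 <= iota * (B n).2).
Proof.
have [m hm] := shrink (mulr_gt0 iota_gt0 (play_gt0 n)).
exists (maxn n.+1 m); rewrite leq_maxl; apply: le_trans hm.
by apply: play_radius; exact: leq_maxr.
Qed.
Definition next n := ex_minn (next_ex n).
Fixpoint major_time j : nat := if j is j'.+1 then next (major_time j') else 0%N.
Notation t := major_time.
Notation b := (B \o t).

Lemma nextP n : [/\ (n < next n)%N, (B (next n)).2 <= iota * (B n).2,
  lam * (B n).2 <= (B (next n)).2 &
  forall m, (n < m < next n)%N -> iota * (B n).2 < (B m).2].
Proof.
rewrite /next; case: ex_minnP => m /andP[nm hm] mmin.
have h k : (n < k < m)%N -> iota * (B n).2 < (B k).2.
  by move=> /andP[nk km]; rewrite ltNge; apply: contraTN km => hk; rewrite -leqNgt mmin ?nk.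
split => //; case: m nm hm mmin h => // m nm hm mmin h.
have [_ hb _] := legal.2 m; apply: le_trans hb.
rewrite /ratio -mulrA ler_pM2l //.
move: nm; rewrite ltnS leq_eqVlt => /orP[/eqP <-|nm]; last by apply/ltW/h; rewrite nm /=.
have i1 : iota <= 1.
  by apply: le_trans (flatness_lt1 d0 beta0 beta1) _; lra.
by rewrite ler_piMl // ltW // play_gt0.
Qed.

Lemma major_time_le i j : (i <= j)%N -> (t i <= t j)%N.
Proof.
move/subnK => <-; elim: (j - i)%N => [|k IH] //.
by rewrite addSn /=; apply: leq_trans IH _; have [/ltnW] := nextP (t (k + i)).
Qed.

Lemma majors_between j n : (t j <= n < t j.+1)%N -> majors (mkseq B n.+1) = hist b j.
Proof.
elim: j n => [|j IH] n /andP[].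
  elim: n => [|n IHn] _; first by [].
  move=> h; rewrite -[n.+2]/(n.+1).+1 mkseqS /majors foldl_rcons -/(majors _).
  rewrite IHn //; last exact: ltn_trans h.
  rewrite /= ifF //; apply/negbTE; rewrite -ltNge.
  by have [_ _ _] := nextP 0; apply; rewrite /= h.
have [s1 s2 s3 s4] := nextP (t j).
have [s1' _ _ s4'] := nextP (t j.+1).
elim: n => [|n IHn]; first by rewrite leqn0 => /eqP h; move: s1; rewrite -/(t j.+1) h.
rewrite leq_eqVlt => /orP[/eqP e|h1] h2.
  rewrite mkseqS /majors foldl_rcons -/(majors _) IH; last first.
    by rewrite e ltnSn andbT -ltnS -e.
  by rewrite histE /= -e /= s2 -histE.
rewrite mkseqS /majors foldl_rcons -/(majors _) IHn //; last exact: ltn_trans h2.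
rewrite histE /= ifF //; apply/negbTE; rewrite -ltNge.
by apply: s4'; rewrite h1.
Qed.

Lemma major_strategy j : alice_move potential_strategy B (t j) =
  (hplane (select (hist b j)).1 (select (hist b j)).2, beta * (b j).2).
Proof.
rewrite /alice_move /potential_strategy -mkseqS (@majors_between j) //.
by rewrite leqnn; have [] := nextP (t j).
Qed.

Lemma major_sub i j : (i <= j)%N -> pball (b j) `<=` pball (b i).
Proof. by move=> ij; apply: play_sub; exact: major_time_le. Qed.

Lemma major_flat_along j (B' : ball) : 0 < B'.2 -> pball B' `<=` pball (b j) ->
  flat_along beta Em (hist b j) B'.
Proof.
move=> r0; elim: j => [|j IH] sub /=; split => //; last first.
- by apply: IH; apply: subset_trans sub _; exact: (major_sub (leqnSn j)).
- move=> i N s e; have [] := Em_flat (play_gt0 _) _ e.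
    by rewrite -B00; exact: (major_sub (leq0n j.+1)).
  by move=> s0 h; split => // sB; apply: h.
move=> i N s e; have [|s0 h] := Em_flat (play_gt0 _) _ e; first by rewrite B00.
by split => // sB; apply: h.
Qed.

Lemma layer_le j B' : (\esum_(i in setT) cost gamma (Em (hist b j) i) B' <=
   (budget * (b j).2 `^ gamma)%:E)%E.
Proof.
rewrite histE; apply: le_trans (Em_mass _ (play_gt0 _) _); last first.
  by rewrite -B00; exact: (major_sub (leq0n j)).
by apply: le_esum => i _; exact: cost_le_mass.
Qed.

Lemma major_pot j : (pot (hist b j) (b j) <= ((b j).2 `^ gamma)%:E)%E.
Proof.
have k0 := kappa_gt0; have k1 := kappa_lt1.
elim: j => [|j IH].
  rewrite /= adde0; apply: le_trans (layer_le 0 _) _.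
  by rewrite lee_fin /budget ler_piMl ?powR_ge0 //; lra.
have [|ab gab] := exists_good d0 beta0 beta1 gamma0 (play_gt0 (t j)) _ IH.
  by apply: major_flat_along => //; exact: play_gt0.
have gs : good beta gamma Em (hist b j) (b j) (select (hist b j)).
  by move: gab; rewrite !histE => gab; exact: select_good gab.
have [s1 s2 s3 s4] := nextP (t j).
have a1 := gs.1.
have sub1 : pball (b j.+1) `<=` pball (b j) := major_sub (leqnSn j).
have : (pot (hist b j) (b j.+1) <= kappa%:E * pot (hist b j) (b j))%E.
  apply: gs.2 => //.
    have := ball_center d0 (play_gt0 _) sub1; have := play_gt0 (t j.+1) => /=; lra.
  have := play_avoids (t j); rewrite major_strategy => hd.
  have := @disjoint_hplane R d (select (hist b j)).1 (select (hist b j)).2 (b j.+1)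
    (beta * (b j).2); rewrite a1 mulr1; apply.
  - exact: select_neq0.
  - exact/ltW/play_gt0.
  by rewrite -subset0 -hd; apply: setSI; exact: play_sub.
move=> h; rewrite [hist b j.+1]/= -/(hist b j.+1) /=.
apply: le_trans (leeD (layer_le j.+1 _) (le_trans h (lee_wpmul2l _ IH))) _.
  by rewrite lee_fin ltW.
rewrite -EFinM -EFinD lee_fin /=.
have L0 := ratio_gt0.
have hr : lam `^ gamma * (b j).2 `^ gamma <= (b j.+1).2 `^ gamma.
  rewrite -powRM ?(ltW L0) ?(ltW (play_gt0 _)) //.
  by apply: ge0_ler_powR; rewrite ?nnegrE ?(ltW gamma0) ?(mulr_ge0 (ltW L0)) ?(ltW (play_gt0 _)).
set x := (_ j.+1).2 `^ gamma in hr *; set y := (_ j).2 `^ gamma in hr *.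
have y0 : 0 <= y by exact: powR_ge0.
have : 2 * kappa / (kappa + 1) * y <= x by apply: le_trans hr; exact: ler_wpM2r.
rewrite mulrAC ler_pdivrMr ?addr_gt0 // /budget; lra.
Qed.

Lemma cost_le_pot j j' i B' : (j <= j')%N ->
  (cost gamma (Em (hist b j) i) B' <= pot (hist b j') B')%E.
Proof.
move/subnK => <-; elim: (j' - j)%N => [|k IH].
  rewrite add0n histE /= -histE; apply: le_trans (leeDl _ (pot_ge0 _ _ _ _)).
  apply: esum_ge; exists [set i]; first by split => //; exact: finite_set1.
  by rewrite fsbig_set1.
rewrite addSn /=; apply: le_trans IH _; apply: leeDr.
by apply: esum_ge0 => ? _; exact: cost_ge0.
Qed.

Theorem potential_play : [/\ t 0 = 0%N,
  forall j, (t j < t j.+1)%N,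
  forall j, lam * (b j).2 <= (b j.+1).2 <= iota * (b j).2 &
  forall j i N s, Em (hist b j) i = Some (N, s) -> forall j', (j <= j')%N ->
    N `&` pball (b j') !=set0 -> s <= (b j').2].
Proof.
split => // [j|j|j i N s e j' jj' mN].
- by have [] := nextP (t j).
- by have [_ -> -> _] := nextP (t j).
have [s0 _] : 0 < s /\ True.
  move: e; rewrite histE => e; have [] := Em_flat (play_gt0 _) _ e => //.
  by rewrite -B00; exact: (major_sub (leq0n j)).
have := le_trans (cost_le_pot i (b j') jj') (major_pot j').
rewrite e /= asboolT // lee_fin => h; rewrite leNgt; apply/negP => h'.
by move: h; apply/negP; rewrite -ltNge gt0_ltr_powR // ?nnegrE ltW // play_gt0.
Qed.

End Play.
End PotentialGame.

(** * Bob's plays *)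

(** Dependent choice with the whole past available, since Alice's answer to a ball depends on it. *)
Lemma history_recursion (T : Type) (inv : seq T -> T -> Prop) (step : seq T -> T -> T -> Prop)
    (x0 : T) : inv [::] x0 ->
  (forall h x, inv h x -> exists2 y, step h x y & inv (rcons h x) y) ->
  exists B : nat -> T, B 0 = x0 /\
    forall n, inv (mkseq B n) (B n) /\ step (mkseq B n) (B n) (B n.+1).
Proof.
move=> inv0 hs.
have /choice[nxt hn] : forall s : seq T * T, exists y, inv s.1 s.2 ->
    step s.1 s.2 y /\ inv (rcons s.1 s.2) y.
  move=> [h x]; have [/hs[y sy iy]|ni] := pselect (inv h x); first by exists y.
  by exists x => /ni.
pose st := fix st n := if n is n'.+1 then (rcons (st n').1 (st n').2, nxt (st n'))
  else ([::], x0).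
pose B n := (st n).2.
have stE n : (st n).1 = mkseq B n by elim: n => // n IH; rewrite mkseqS -IH.
have stI n : inv (st n).1 (st n).2 by elim: n => // n IH; have [] := hn _ IH.
exists B; split => // n; rewrite -stE; split; first exact: stI.
by have [] := hn _ (stI n).
Qed.

Lemma geometric_small (R : realType) (r beta e : R) : 0 <= r -> 0 < beta -> beta < 1 ->
  0 < e -> exists n, r * beta ^+ n <= e.
Proof.
move=> r0 beta0 beta1 e0.
have b1 : `|beta| < 1 by rewrite ger0_norm // ltW.
have /cvgrPdist_le/(_ e e0)[N _ hN] := cvg_geometric r b1.
exists N; have := hN N (leqnn N); rewrite sub0r normrN ger0_norm //.
by rewrite mulr_ge0 // exprn_ge0 // ltW.
Qed.

Section Plays.
Context {R : realType} {d : nat}.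
Notation ball := (@ball_pair R d).

(** The radii may have a positive limit [r], and then the ball [(c, r)] lies in all balls.
    Coordinatewise, [c - r] is the supremum of the lower ends of the projected balls. *)
Lemma nested_center (B : nat -> ball) : (forall n, 0 < (B n).2) ->
  (forall n m, (n <= m)%N -> enorm ((B m).1 - (B n).1) <= (B n).2 - (B m).2) ->
  exists c r, [/\ 0 <= r, forall n, enorm (c - (B n).1) <= (B n).2 - r &
    forall e, 0 < e -> exists n, (B n).2 <= r + e].
Proof.
move=> r0 hB.
pose r := inf (range (fun n => (B n).2)).
have lbr : has_lbound (range (fun n => (B n).2)) by exists 0 => _ [n _ <-]; exact: ltW.
have rle n : r <= (B n).2 by apply: ge_inf => //; exists n.
have rge0 : 0 <= r.
  by apply: lb_le_inf; [exists (B 0).2, 0%N|move=> _ [n _ <-]; exact: ltW].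
have rapp e : 0 < e -> exists n, (B n).2 <= r + e.
  move=> e0; have [|_ [n _ <-] hn] := @inf_adherent R (range (fun n => (B n).2)) e e0.
    by split => //; exists (B 0).2, 0%N.
  by exists n; exact: ltW.
have rm n m : (n <= m)%N -> (B m).2 <= (B n).2.
  by move=> /hB; have := enorm_ge0 ((B m).1 - (B n).1); lra.
pose S i := range (fun n => (B n).1 0 i - (B n).2).
have hcoord n m i : (B m).1 0 i - (B m).2 <= (B n).1 0 i + (B n).2 - 2 * r.
  have h k l : (k <= l)%N -> `|(B l).1 0 i - (B k).1 0 i| <= (B k).2 - (B l).2.
    by move=> kl; apply: le_trans (hB k l kl); have := coord_le ((B l).1 - (B k).1) i; rewrite !mxE.
  have rn := rle n; have rm' := rle m.
  by have [/h|/ltnW/h] := leqP n m; rewrite ler_norml => /andP[]; lra.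
pose c : 'rV[R]_d := \row_i (sup (S i) + r).
have hc n i : `|c 0 i - (B n).1 0 i| <= (B n).2 - r.
  have ub : has_ubound (S i).
    by exists ((B n).1 0 i + (B n).2 - 2 * r) => _ [m _ <-].
  have h1 : sup (S i) <= (B n).1 0 i + (B n).2 - 2 * r.
    by apply: ge_sup; [exists ((B 0).1 0 i - (B 0).2), 0%N|move=> _ [m _ <-]].
  have h2 : (B n).1 0 i - (B n).2 <= sup (S i) by apply: ub_le_sup => //; exists n.
  by rewrite mxE ler_norml; apply/andP; split; lra.
(* Coordinate bounds lose a factor [d], so they are used only between [c] and a late centre whose
   radius is within [e / (d + 1)] of [r]. *)
exists c, r; split => // n; apply/ler_addgt0Pr => e e0.
have e1 : 0 < e / (d%:R + 1) by rewrite divr_gt0 // ltr_pwDr.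
have [m0 hm0] := rapp _ e1.
pose m := maxn n m0.
have hm : (B m).2 <= r + e / (d%:R + 1) by apply: le_trans hm0; apply: rm; exact: leq_maxr.
have g1 := hB n m (leq_maxl _ _).
have g2 : enorm (c - (B m).1) <= d%:R * (e / (d%:R + 1)).
  apply: enorm_le_coord => i; rewrite !mxE; have := hc m i; rewrite mxE; lra.
have := ler_enorm_dist c (B m).1 (B n).1.
have eE : e = d%:R * (e / (d%:R + 1)) + e / (d%:R + 1).
  by field; rewrite gt_eqF // ltr_pwDr.
have := rle m; rewrite [X in _ -> _ -> _ <= _ + X]eE; lra.
Qed.

Variable beta : R.
Hypotheses (d0 : (0 < d)%N) (beta0 : 0 < beta) (beta3 : beta < 3^-1).

Lemma bob_gt0 sigma (B : nat -> ball) n : bob_legal beta sigma B -> 0 < (B n).2.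
Proof.
move=> [r0 h]; elim: n => // n IH.
have := h n; case: alice_move => H e [_ h2 _].
by rewrite (lt_le_trans _ h2) // mulr_gt0.
Qed.

Lemma bob_nested sigma (B : nat -> ball) m n : bob_legal beta sigma B -> (m <= n)%N ->
  pball (B n) `<=` pball (B m).
Proof.
move=> [_ h] /subnK <-; elim: (n - m)%N => [|k IH] //.
apply: subset_trans IH; rewrite addSn; have := h (k + m)%N.
by case: alice_move => H e [].
Qed.

Lemma bob_center sigma (B : nat -> ball) m n : bob_legal beta sigma B -> (m <= n)%N ->
  enorm ((B n).1 - (B m).1) <= (B m).2 - (B n).2.
Proof. by move=> l mn; apply: ball_center => //; [exact: bob_gt0 l|exact: bob_nested l mn]. Qed.

(** The centre moves by [(1 - beta) * B.2] along the normal, away from the hyperplane; this is at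
    least [e + beta * B.2] because [3 * beta < 1]. *)
Lemma bob_response (B : ball) H e : 0 < B.2 -> affine_hyperplane H -> e <= beta * B.2 ->
  exists B' : ball, [/\ B'.2 = beta * B.2, pball B' `<=` pball B &
    pball B' `&` open_nbhd H e = set0].
Proof.
move=> r0 [a [b [a0 ->]]] he.
have n0 := enorm_gt0 a0.
have b3 : 3 * beta < 1 by move: beta3; rewrite -ltr_pdivlMl // mulr1.
pose k : R := if 0 <= dot a B.1 - b then 1 else -1.
have k1 : `|k| = 1 by rewrite /k; case: ifP => _; rewrite ?normrN normr1.
exists (B.1 + (k * ((1 - beta) * B.2 / enorm a)) *: a, beta * B.2); split => //.
  apply: pball_sub; rewrite /= addrC addKr enormZ normrM k1 mul1r ger0_norm.
    by rewrite divfK ?gt_eqF //; lra.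
  by apply: divr_ge0; [apply: mulr_ge0; [lra|]|]; exact: ltW.
apply: hplane_disjoint => //=; rewrite dotDr dotZr -enorm_sqr.
have -> : k * ((1 - beta) * B.2 / enorm a) * enorm a ^+ 2 = k * ((1 - beta) * B.2 * enorm a).
  by field; rewrite gt_eqF.
have h1 : (e + beta * B.2) * enorm a <= (1 - beta) * B.2 * enorm a.
  rewrite ler_pM2r //.
  have : 0 <= (1 - 3 * beta) * B.2 by apply: mulr_ge0; [lra|exact: ltW].
  by lra.
apply: le_trans h1 _; set X := (1 - beta) * B.2 * enorm a.
have X0 : 0 <= X by apply: mulr_ge0; [apply: mulr_ge0; [lra|]|]; exact: ltW.
rewrite /k; case: ifP => hs.
  by rewrite mul1r ger0_norm; lra.
have : dot a B.1 - b < 0 by rewrite ltNge hs.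
by move=> hs'; rewrite mulN1r ler0_norm; lra.
Qed.

Lemma shrinking_play sigma (B0 : ball) : alice_legal beta sigma -> 0 < B0.2 ->
  exists B, [/\ B 0 = B0, bob_legal beta sigma B &
    forall e : R, 0 < e -> exists n, (B n).2 <= e].
Proof.
move=> al r0.
have [|B [B00 hB]] := @history_recursion ball (fun _ B => 0 < B.2) (fun h B B' =>
   [/\ B'.2 = beta * B.2, pball B' `<=` pball B &
    pball B' `&` open_nbhd (sigma h B).1 (sigma h B).2 = set0]) B0 r0.
  move=> h B B20; have [hH /andP[_ he]] := al h B B20.
  have [B' [e1 e2 e3]] := bob_response B20 hH he.
  by exists B' => //; rewrite e1 mulr_gt0.
exists B; split => //.
  split; first by rewrite B00.
  move=> n; have [_ [e1 e2 e3]] := hB n; rewrite /alice_move.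
  by move: e3; case: (sigma _ _) => H e /= e3; split; rewrite ?e1.
have beta1 : beta < 1 by apply: lt_trans beta3 _; rewrite invf_lt1 ?ltr1n.
have rE n : (B n).2 = B0.2 * beta ^+ n.
  elim: n => [|n IH]; first by rewrite B00 expr0 mulr1.
  by have [_ [-> _ _]] := hB n; rewrite IH exprS mulrCA.
move=> e e0; have [n hn] := geometric_small (ltW r0) beta0 beta1 e0.
by exists n; rewrite rE.
Qed.

End Plays.

Section Winning.
Context {R : realType} {d : nat}.
Notation ball := (@ball_pair R d).

(* If Bob's radii do not tend to 0, Alice plays a second, shrinking game inside
   the intersection of his balls. *)
Lemma shrinking_winning (S : set 'rV[R]_d) : (0 < d)%N ->
  (forall beta, 0 < beta < 3^-1 -> forall B0 : ball, 0 < B0.2 ->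
    exists sigma, alice_legal beta sigma /\ forall B, B 0 = B0 -> bob_legal beta sigma B ->
      (forall e : R, 0 < e -> exists n, (B n).2 <= e) ->
      forall x, (forall n, pball (B n) x) -> S x) ->
  hyperplane_absolute_winning S.
Proof.
move=> d0 hS beta /[dup] hb /andP[b0 b3].
have /choice[sig hsig] : forall B0 : ball, exists sigma, 0 < B0.2 ->
    alice_legal beta sigma /\ forall B, B 0 = B0 -> bob_legal beta sigma B ->
      (forall e : R, 0 < e -> exists n, (B n).2 <= e) ->
      forall x, (forall n, pball (B n) x) -> S x.
  move=> B0; have [r0|r0] := boolP (0 < B0.2).
    by have [sigma h] := hS beta hb B0 r0; exists sigma.
  by exists (fun _ _ => (set0, 0)).
pose sigma : alice_strategy := fun h B =>
  if 0 < (head B h).2 then sig (head B h) h B else sig B h B.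
have legal_sig B : bob_legal beta sigma B -> bob_legal beta (sig (B 0)) B.
  move=> [r0 h]; split => // n; have := h n; rewrite /alice_move /sigma.
  have -> : head (B n) (mkseq B n) = B 0 by case: n.
  by rewrite r0.
have al : alice_legal beta sigma.
  move=> h B r0; rewrite /sigma; case: ifP => hh.
    by have [+ _] := hsig _ hh; apply.
  by have [+ _] := hsig _ r0; apply.
exists sigma; split => // B lB.
have [c [r [r0 hc hr]]] := nested_center (fun n => bob_gt0 b0 n lB)
  (fun n m nm => bob_center d0 b0 lB nm).
have cB n : pball (B n) c by rewrite /pball /eball /=; have := hc n; lra.
move: r0; rewrite le_eqVlt => /orP[/eqP r0|r0].
  exists c; split; first by move=> n _.
  have [_ h] := hsig (B 0) lB.1; apply: (h B) => //; first exact: legal_sig.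
  by move=> e e0; have [n hn] := hr e e0; exists n; rewrite -[e]add0r r0.
have [B' [B'0 lB' shr]] := @shrinking_play R d beta b0 b3 sigma (c, r) al r0.
have [x [_ [_ hx]]] : exists (x : 'rV[R]_d) (_ : R), 0 <= 0 :> R /\ forall n, pball (B' n) x.
  have [x [r' [r'0 hx _]]] := nested_center (fun n => bob_gt0 b0 n lB')
    (fun n m nm => bob_center d0 b0 lB' nm).
  by exists x, 0; split => // n; rewrite /pball /eball /=; have := hx n; lra.
exists x; split.
  move=> n _; have := hx 0; rewrite B'0 /pball /eball /= => h.
  have := ler_enorm_dist x c (B n).1; have := hc n; lra.
have [_ h] := hsig (c, r) r0; apply: (h B') => //.
by have := legal_sig _ lB'; rewrite B'0.
Qed.

End Winning.

(** * A criterion for bad approximability *)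

Section Sums.
Context {R : realType}.

Lemma esum_nat_halves (c : R) : 0 <= c ->
  (\esum_(k in [set: nat]) (c / 2 ^+ k.+1)%:E <= c%:E)%E.
Proof.
move=> c0; rewrite -nneseries_esumT; last first.
  by move=> k; rewrite lee_fin divr_ge0 // exprn_ge0.
apply: le_trans (epsilon_trick0 xpredT c0); apply: lee_nneseries => k _.
  by rewrite lee_fin divr_ge0 // exprn_ge0.
by rewrite lee_fin natrX lexx.
Qed.

Lemma esum_prod_halves (A : choiceType) (F : A -> R) : (forall a, 0 <= F a) ->
  (\esum_(k in [set: A * nat]) (F k.1 / 2 ^+ k.2.+1)%:E <= \esum_(a in setT) (F a)%:E)%E.
Proof.
move=> F0.
have -> : [set: A * nat] = [set: A] `*`` (fun=> [set: nat]).
  by rewrite eqEsubset; split => -[a n].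
rewrite -(@esum_esum R A nat setT (fun=> setT) (fun a n => (F a / 2 ^+ n.+1)%:E)).
  by apply: le_esum => a _; exact: esum_nat_halves.
by move=> a n _ _; rewrite lee_fin divr_ge0 // exprn_ge0.
Qed.

End Sums.

Section BadCriterion.
Context {R : realType} {d : nat}.

Lemma dist_int_near (t : R) (e : R) : dist_int t < e -> exists P : int, `|t - P%:~R| < e.
Proof.
move=> h; have [||_ [P _ <-] hP] := @inf_lt R [set `|t - n%:~R| | n in [set: int]] e.
- by exists `|t - 0%:~R|, 0.
- by [].
by exists P.
Qed.

(** The hypothesis speaks of integral vectors and of powers [|q| ^ w_i] of the height; taking the
    root of order [w_i] in the coordinate found gives the normalisation of [bad_quality]. *)
Lemma bad_criterion (theta w z : 'rV[R]_d) (c : R) : 0 < c ->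
  (forall (q : int) (P : 'rV[int]_d), q != 0 -> exists i, 0 < w 0 i /\
     c <= `|q%:~R * z 0 i - (P 0 i)%:~R - theta 0 i| * expR (w 0 i * ln `|q%:~R|)) ->
  Bad theta w z.
Proof.
move=> c0 h.
(* A coordinate of weight 0 contributes [c ^ 0 = 1], which is harmless. *)
pose c' := \big[Num.min/1]_(i < d) (c `^ (w 0 i)^-1).
have c'0 : 0 < c' by apply: lt_bigmin => // i _; rewrite powR_gt0.
rewrite /Bad /= /liminf_int; apply: (@lt_le_trans _ _ c'%:E); first by rewrite lte_fin.
apply: le_trans (ereal_sup_ubound _); last by exists 0%N.
apply: le_ereal_inf_tmp => _ [q [q0 _] <-]; rewrite lee_fin /bad_quality.
have Q0 : 0 < `|q%:~R| :> R by rewrite normr_gt0 intr_eq0.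
pose t i := q%:~R * z 0 i - theta 0 i.
have [i [wi hi]] : exists i, 0 < w 0 i /\ c <= dist_int (t i) * expR (w 0 i * ln `|q%:~R|).
  (* If every coordinate failed, near integers chosen separately for the coordinates would form one
     vector [P] that contradicts [h]. *)
  apply: contrapT => no.
  have /choice[P hP] : forall i, exists P : int,
      0 < w 0 i -> `|t i - P%:~R| * expR (w 0 i * ln `|q%:~R|) < c.
    move=> i; have [wi|wi] := boolP (0 < w 0 i); last by exists 0.
    have : dist_int (t i) < c / expR (w 0 i * ln `|q%:~R|).
      rewrite ltr_pdivlMr ?expR_gt0 // ltNge; apply/negP => h'; apply: no.
      by exists i.
    by move=> /dist_int_near[P hP]; exists P => _; rewrite -ltr_pdivlMr ?expR_gt0.
  have [i [wi hi]] := h q (\row_i P i) q0.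
  have := hP i wi; rewrite ltNge; apply/negP; rewrite negbK.
  by apply: le_trans hi _; rewrite mxE /t addrAC.
have D0 : 0 < dist_int (t i).
  by rewrite -(pmulr_lgt0 _ (expR_gt0 (w 0 i * ln `|q%:~R|))); exact: lt_le_trans hi.
have h1 : c `^ (w 0 i)^-1 <= wpow (t i) (w 0 i) * `|q|%:~R.
  rewrite /wpow gt_eqF // intr_norm.
  have -> : `|q%:~R| = expR (w 0 i * ln `|q%:~R|) `^ (w 0 i)^-1 :> R.
    by rewrite /powR gt_eqF ?expR_gt0 // expRK mulKf ?gt_eqF // lnK.
  rewrite -powRM ?(ltW D0) ?(ltW (expR_gt0 _)) //.
  by rewrite ge0_ler_powR ?nnegrE ?invr_ge0 ?(ltW wi) ?(ltW c0) ?mulr_ge0 ?(ltW D0) ?(ltW (expR_gt0 _)).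
apply: le_trans (_ : c `^ (w 0 i)^-1 <= _); first exact: bigmin_le_cond.
apply: le_trans h1 _; rewrite ler_wpM2r ?ler0z ?normr_ge0 //.
exact: (le_bigmax_cond _ (fun i => wpow (t i) (w 0 i))).
Qed.

End BadCriterion.

(** * Charts *)

Section Compactness.
Context {R : realType} {d m n : nat}.
Implicit Types (x y c : 'rV[R]_d) (Phi : 'rV[R]_d -> 'M[R]_(m, n)).

Lemma mx_norm_le (A : 'M[R]_(m, n)) e : 0 <= e -> (forall i j, `|A i j| <= e) -> `|A| <= e.
Proof.
by move=> e0 h; rewrite [leLHS]/Num.norm /= mx_normrE; apply/bigmax_leP; split => // -[i j] _; exact: h.
Qed.

Lemma entry_le_norm (A : 'M[R]_(m, n)) i j : `|A i j| <= `|A|.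
Proof.
by rewrite [leRHS]/Num.norm /= mx_normrE; apply/bigmax_geP; right; exists (i, j).
Qed.

Definition box c (r : R) : set 'rV[R]_d := [set x | forall i, x 0 i \in `[c 0 i - r, c 0 i + r]].

Lemma box_compact c r : compact (box c r).
Proof.
apply: (@rV_compact _ _ (fun i => `[c 0 i - r, c 0 i + r]%classic)) => i.
exact: segment_compact.
Qed.

Lemma pball_box c r : pball (c, r) `<=` box c r.
Proof.
move=> x hx i; have := le_trans (coord_le (x - c) i) hx.
by rewrite !mxE in_itv /= ler_norml lerBlDl lerBrDl => /andP[h1 h2]; rewrite h2 andbT; lra.
Qed.

Lemma bounded_on_compact Phi (K : set 'rV[R]_d) : continuous Phi -> compact K ->
  exists2 M, 0 < M & forall x, K x -> forall i j, `|Phi x i j| <= M.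
Proof.
move=> cP cK.
have := @compact_bounded R _ (Phi @` K) (continuous_compact (continuous_subspaceT cP) cK).
move=> [M [Mr hM]]; exists (`|M| + 1); first by rewrite ltr_pwDr.
move=> x Kx i j; apply: le_trans (entry_le_norm _ _ _) _; apply: hM; last by exists x.
by rewrite (le_lt_trans (ler_norm _)) // ltrDl.
Qed.

End Compactness.

Section Uniform.
Context {R : realType} {d m n : nat}.
Implicit Types (x y c : 'rV[R]_d) (Phi : 'rV[R]_d -> 'M[R]_(m, n)).

Lemma norm_le_enorm x : `|x| <= enorm x.
Proof. by apply: mx_norm_le => [|i j]; [exact: enorm_ge0|rewrite ord1; exact: coord_le]. Qed.

Lemma uniform_on_compact Phi (K : set 'rV[R]_d) (eta : R) : continuous Phi -> compact K ->
  0 < eta -> exists2 rho, 0 < rho & forall x y, K x -> enorm (y - x) <= rho ->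
    forall i j, `|Phi y i j - Phi x i j| <= eta.
Proof.
move=> cP /compact_near_coveringP cK eta0.
pose P (rho : R) x := forall y, enorm (y - x) <= rho ->
    forall i j, `|Phi y i j - Phi x i j| <= eta.
have h : \forall rho \near (0:R)^'+, K `<=` P rho.
  apply: cK => x Kx.
  have e20 : 0 < eta / 2 by rewrite divr_gt0.
  have /cvgrPdist_le/(_ _ e20)/nbhs_ballP[e /= e0 he] := cP x.
  have e3 : 0 < e / 2 by rewrite divr_gt0.
  exists (ball x (e / 2), [set rho | rho < e / 2]) => /=.
    by split; [exact: nbhsx_ballx|exact: nbhs_right_lt].
  move=> [x' rho] /= [hx hr] y hy i j.
  have bx : ball x e x' by apply: le_ball hx; lra.
  have by' : ball x e y.
    move: hx; rewrite -!ball_normE /= => hx.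
    have : `|y - x'| < e / 2 by apply: le_lt_trans (norm_le_enorm _) _; apply: le_lt_trans hy hr.
    have := ler_distD x' x y; rewrite (distrC x' y); lra.
  have h1 := le_trans (entry_le_norm _ i j) (he _ bx).
  have h2 := le_trans (entry_le_norm _ i j) (he _ by').
  rewrite !mxE in h1 h2; have := ler_distD (Phi x i j) (Phi y i j) (Phi x' i j).
  rewrite (distrC (Phi y i j) (Phi x i j)); lra.
have [rho [h1 h2]] : exists rho : R, 0 < rho /\ K `<=` P rho.
  have : \forall rho \near 0^'+, 0 < rho /\ K `<=` P rho.
    by apply: filterI => //; exact: nbhs_right_gt.
  exact: filter_ex.
by exists rho => // x y Kx; exact: h2.
Qed.

End Uniform.

Section MeanValue.
Context {R : realType} {d : nat}.
Variable g : 'rV[R]_d -> 'rV[R]_d.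
Hypothesis dg : forall x, differentiable g x.

Lemma is_derive_line x v k (t : R) :
  is_derive t 1 (fun t : R => g (x + t *: v) 0 k) ((v *m jacobian g (x + t *: v)) 0 k).
Proof.
have /cvg_ex[l hl] := diff_derivable (v := v) (dg (x + t *: v)).
have lE : l = v *m jacobian g (x + t *: v).
  by rewrite -deriveEjacobian // /derive; apply/esym/cvg_lim.
have cv : (fun h : R => h^-1 *: ((g (x + (h *: 1 + t) *: v) 0 k : R) - g (x + t *: v) 0 k)) @ 0^' --> l 0 k.
  have -> : (fun h : R => h^-1 *: ((g (x + (h *: 1 + t) *: v) 0 k : R) - g (x + t *: v) 0 k)) =
     (fun M : 'rV[R]_d => M 0 k) \o (fun h : R => h^-1 *: (g (h *: v + (x + t *: v)) - g (x + t *: v))).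
    apply/funext => h /=; rewrite !mxE; congr (_ * (g _ 0 k - _)).
    by rewrite scalerDl [h *: 1]mulr1 addrCA.
  by apply: cvg_comp hl _; exact: coord_continuous.
split; first by apply/cvg_ex; exists (l 0 k).
by rewrite -lE; exact: cvg_lim.
Qed.

Lemma mean_value x y k : exists2 t, 0 <= t <= 1 &
  g y 0 k - g x 0 k = ((y - x) *m jacobian g (x + t *: (y - x))) 0 k.
Proof.
have := @MVT R (fun t => g (x + t *: (y - x)) 0 k)
  (fun t => ((y - x) *m jacobian g (x + t *: (y - x))) 0 k) 0 1 ltr01.
case.
- by move=> t _; exact: is_derive_line.
- apply: derivable_within_continuous => t _.
  by have [] := is_derive_line x (y - x) k t.
move=> t; rewrite in_itv /= => /andP[t0 t1]; rewrite scale0r addr0 scale1r (addrC x (y - x)) subrK.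
by rewrite subr0 mulr1 => e; exists t => //; rewrite !ltW.
Qed.

End MeanValue.

Section Chart.
Context {R : realType} {d : nat}.
Variables f g : 'rV[R]_d -> 'rV[R]_d.
Hypotheses (fg : cancel f g) (gf : cancel g f) (fC1 : C1 f) (gC1 : C1 g).
Notation ball := (@ball_pair R d).

Lemma row_mul_le (v : 'rV[R]_d) (A : 'M[R]_d) M k : 0 <= M -> (forall i, `|A i k| <= M) ->
  `|(v *m A) 0 k| <= d%:R * M * enorm v.
Proof.
move=> M0 hA; rewrite mxE; apply: le_trans (ler_norm_sum _ _ _) _.
have -> : d%:R * M * enorm v = \sum_(i < d) enorm v * M.
  by rewrite sumr_const card_ord -[RHS]mulr_natl mulrAC mulrA.
by apply: ler_sum => i _; rewrite normrM; apply: ler_pM => //; exact: coord_le.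
Qed.

Lemma segment_pball (B : ball) x y (t : R) : 0 <= t <= 1 -> pball B x -> pball B y ->
  pball B (x + t *: (y - x)).
Proof.
move=> /andP[t0 t1]; rewrite /pball /eball /= => hx hy.
have -> : x + t *: (y - x) - B.1 = (1 - t) *: (x - B.1) + t *: (y - B.1).
  by rewrite scalerBl scale1r !scalerBr; apply/rowP => i; rewrite !mxE; ring.
apply: le_trans (ler_enormD _ _) _; rewrite !enormZ !ger0_norm ?subr_ge0 //.
have h1 : (1 - t) * enorm (x - B.1) <= (1 - t) * B.2 by rewrite ler_wpM2l ?subr_ge0.
have h2 : t * enorm (y - B.1) <= t * B.2 by rewrite ler_wpM2l.
lra.
Qed.

Lemma chart_lipschitz (B0 : ball) : exists2 L, 1 <= L &
  forall x y, pball B0 x -> pball B0 y -> forall k, `|g y 0 k - g x 0 k| <= L * enorm (y - x).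
Proof.
have [M M0 hM] := bounded_on_compact gC1.2 (@box_compact R d B0.1 B0.2).
exists (1 + d%:R * M); first by rewrite lerDl mulr_ge0 // ltW.
move=> x y hx hy k; have [t t01 ->] := mean_value gC1.1 x y k.
apply: le_trans (_ : d%:R * M * enorm (y - x) <= _).
  apply: row_mul_le => [|i]; first exact: ltW.
  by apply: hM; apply: pball_box; apply: segment_pball; rewrite -?surjective_pairing.
by rewrite ler_wpM2r ?enorm_ge0 // lerDr.
Qed.

Lemma jacobian_inv x : jacobian f (g x) *m jacobian g x = 1%:M.
Proof.
apply: mulmx1C; apply/row_matrixP => i; rewrite row1 rowE.
have dJ (h : 'rV[R]_d -> 'rV[R]_d) y v : differentiable h y -> 'd h y v = v *m jacobian h y.
  by move=> dh; rewrite -deriveEjacobian // deriveE.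
have e (v : 'rV[R]_d) : v *m jacobian (f \o g) x = v *m jacobian g x *m jacobian f (g x).
  have dfg : differentiable (f \o g) x by apply: differentiable_comp; [exact: gC1.1|exact: fC1.1].
  transitivity ('d (f \o g) x v); first by apply/esym/dJ.
  have -> : 'd (f \o g) x v = 'd f (g x) ('d g x v).
    exact: (congr1 (fun h => h v) (diff_comp (gC1.1 x) (fC1.1 (g x)))).
  apply: etrans (dJ f (g x) _ (fC1.1 (g x))) _.
  exact: (congr1 (fun u => u *m jacobian f (g x)) (dJ g x v (gC1.1 x))).
rewrite mulmxA -e.
have -> : f \o g = id by apply/funext => y /=; rewrite gf.
by rewrite -deriveEjacobian // derive_id.
Qed.

(* Preimages of slabs under a C1 chart are flat at small scales: the differential
   is almost constant there, and its inverse is bounded. *)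
Lemma chart_flat (iota : R) (B0 : ball) : 0 < iota -> (0 < d)%N ->
  exists kap rho, [/\ 1 <= kap, 0 < rho &
  forall (a : 'rV[R]_d) b i eps (B : ball), pball B `<=` pball B0 -> 0 < B.2 <= rho ->
    a 0 i != 0 -> kap * eps / `|a 0 i| <= B.2 ->
    exists (n : 'rV[R]_d) (c : R), enorm n = 1 /\
      forall x, `|dot a (g x) + b| < eps -> pball B x -> `|dot n x - c| <= iota * B.2].
Proof.
move=> iota0 d0.
have cfg : continuous (fun x => jacobian f (g x)).
  move=> x; apply: continuous_comp; last exact: fC1.2.
  exact: differentiable_continuous (gC1.1 x).
have [M M0 hM] := bounded_on_compact cfg (@box_compact R d B0.1 B0.2).
have d1 : 1 <= d%:R :> R by rewrite ler1n.
pose k' := 1 + iota + d%:R * (d%:R * M).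
have dM0 : 0 <= d%:R * (d%:R * M) by rewrite !mulr_ge0 // ltW.
have k0 : 0 < k' by rewrite /k'; lra.
pose eta := iota / (4 * k' * d%:R * d%:R).
have eta0 : 0 < eta by rewrite divr_gt0 // !mulr_gt0 // ltr0n.
have [rho rho0 hrho] := uniform_on_compact gC1.2 (@box_compact R d B0.1 B0.2) eta0.
exists (4 * k' / iota), rho; split => //.
  by rewrite ler_pdivlMr // /k'; lra.
move=> a b i eps B sub /andP[r0 rr] ai0 hs.
have a0 : a != 0 by apply: contraNneq ai0 => ->; rewrite mxE.
have na0 := enorm_gt0 a0.
have cB0 : pball B0 B.1 by apply: sub; rewrite /pball /eball /= subrr enorm0 ltW.
pose n := a *m (jacobian g B.1)^T.
have hn : enorm a <= k' * enorm n.
  have aE : a = n *m (jacobian f (g B.1))^T.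
    by rewrite -mulmxA -trmx_mul jacobian_inv trmx1 mulmx1.
  have h j : `|a 0 j| <= d%:R * M * enorm n.
    rewrite aE; apply: row_mul_le => [|l]; first exact: ltW.
    by rewrite mxE; apply: hM; exact: pball_box.
  apply: le_trans (enorm_le_coord h) _; rewrite !mulrA ler_wpM2r ?enorm_ge0 //.
  by rewrite /k'; lra.
have nn0 : 0 < enorm n.
  rewrite lt_def enorm_ge0 andbT; apply: contraTneq hn => ->.
  by rewrite mulr0 -ltNge.
have [[x0 [hx0 Bx0]]|no] := pselect (exists x0, `|dot a (g x0) + b| < eps /\ pball B x0); last first.
  exists ((enorm n)^-1 *: n), 0; split.
    by rewrite enormZ normfV ger0_norm ?enorm_ge0 // mulVf // gt_eqF.
  by move=> x h1 h2; exfalso; apply: no; exists x.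
exists ((enorm n)^-1 *: n), ((enorm n)^-1 * dot n x0); split.
  by rewrite enormZ normfV ger0_norm ?enorm_ge0 // mulVf // gt_eqF.
move=> x hx Bx; rewrite dotZl -mulrBr -dotBr normrM normfV (ger0_norm (enorm_ge0 n)).
rewrite mulrC ler_pdivrMr //.
have dx : enorm (x - x0) <= 2 * B.2.
  have := ler_enorm_dist x B.1 x0; rewrite (enormB B.1 x0).
  by have : enorm (x - B.1) <= B.2 by []; have : enorm (x0 - B.1) <= B.2 by []; lra.
pose er := (g x - g x0) - (x - x0) *m jacobian g B.1.
have her k : `|er 0 k| <= d%:R * eta * enorm (x - x0).
  rewrite /er !mxE; have [t t01 e] := mean_value gC1.1 x0 x k.
  have -> : g x 0 k - g x0 0 k - \sum_j (x - x0) 0 j * jacobian g B.1 j k =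
    ((x - x0) *m (jacobian g (x0 + t *: (x - x0)) - jacobian g B.1)) 0 k.
    by rewrite e mulmxBr !mxE.
  apply: row_mul_le => [|l]; first exact: ltW.
  have sB : pball B (x0 + t *: (x - x0)) by apply: segment_pball.
  rewrite mxE [X in _ + X]mxE; apply: hrho; first exact: pball_box.
  by apply: le_trans rr; exact: sB.
have eer : enorm er <= d%:R * (d%:R * eta * (2 * B.2)).
  apply: enorm_le_coord => k; apply: le_trans (her k) _.
  by rewrite ler_wpM2l // mulr_ge0 // ltW.
have dE : dot n (x - x0) = (dot a (g x) + b) - (dot a (g x0) + b) - dot a er.
  have -> : dot n (x - x0) = dot a ((x - x0) *m jacobian g B.1).
    have dotE (u v : 'rV[R]_d) : dot u v = (u *m v^T) 0 0.
      by rewrite mxE; apply: eq_bigr => j _; rewrite mxE.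
    by rewrite !dotE trmx_mul mulmxA.
  by rewrite /er !dotBr; ring.
have e1 : `|dot n (x - x0)| <= 2 * eps + enorm a * (d%:R * (d%:R * eta * (2 * B.2))).
  rewrite dE; apply: le_trans (ler_normB _ _) _; apply: lerD.
    apply: le_trans (ler_normB _ _) _; lra.
  apply: le_trans (cauchy_schwarz _ _) _; rewrite ler_pM2l //.
apply: le_trans e1 _.
have e2 : 2 * eps <= iota * B.2 / 2 * enorm n.
  have eps4 : 4 * k' * eps <= iota * B.2 * enorm a.
    have : 4 * k' * eps <= iota * B.2 * `|a 0 i|.
      move: hs; rewrite ler_pdivrMr ?normr_gt0 // mulrAC ler_pdivrMr //.
      by rewrite [B.2 * _ * _]mulrC mulrA.
    by move=> h; apply: le_trans h _; rewrite ler_wpM2l ?coord_le // mulr_ge0 // ltW.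
  have : 4 * k' * eps <= iota * B.2 * (k' * enorm n).
    by apply: le_trans eps4 _; rewrite ler_wpM2l // mulr_ge0 // ltW.
  rewrite -(ler_pM2l k0); lra.
have e3 : enorm a * (d%:R * (d%:R * eta * (2 * B.2))) <= iota * B.2 / 2 * enorm n.
  have -> : iota * B.2 / 2 * enorm n = (k' * enorm n) * (d%:R * (d%:R * eta * (2 * B.2))).
    by rewrite /eta; field; rewrite !gt_eqF // ltr0n.
  by rewrite ler_wpM2r //; exact: le_trans (enorm_ge0 er) eer.
lra.
Qed.

End Chart.

(** * The winning property *)

Section History.
Context {R : realType} {d n : nat}.
Implicit Types (b : nat -> 'rV[R]_d * R).

Lemma map_hist (phi : 'rV[R]_d -> 'rV[R]_n) b m :
  map (fun B => (phi B.1, B.2)) (hist b m) = hist (fun m => (phi (b m).1, (b m).2)) m.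
Proof. by elim: m => //= m ->. Qed.

Lemma filter_hist0 b (rho : R) m : (forall k, (k <= m)%N -> rho < (b k).2) ->
  [seq B <- hist b m | B.2 <= rho] = [::].
Proof.
elim: m => [|m IH] h /=; first by rewrite leNgt h.
by rewrite leNgt h //= IH // => k km; apply: h; exact: leqW.
Qed.

Lemma filter_hist b (rho : R) m0 m : (forall k, (k < m0)%N -> rho < (b k).2) ->
  (forall k, (m0 <= k)%N -> (b k).2 <= rho) ->
  [seq B <- hist b (m0 + m) | B.2 <= rho] = hist (fun m => b (m0 + m)%N) m.
Proof.
move=> h1 h2; elim: m => [|m IH].
  case: m0 h1 h2 => [|m0] h1 h2 /=; first by rewrite h2.
  by rewrite /= !addn0 /= h2 // filter_hist0 // => k km; apply: h1.
have h3 := h2 _ (leqW (leq_addr m m0)).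
by rewrite addnS /= h3 IH addnS.
Qed.

End History.

Section ChartMachine.
Context {R : realType} {d : nat}.
Notation ball := (@ball_pair R d).

Lemma powR_scale (gamma eta r : R) n : 0 < gamma -> 0 <= eta -> 0 <= r ->
  (eta `^ gamma^-1 * (2^-1 `^ gamma^-1) ^+ n * r) `^ gamma = eta * r `^ gamma / 2 ^+ n.
Proof.
move=> g0 eta0 r0.
have half : 0 <= 2^-1 :> R by rewrite invr_ge0.
rewrite !powRM ?mulr_ge0 ?exprn_ge0 ?powR_ge0 // -powRrM mulVf ?gt_eqF // powRr1 //.
rewrite -powR_mulrn ?powR_ge0 // -!powRrM mulrCA mulVf ?gt_eqF // mulr1 powR_mulrn //.
by rewrite exprVn mulrAC.
Qed.

(** The lattice machine runs in the coordinates of positive weight: [rst] restricts to them, and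
    [lft] extends a normal by zeros. It waits for balls of radius at most [rho], where preimages of
    slabs are flat; the filtered history is then the history of the shifted play, which lets the
    guarantees of the machine apply. *)
Lemma chart_machine (beta gamma lam eta : R) (w theta : 'rV[R]_d) f (B0 : ball) :
  (0 < d)%N -> 0 < beta -> beta < 1 -> 0 < gamma -> 0 < lam < 1 -> 0 < eta ->
  weight w -> C1_diffeomorphism f -> 0 < B0.2 ->
  exists Em : seq ball -> nat * nat * nat -> option (set 'rV[R]_d * R),
    (forall B H idx N s, 0 < B.2 -> pball B `<=` pball B0 -> Em (B :: H) idx = Some (N, s) ->
       [/\ 0 < s, s `^ gamma <= eta * B.2 `^ gamma / 2 ^+ (idx.1.1 + idx.1.2 + idx.2) &
        forall B', pball B' `<=` pball B -> 0 < B'.2 -> s <= B'.2 -> flat beta N B']) /\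
    forall b : nat -> ball, b 0 = B0 -> (forall m, 0 < (b m).2) ->
      (forall m, lam * (b m).2 <= (b m.+1).2) -> (forall m, (b m.+1).2 <= 3^-1 * (b m).2) ->
      (forall m m', (m <= m')%N -> pball (b m') `<=` pball (b m)) ->
      (forall e : R, 0 < e -> exists m, (b m).2 <= e) ->
      (forall m idx N s, Em (hist b m) idx = Some (N, s) -> forall m', (m <= m')%N ->
        N `&` pball (b m') !=set0 -> s <= (b m').2) ->
      forall x, (forall m, pball (b m) x) -> (f @` Bad theta w) x.
Proof.
move=> d0 beta0 beta1 gamma0 /[dup] lam01 /andP[lam0 lam1] eta0 [w0 w1] [fC1 [g [fg gf gC1]]] r00.
have iota0 : 0 < @flatness R d beta by exact: flatness_gt0.
have [L L1 hL] := chart_lipschitz gC1 B0.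
have [kap [rho' [kap1 rho'0 hflat]]] := chart_flat gf fC1 gC1 B0 iota0 d0.
pose rho := Num.min rho' 1.
have rho0 : 0 < rho by rewrite lt_min rho'0 ltr01.
have kap0 : 0 < kap by rewrite (lt_le_trans ltr01).
pose A := [pred i | 0 < w 0 i].
pose e (i : 'I_#|A|) : 'I_d := enum_val i.
have e_inj : injective e by exact: enum_val_inj.
have we i : 0 < w 0 (e i) by have := enum_valP i.
have sw : \sum_i w 0 (e i) = 1.
  rewrite -w1 -(big_enum_val (A := A) (fun k => w 0 k)) /= big_mkcond /=.
  apply: eq_bigr => k _; case: ifP => // /negbT; rewrite inE -leNgt => h.
  by apply/eqP; rewrite eq_le h w0.
pose rst (v : 'rV[R]_d) : 'rV[R]_#|A| := \row_i v 0 (e i).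
pose lft (a : 'rV[R]_#|A|) : 'rV[R]_d := \row_k \sum_(i | e i == k) a 0 i.
have dot_lft a v : dot (lft a) v = dot a (rst v).
  rewrite /dot [RHS](partition_big e xpredT) //=; apply: eq_bigr => k _.
  by rewrite mxE mulr_suml; apply: eq_bigr => i /eqP <-; rewrite mxE.
have lft_e a i : lft a 0 (e i) = a 0 i.
  by rewrite mxE (big_pred1 i) // => i'; rewrite /= (inj_eq e_inj).
(* The budget bounds [s ^ gamma], the machine bounds widths: [tau] and [delta] are roots of order
   [gamma], and [kap] accounts for the passage through the chart. *)
pose tau : R := 2^-1 `^ gamma^-1.
have tau01 : 0 < tau < 1.
  rewrite powR_gt0 ?invr_gt0 //=.
  have <- : 1 `^ gamma^-1 = 1 :> R by rewrite powR1.
  apply: gt0_ltr_powR; rewrite ?invr_gt0 ?nnegrE ?invr_ge0 //.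
  by rewrite invf_lt1 // ltr1n.
pose delta := eta `^ gamma^-1 / kap.
have delta0 : 0 < delta by rewrite divr_gt0 // powR_gt0.
(* The first ball of radius at most [rho] is [B0] itself or follows a ball of radius above [rho]. *)
pose rlow := Num.min B0.2 (lam * rho).
have rlow0 : 0 < rlow by rewrite lt_min r00 mulr_gt0.
have [El [El1 El2]] := @lattice_machine R #|A| (fun i => w 0 (e i)) (rst theta) lam L delta tau
  rlow we sw lam01 L1 delta0 tau01 rlow0.
pose y x := rst (g x).
pose phi (B : ball) : 'rV[R]_#|A| * R := (y B.1, B.2).
pose conv (x : 'rV[R]_#|A| * R * 'I_#|A| * R) : set 'rV[R]_d * R :=
  ([set z | `|dot x.1.1.1 (y z) + x.1.1.2| < x.2], kap * x.2 / `|x.1.1.1 0 x.1.2|).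
pose Em (H : seq ball) idx : option (set 'rV[R]_d * R) :=
  if H is B :: _ then
    if B.2 <= rho then omap conv (El (map phi [seq B <- H | B.2 <= rho]) idx) else None
  else None.
exists Em; split.
  move=> B H idx N s B0' sub; rewrite /Em; case: ifP => // Br; rewrite /= Br /=.
  case E : (El _ _) => [x|] //= [<- <-].
  have [x0 hx] := El1 _ (phi B) _ _ (B0' : 0 < (phi B).2) E.
  have a0 : 0 < `|x.1.1.1 0 x.1.2|.
    rewrite lt_def normr_ge0 andbT; apply: contraTneq hx => ->.
    by rewrite !mulr0 -ltNge.
  have s0 : 0 < kap * x.2 / `|x.1.1.1 0 x.1.2| by rewrite divr_gt0 // mulr_gt0.
  split => //.
    rewrite -(powR_scale _ gamma0 (ltW eta0) (ltW B0')).
    have hs : kap * x.2 / `|x.1.1.1 0 x.1.2| <=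
        eta `^ gamma^-1 * tau ^+ (idx.1.1 + idx.1.2 + idx.2) * B.2.
      rewrite ler_pdivrMr //; apply: le_trans (ler_wpM2l (ltW kap0) hx) _.
      by rewrite /delta /= le_eqVlt; apply/orP; left; apply/eqP; field; rewrite gt_eqF.
    apply: ge0_ler_powR; rewrite ?nnegrE ?(ltW gamma0) ?(ltW s0) //.
    exact: le_trans (ltW s0) hs.
  move=> B' sub' B'0 sB'.
  have [||||n [c [n1 hn]]] := hflat (lft x.1.1.1) x.1.1.2 (e x.1.2) x.2 B'.
  - exact: subset_trans sub' sub.
  - rewrite B'0 /=; have := ball_center d0 B'0 sub'; have := enorm_ge0 (B'.1 - B.1).
    by move: Br; rewrite le_min => /andP[]; clear; lra.
  - by rewrite lft_e -normr_gt0.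
  - by rewrite lft_e.
  exists n, c; split => // z hz zB; apply: hn => //.
  by rewrite dot_lft.
move=> b b00 bpos blow bup bnest bshr hrem x hx.
have brad m m' : (m <= m')%N -> (b m').2 <= (b m).2.
  move=> mm'; have := ball_center d0 (bpos m') (bnest _ _ mm').
  by have := enorm_ge0 ((b m').1 - (b m).1); clear; lra.
have bsub m : pball (b m) `<=` pball B0 by rewrite -b00; exact: bnest.
have bcen m : pball B0 (b m).1 by apply: (bsub m); rewrite /pball /eball /= subrr enorm0 ltW.
have [m0 hm0 m0min] : exists2 m0, (b m0).2 <= rho & forall k, (k < m0)%N -> rho < (b k).2.
  have ex : exists m, (b m).2 <= rho := bshr _ rho0.
  exists (ex_minn ex); case: ex_minnP => // m hm mmin k km.
  by rewrite ltNge; apply: contraTN km => hk; rewrite -leqNgt mmin.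
have after k : (m0 <= k)%N -> (b k).2 <= rho by move=> mk; exact: le_trans (brad _ _ mk) hm0.
pose B m := phi (b (m0 + m)%N).
have EmE m idx : Em (hist b (m0 + m)) idx = omap conv (El (hist B m) idx).
  have := filter_hist m m0min after; rewrite /Em.
  case: (hist b (m0 + m)) (histE b (m0 + m)) => // B1 H' [-> _].
  by rewrite after ?leq_addr // => ->; rewrite /phi (map_hist y).
have cen m m' : (m <= m')%N -> enorm ((b m').1 - (b m).1) <= (b m).2.
  move=> mm'; have := ball_center d0 (bpos m') (bnest _ _ mm').
  by have := bpos m'; clear; lra.
have [|||||||c c0 hc] := El2 B _ _ _ _ _ _ (y x).
- by move=> m; exact: bpos.
- by move=> m; rewrite /B addnS; exact: blow.
- move=> m; rewrite /B addnS /=; have := bup (m0 + m)%N; have := bpos (m0 + m)%N.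
  by set u := (b _).2; clear; lra.
- move=> m m' i mm'; rewrite /B /= !mxE.
  apply: le_trans (hL _ _ (bcen _) (bcen _) _) _.
  by apply: ler_wpM2l; [exact: le_trans ler01 L1|apply: cen; rewrite leq_add2l].
- rewrite /B /= addn0; apply/andP; split; last first.
    by apply: le_trans hm0 _; rewrite /rho ge_min lexx orbT.
  rewrite /rlow ge_min; case: (m0) m0min => [|k] kmin; first by rewrite b00 lexx.
  apply/orP; right; apply: le_trans (blow k); rewrite ler_pM2l //.
  by apply/ltW/kmin.
- move=> m idx z Ez m' mm' hz.
  have [z0 hz2] : 0 < z.2 /\ z.2 <= delta * tau ^+ (idx.1.1 + idx.1.2 + idx.2) * ((B m).2 * `|z.1.1.1 0 z.1.2|).
    by move: Ez; rewrite histE => Ez; apply: El1 Ez; exact: bpos.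
  have a0 : 0 < `|z.1.1.1 0 z.1.2|.
    rewrite lt_def normr_ge0 andbT; apply: contraTneq hz2 => ->.
    by rewrite !mulr0 -ltNge.
  have := hrem (m0 + m)%N idx _ _ _ (m0 + m')%N.
  rewrite EmE Ez /= leq_add2l => /(_ _ _ erefl mm') h.
  have : kap * z.2 / `|z.1.1.1 0 z.1.2| <= (b (m0 + m')%N).2.
    apply: h; exists (b (m0 + m')%N).1; split; first by rewrite /=.
    by rewrite /pball /eball /= subrr enorm0 ltW.
  rewrite ler_pdivrMr // => h'; apply: le_trans h'.
  by rewrite ler_peMl // ltW.
- move=> m i; rewrite /B /= !mxE; apply: le_trans (hL _ _ (bcen _) _ _) _.
    by apply: (bsub 0%N); exact: hx.
  by apply: ler_wpM2l; [exact: le_trans ler01 L1|exact: hx].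
exists (g x); last by rewrite gf.
apply: (bad_criterion c0) => q P q0.
have [i hi] := hc q (\row_i P 0 (e i)) q0.
by exists (e i); split; [exact: we|move: hi; rewrite !mxE].
Qed.

End ChartMachine.

Section Main.
Context {R : realType} {d : nat}.
Notation ball := (@ball_pair R d).

Lemma weight_dim (w : 'rV[R]_d) : weight w -> (0 < d)%N.
Proof.
case: d w => // w [_]; rewrite big_ord0 => /eqP; by rewrite eq_sym oner_eq0.
Qed.

Lemma exists_exponent (q lam : R) : 0 < q < 1 -> 0 < lam < 1 ->
  exists2 gamma, 0 < gamma & q <= lam `^ gamma.
Proof.
move=> /andP[q0 q1] /andP[l0 l1].
have lq : ln q < 0 by rewrite ln_lt0 // q0.
have ll : ln lam < 0 by rewrite ln_lt0 // l0.
exists (ln q / ln lam); first by rewrite nmulr_rgt0 // invr_lt0.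
by rewrite /powR gt_eqF // divfK ?lt_eqF // lnK.
Qed.

Theorem winning (w theta : nat -> 'rV[R]_d) (f : nat -> 'rV[R]_d -> 'rV[R]_d) :
  (forall j, weight (w j)) -> (forall j, C1_diffeomorphism (f j)) ->
  hyperplane_absolute_winning (\bigcap_j (f j @` Bad (theta j) (w j))).
Proof.
move=> hw hf; have d0 := weight_dim (hw 0%N).
apply: shrinking_winning => // beta /andP[beta0 beta3] B0 r0.
have beta1 : beta < 1 by apply: lt_trans beta3 _; rewrite invf_lt1 ?ltr1n.
have iota0 : 0 < @flatness R d beta by exact: flatness_gt0.
have iota1 : @flatness R d beta <= 3^-1 by exact: flatness_lt1.
pose lam := @ratio R d beta.
have lam0 : 0 < lam by rewrite mulr_gt0.
have lam1 : lam < 1.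
  apply: le_lt_trans beta1; rewrite /lam /ratio ger_pMr //.
  by apply: le_trans iota1 _; rewrite invf_le1 ?ler1n.
have k0 := @kappa_gt0 R d; have k1 := @kappa_lt1 R d.
have [||gamma gamma0 hgamma] := @exists_exponent (2 * @kappa R d / (@kappa R d + 1)) lam.
- apply/andP; split; first by rewrite divr_gt0 ?mulr_gt0 ?addr_gt0.
  by rewrite ltr_pdivrMr ?addr_gt0 //; lra.
- by rewrite lam0.
have bud0 := @budget_gt0 R d.
(* The 8 turns the weights [2 ^- i] of the three indices into [2 ^- i.+1], whose sums are at most
   1. *)
pose eta j : R := @budget R d / 8 / 2 ^+ j.+1.
have eta0 j : 0 < eta j by apply: divr_gt0; [apply: divr_gt0|rewrite exprn_gt0].
have /choice[Emj hEmj] : forall j, exists Em : seq ball -> nat * nat * nat -> option (set 'rV[R]_d * R),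
    (forall B H idx N s, 0 < B.2 -> pball B `<=` pball B0 -> Em (B :: H) idx = Some (N, s) ->
       [/\ 0 < s, s `^ gamma <= eta j * B.2 `^ gamma / 2 ^+ (idx.1.1 + idx.1.2 + idx.2) &
        forall B', pball B' `<=` pball B -> 0 < B'.2 -> s <= B'.2 -> flat beta N B']) /\
    forall b : nat -> ball, b 0 = B0 -> (forall m, 0 < (b m).2) ->
      (forall m, lam * (b m).2 <= (b m.+1).2) -> (forall m, (b m.+1).2 <= 3^-1 * (b m).2) ->
      (forall m m', (m <= m')%N -> pball (b m') `<=` pball (b m)) ->
      (forall e : R, 0 < e -> exists m, (b m).2 <= e) ->
      (forall m idx N s, Em (hist b m) idx = Some (N, s) -> forall m', (m <= m')%N ->
        N `&` pball (b m') !=set0 -> s <= (b m').2) ->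
      forall x, (forall m, pball (b m) x) -> (f j @` Bad (theta j) (w j)) x.
  by move=> j; apply: chart_machine => //; rewrite lam0.
pose Em (H : seq ball) (k : nat * nat * nat * nat) := Emj k.2 H k.1.
have Em_flat B H i N s : 0 < B.2 -> pball B `<=` pball B0 -> Em (B :: H) i = Some (N, s) ->
    0 < s /\ forall B', pball B' `<=` pball B -> 0 < B'.2 -> s <= B'.2 -> flat beta N B'.
  by move=> B20 sub e; have [s0 _ h] := (hEmj i.2).1 _ _ _ _ _ B20 sub e.
have Em_mass B H : 0 < B.2 -> pball B `<=` pball B0 ->
    (\esum_(i in setT) mass gamma (Em (B :: H) i) <= (@budget R d * B.2 `^ gamma)%:E)%E.
  move=> B20 sub; set c := _ * _.
  have c0 : 0 <= c by rewrite mulr_ge0 ?powR_ge0 // ltW.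
  have p2 n : 0 <= 2 ^+ n :> R by rewrite exprn_ge0.
  apply: le_trans (esum_nat_halves c0).
  apply: le_trans (esum_prod_halves (F := fun p => c / 2 ^+ p.+1) _); last by move=> p; rewrite divr_ge0.
  apply: le_trans (esum_prod_halves (F := fun p : nat * nat => c / 2 ^+ p.1.+1 / 2 ^+ p.2.+1) _);
    last by move=> p; rewrite !divr_ge0.
  apply: le_trans (esum_prod_halves (F := fun p : nat * nat * nat =>
    c / 2 ^+ p.1.1.+1 / 2 ^+ p.1.2.+1 / 2 ^+ p.2.+1) _); last by move=> p; rewrite !divr_ge0.
  apply: le_esum => -[[[p u] k] j] _ /=.
  rewrite /Em /=; case e : (Emj _ _ _) => [[N s]|] /=; last by rewrite lee_fin !divr_ge0.
  have [_ h _] := (hEmj j).1 _ _ _ _ _ B20 sub e; rewrite lee_fin; apply: le_trans h _.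
  rewrite le_eqVlt; apply/orP; left; apply/eqP; rewrite /c /eta /= !exprD !exprS.
  by field; rewrite !expf_neq0.
exists (potential_strategy beta gamma Em); split; first exact: potential_strategy_legal.
move=> B B00 lB shr x hx j _.
have := @potential_play R d _ beta gamma Em B0 d0 beta0 beta1 gamma0 hgamma Em_flat Em_mass B B00 lB shr.
set t := major_time _ _ _ _ _; move=> [t0 tS tr trem].
have tmono m m' : (m <= m')%N -> (t m <= t m')%N.
  by move=> /subnK <-; elim: (m' - m)%N => // k IH; rewrite addSn; apply: leq_trans IH _; exact: ltnW.
have tge m : (m <= t m)%N by elim: m => // m IH; exact: leq_ltn_trans IH (tS m).
have rpos n := bob_gt0 beta0 n lB.
apply: ((hEmj j).2 (B \o t)).
- exact: B00.
- by move=> m; exact: rpos.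
- by move=> m; have /andP[] := tr m.
- move=> m; have /andP[_ h] := tr m; apply: le_trans h _.
  by apply: ler_wpM2r iota1; exact/ltW/rpos.
- by move=> m m' mm'; exact: (bob_nested lB (tmono _ _ mm')).
- move=> e e0; have [m hm] := shr e e0; exists m; apply: le_trans hm.
  have := bob_center d0 beta0 lB (tge m); have := enorm_ge0 ((B (t m)).1 - (B m).1).
  by move=> h1 h2; rewrite -subr_ge0; exact: le_trans h1 h2.
- by move=> m idx N s e m' mm'; apply: (trem m (idx, j)).
- by move=> m; exact: hx.
Qed.

End Main.

(** * Hausdorff measure and dimension *)

Section Hausdorff.
Context {R : realType} {d : nat}.
Implicit Types (A B S : set 'rV[R]_d) (s t delta eps : R).

Lemma diam_pow_ge0 s A : (0 <= diam_pow s A)%E.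
Proof. by rewrite /diam_pow; case: ifP => // _; exact: poweR_ge0. Qed.

Lemma ediam_ge A x y : A x -> A y -> ((enorm (x - y))%:E <= ediam A)%E.
Proof. by move=> Ax Ay; apply: ereal_sup_ubound; exists (x, y). Qed.

Lemma ediam_le A (v : R) : (forall x y, A x -> A y -> enorm (x - y) <= v) ->
  (ediam A <= v%:E)%E.
Proof. by move=> h; apply: ge_ereal_sup => _ [[x y] [/= Ax Ay] <-]; rewrite lee_fin h. Qed.

Lemma ediam_eball c r : (ediam (eball c r : set 'rV[R]_d) <= (2 * r)%:E)%E.
Proof.
apply: ediam_le => x y; rewrite /eball /= => hx hy.
by have := ler_enorm_dist x c y; rewrite (enormB c y); lra.
Qed.

Lemma diam_pow_le s A (v : R) : 0 <= s -> 0 <= v -> (ediam A <= v%:E)%E ->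
  (diam_pow s A <= (v `^ s)%:E)%E.
Proof.
move=> s0 v0 h; rewrite /diam_pow; case: eqP => [_|/eqP/set0P[x Ax]].
  by rewrite lee_fin powR_ge0.
rewrite -poweR_EFin; apply: gt0_ler_poweR => //.
  rewrite in_itv /= leey andbT; apply: le_trans (ediam_ge Ax Ax).
  by rewrite subrr enorm0.
by rewrite in_itv /= leey andbT lee_fin.
Qed.

Lemma hausdorff_content_ge0 s delta S : (0 <= hausdorff_content s delta S)%E.
Proof.
apply: le_ereal_inf_tmp => _ [U _ <-]; apply: nneseries_ge0 => k _ _.
exact: diam_pow_ge0.
Qed.

Lemma hausdorff_measure_ge0 s S : (0 <= hausdorff_measure s S)%E.
Proof.
apply: le_trans (hausdorff_content_ge0 s 1 S) _.
by apply: ereal_sup_ubound; exists 1 => //=.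
Qed.

Lemma hausdorff_contentS s delta A B : A `<=` B ->
  (hausdorff_content s delta A <= hausdorff_content s delta B)%E.
Proof.
move=> AB; apply: le_ereal_inf => _ [U [BU dU] <-]; exists U => //; split => //.
exact: subset_trans BU.
Qed.

Lemma hausdorff_null s S :
  (forall delta eps, 0 < delta -> 0 < eps -> (hausdorff_content s delta S <= eps%:E)%E) ->
  hausdorff_measure s S = 0%E.
Proof.
move=> h; apply/eqP; rewrite eq_le hausdorff_measure_ge0 andbT.
apply: ge_ereal_sup => _ [delta /= d0 <-].
by apply/lee_addgt0Pr => eps e0; rewrite add0e h.
Qed.

Lemma hausdorff_null_cover s S delta eps : hausdorff_measure s S = 0%E ->
  0 < delta -> 0 < eps -> exists U : nat -> set 'rV[R]_d,
    [/\ S `<=` \bigcup_k U k, forall k, (ediam (U k) <= delta%:E)%E &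
    (\sum_(0 <= k <oo) diam_pow s (U k) <= eps%:E)%E].
Proof.
move=> h d0 e0.
have : (hausdorff_content s delta S < eps%:E)%E.
  apply: le_lt_trans (_ : 0 < _)%E; last by rewrite lte_fin.
  by rewrite -h; apply: ereal_sup_ubound; exists delta.
by move=> /ereal_inf_lt[_ [U [SU dU] <-] hU]; exists U; split => //; exact: ltW.
Qed.

Lemma hausdorff_measure0S s A B : A `<=` B -> hausdorff_measure s B = 0%E ->
  hausdorff_measure s A = 0%E.
Proof.
move=> AB h; apply: hausdorff_null => delta eps d0 e0.
apply: le_trans (hausdorff_contentS _ _ AB) _.
apply: (@le_trans _ _ 0%E); last by rewrite lee_fin ltW.
by rewrite -h; apply: ereal_sup_ubound; exists delta.
Qed.

Lemma hausdorff_dimS A B : A `<=` B -> (hausdorff_dim A <= hausdorff_dim B)%E.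
Proof.
move=> AB; apply: le_ereal_inf => _ [s [s0 h] <-]; exists s => //; split => //.
exact: hausdorff_measure0S AB h.
Qed.

Lemma hausdorff_dim_le (a : R) S : 0 <= a ->
  (forall t, a < t -> hausdorff_measure t S = 0%E) -> (hausdorff_dim S <= a%:E)%E.
Proof.
move=> a0 h; apply/lee_addgt0Pr => e e0; rewrite -EFinD.
apply: ereal_inf_lbound; exists (a + e) => //; split; first by rewrite addr_ge0 // ltW.
by apply: h; rewrite ltrDl.
Qed.

Lemma hausdorff_content_le s delta S (U : nat * nat -> set 'rV[R]_d) :
  S `<=` \bigcup_i U i -> (forall i, (ediam (U i) <= delta%:E)%E) ->
  (hausdorff_content s delta S <= \esum_(i in setT) diam_pow s (U i))%E.
Proof.
move=> SU dU.
have /card_esym/ppcard_eqP[f] := card_nat2.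
have -> : (\esum_(i in [set: nat * nat]) diam_pow s (U i) =
    \sum_(0 <= k <oo) diam_pow s (U (f k)))%E.
  rewrite -(esum_pred_image (fun i => diam_pow s (U i)) _ xpredT) ?[fun=> _]set_true//.
    congr esum; apply/esym; rewrite eqEsubset; split => // x _.
    by exists (f^-1%FUN x) => //; rewrite invK ?inE.
  by move=> *; exact: diam_pow_ge0.
apply: ereal_inf_lbound; exists (U \o f) => //; split => [x /SU[i _ Ux]|k]; last exact: dU.
by exists (f^-1%FUN i) => //=; rewrite invK ?inE.
Qed.

End Hausdorff.

(** * Ahlfors regular and absolutely decaying measures *)

Section Topology.
Context {R : realType} {d : nat}.
Implicit Types (x y c : 'rV[R]_d).

Lemma enorm_lip_continuous (f : 'rV[R]_d -> R) (k : R) : 0 <= k ->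
  (forall x y, `|f x - f y| <= k * enorm (x - y)) -> continuous f.
Proof.
move=> k0 h x; apply: (cvgrPdist_le (FF := nbhs_filter x) _ _).2 => e e0; apply/nbhs_ballP.
have k1 : 0 < k * d%:R + 1 by rewrite ltr_wpDl // mulr_ge0.
exists (e / (k * d%:R + 1)); first by rewrite /= divr_gt0.
move=> y; rewrite -ball_normE /= => xy.
apply: le_trans (h x y) _.
have : enorm (x - y) <= d%:R * (e / (k * d%:R + 1)).
  by apply: enorm_le_coord => i; apply: le_trans (entry_le_norm _ _ _) _; exact: ltW.
move=> h1; apply: le_trans (ler_wpM2l k0 h1) _.
have -> : k * (d%:R * (e / (k * d%:R + 1))) = (k * d%:R * e) / (k * d%:R + 1) by ring.
by rewrite ler_pdivrMr //; lra.
Qed.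

Lemma continuous_enormB c : continuous (fun x => enorm (x - c)).
Proof.
apply: (@enorm_lip_continuous _ 1) => // x y; rewrite mul1r ler_norml.
have := ler_enorm_dist x y c; have := ler_enorm_dist y x c; rewrite (enormB y x).
by move=> h1 h2; apply/andP; split; lra.
Qed.

Lemma closed_eball c r : closed (eball c r : set 'rV[R]_d).
Proof.
have -> : eball c r = (fun x => enorm (x - c)) @^-1` [set t | t <= r] by [].
by apply: preimage_closed; [move=> x _; exact: continuous_enormB|exact: closed_le].
Qed.

Lemma closed_far c r : closed [set x : 'rV[R]_d | r <= enorm (x - c)].
Proof.
have -> : [set x : 'rV[R]_d | r <= enorm (x - c)] = (fun x => enorm (x - c)) @^-1` [set t | r <= t] by [].
by apply: preimage_closed; [move=> x _; exact: continuous_enormB|exact: closed_ge].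
Qed.

Lemma compact_eball c r : compact (eball c r : set 'rV[R]_d).
Proof.
exact: subclosed_compact (@closed_eball c r) (@box_compact R d c r) (@pball_box R d c r).
Qed.

Definition hdist a b x : R := `|dot a x - b| / enorm a.

Lemma edist_hplane a b x : a != 0 -> edist_set (hplane a b) x = hdist a b x.
Proof.
by move=> a0; apply/le_anti; rewrite edist_hplane_ge // edist_hplane_le.
Qed.

Lemma continuous_hdist a b : continuous (hdist a b).
Proof.
apply: (@enorm_lip_continuous _ 1) => // x y; rewrite /hdist mul1r -mulrBl normrM.
rewrite normfV (ger0_norm (enorm_ge0 a)).
have [a0|a0] := eqVneq (enorm a) 0; first by rewrite a0 invr0 mulr0 enorm_ge0.
have a1 : 0 < enorm a by rewrite lt_def a0 enorm_ge0.
rewrite ler_pdivrMr // mulrC; apply: le_trans (cauchy_schwarz a (x - y)).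
by rewrite dotBr; apply: le_trans (ler_dist_dist _ _) _; rewrite opprB addrA subrK.
Qed.

Lemma closed_hdist_ge a b r : closed [set x | r <= hdist a b x].
Proof.
have -> : [set x | r <= hdist a b x] = hdist a b @^-1` [set t | r <= t] by [].
by apply: preimage_closed; [move=> x _; exact: continuous_hdist|exact: closed_ge].
Qed.

Lemma closed_hdist_le a b r : closed [set x | hdist a b x <= r].
Proof.
have -> : [set x | hdist a b x <= r] = hdist a b @^-1` [set t | t <= r] by [].
by apply: preimage_closed; [move=> x _; exact: continuous_hdist|exact: closed_le].
Qed.

Definition separated (rho : R) (l : seq 'rV[R]_d) : bool :=
  pairwise (fun x y => rho <= enorm (x - y)) l.

Lemma maximal_separated (E : set 'rV[R]_d) (rho : R) (M : nat) : 0 < rho ->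
  (forall l, separated rho l -> (forall x, x \in l -> E x) -> (size l <= M)%N) ->
  exists l, [/\ separated rho l, forall x, x \in l -> E x &
    forall x, E x -> exists2 y, y \in l & enorm (x - y) < rho].
Proof.
move=> rho0 hM.
pose P n := `[< exists l, [/\ separated rho l, forall x, x \in l -> E x & size l = n] >].
have exP : exists n, P n by exists 0%N; apply/asboolP; exists [::].
have leP n : P n -> (n <= M)%N by move=> /asboolP[l [h1 h2 <-]]; exact: hM.
case: (ex_maxnP exP leP) => n /asboolP[l [sl El szl]] nmax.
exists l; split => // x Ex; apply: contrapT => no.
have : P n.+1.
  apply/asboolP; exists (x :: l); split; last by rewrite /= szl.
    rewrite /separated /= -/(separated _ _) sl andbT; apply/allP => y yl.
    by rewrite leNgt; apply/negP => h; apply: no; exists y.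
  by move=> y; rewrite inE => /orP[/eqP->|/El].
by move=> /nmax; rewrite ltnn.
Qed.

End Topology.

Section Measure.
Context {R : realType} {d : nat}.
Variable mu : {measure set (borel_rV R d) -> \bar R}.
Notation bset := (set (borel_rV R d)).
Local Open Scope ereal_scope.

Lemma borel_open (A : set 'rV[R]_d) : open A -> measurable (A : bset).
Proof. exact: sub_sigma_algebra. Qed.

Lemma borel_closed (A : set 'rV[R]_d) : closed A -> measurable (A : bset).
Proof.
move=> cA; rewrite -[A]setCK; apply: measurableC; apply: borel_open.
exact: closed_openC.
Qed.

Lemma borel_eball c r : measurable (eball c r : bset).
Proof. by apply: borel_closed; exact: closed_eball. Qed.

Lemma measure_cover_seq (T : eqType) (l : seq T) (F : T -> bset) (X : bset) : measurable X ->
  (forall i, i \in l -> measurable (F i)) ->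
  (forall x, X x -> exists2 i, i \in l & F i x) -> mu X <= \sum_(i <- l) mu (F i).
Proof.
elim: l X => [|i l IH] X mX mF cov.
  rewrite big_nil (_ : X = set0) ?measure0 // -subset0 => x /cov[].
  by move=> i; rewrite in_nil.
have mi : measurable (F i) by apply: mF; rewrite mem_head.
rewrite big_cons (measureDI _ mX mi) addeC; apply: leeD.
  by apply: le_measure; rewrite ?inE //; do ?[exact: measurableI|exact: subIsetr].
apply: IH; first exact: measurableD.
  by move=> k kl; apply: mF; rewrite inE kl orbT.
move=> x [/cov[k]]; rewrite inE => /orP[/eqP->//|kl Fk _]; by exists k.
Qed.

Lemma measure_pack_seq rho (l : seq 'rV[R]_d) (X : bset) : (0 < rho)%R ->
  separated rho l -> measurable X ->
  (forall y, y \in l -> eball y (rho / 3) `<=` X) ->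
  \sum_(y <- l) mu (eball y (rho / 3)) <= mu X.
Proof.
move=> rho0; elim: l X => [|y l IH] X; first by rewrite big_nil.
rewrite /separated /= -/(separated _ _) => /andP[/allP sy sl] mX sub.
have my := borel_eball y (rho / 3).
rewrite big_cons (measureDI _ mX my) addeC.
rewrite (_ : X `&` eball y (rho / 3) = eball y (rho / 3)); last first.
  by apply/setIidPr; apply: sub; rewrite mem_head.
apply: leeD; last by [].
apply: IH => //; first exact: measurableD.
move=> z zl x zx; split; first by apply: (sub z) => //; rewrite inE zl orbT.
move=> yx; have := sy z zl; rewrite /eball /= in zx yx.
by have := ler_enorm_dist y x z; rewrite (enormB y x); lra.
Qed.

Lemma null_outside_supp (K : set 'rV[R]_d) : compact K -> closed K ->
  (forall x, K x -> ~ supp mu x) -> mu K = 0.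
Proof.
move=> cK clK out.
have /choice[U hU] : forall x, exists U : set 'rV[R]_d, K x ->
    [/\ open U, U x & mu U = 0].
  move=> x; have [Kx|nKx] := pselect (K x); last by exists set0.
  have /existsNP[U /not_implyP[oU /not_implyP[Ux /negP mU]]] := out x Kx.
  by exists U => _; split => //; apply/eqP; rewrite eq_le measure_ge0 andbT leNgt.
move: cK; rewrite compact_cover => /(_ _ K U) [].
- by move=> x /hU[].
- by move=> x Kx; exists x => //; have [] := hU x Kx.
move=> D sD cov; apply/eqP; rewrite eq_le measure_ge0 andbT.
have mD i : i \in finmap.enum_fset D -> measurable (U i : bset) /\ mu (U i) = 0.
  by move=> iD; have [oU _ mU] := hU i (set_mem (sD _ iD)); split => //; exact: borel_open.
apply: le_trans (@measure_cover_seq _ (finmap.enum_fset D) U K _ _ _) _.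
- exact: borel_closed.
- by move=> i iD; have [] := mD i iD.
- by move=> x /cov[i iD Ux]; exists i.
by rewrite big_seq big1 // => i iD; have [] := mD i iD.
Qed.

Lemma supp_closed x : (forall e : R, (0 < e)%R -> exists2 y, supp mu y & (enorm (y - x) <= e)%R) ->
  supp mu x.
Proof.
move=> h U oU Ux.
have := open_nbhs_nbhs (conj oU Ux); move/nbhs_ballP => [e e0 he].
have e20 : (0 < e / 2)%R by rewrite divr_gt0.
have [y sy yx] := h _ e20; apply: sy => //; apply: he.
rewrite -ball_normE /= distrC; apply: le_lt_trans (norm_le_enorm _) _.
by apply: le_lt_trans yx _; rewrite ltr_pdivrMr // ltr_pMr // ltr1n.
Qed.

Lemma packing A alpha r0 c r rho (l : seq 'rV[R]_d) : (0 < A)%R ->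
  (forall x rho, supp mu x -> (0 < rho <= r0)%R ->
      (A^-1 * rho `^ alpha)%:E <= mu (eball x rho) <= (A * rho `^ alpha)%:E) ->
  supp mu c -> (0 < r <= r0)%R -> (0 < rho <= r)%R -> separated rho l ->
  (forall y, y \in l -> supp mu y /\ eball c (r / 2) y) ->
  ((size l)%:R * (rho / 3) `^ alpha <= A ^+ 2 * r `^ alpha)%R.
Proof.
move=> A0 hA sc /andP[r_0 rr0] /andP[rho0 rhor] sl hl.
have rho3 : (0 < rho / 3 <= r0)%R by apply/andP; split; lra.
have h1 : \sum_(y <- l) mu (eball y (rho / 3)) <= mu (eball c r).
  apply: measure_pack_seq => //; first exact: borel_eball.
  move=> y /hl[_]; rewrite /eball /= => h1 x; rewrite /eball /= => h2.
  by have := ler_enorm_dist x y c; lra.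
have h2 : \sum_(y <- l) (A^-1 * (rho / 3) `^ alpha)%:E <= \sum_(y <- l) mu (eball y (rho / 3)).
  rewrite big_seq [leRHS]big_seq; apply: lee_sum => y /hl[sy _].
  by have /andP[] := hA y _ sy rho3.
have /andP[_ h3] : _ <= mu (eball c r) <= _ := hA c r sc (introT andP (conj r_0 rr0)).
have := le_trans h2 (le_trans h1 h3).
rewrite sumEFin lee_fin big_const_seq count_predT iter_addr_0 -[leLHS]mulr_natl.
move=> h; rewrite -(ler_pM2l (_ : 0 < A^-1)%R) ?invr_gt0 //.
have -> : (A^-1 * (A ^+ 2 * r `^ alpha) = A * r `^ alpha)%R by rewrite expr2; field; rewrite gt_eqF.
by rewrite mulrCA.
Qed.

End Measure.

Section Upper.
Context {R : realType} {d : nat}.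
Variable mu : {measure set (borel_rV R d) -> \bar R}.

Lemma esum_initial (f : nat -> \bar R) (n : nat) (v : R) : (forall i, (0 <= f i)%E) ->
  (forall i, (i < n)%N -> (f i <= v%:E)%E) -> (forall i, (n <= i)%N -> f i = 0%E) ->
  (\esum_(i in [set: nat]) f i <= (n%:R * v)%:E)%E.
Proof.
move=> f0 fv fn.
have -> : (\esum_(i in [set: nat]) f i = \esum_(i in `I_n) f i)%E.
  rewrite [RHS]esum_mkcond; apply: eq_esum => i _; case: ifPn => // /negP h.
  by rewrite fn // leqNgt; apply/negP => h'; apply: h; rewrite inE.
rewrite esum_fset; [|exact: finite_II|by move=> i _; exact: f0].
rewrite -fsbig_ord; apply: (@le_trans _ _ (\sum_(i < n) v%:E)%E).
  by apply: lee_sum => i _; exact: fv.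
by rewrite sumEFin sumr_const card_ord mulr_natl.
Qed.

Lemma powR_small (u v : R) : 0 < u -> 0 < v -> exists2 rho, 0 < rho & rho `^ u <= v.
Proof.
move=> u0 v0; exists (v `^ u^-1); first by rewrite powR_gt0.
by rewrite -powRrM mulVf ?gt_eqF // powRr1 // ltW.
Qed.

(** Half-open cubes of side [h], enumerated by [nat] through the countability of integral vectors; a
    number that codes no vector gives the empty set. *)
Definition grid_cell (h : R) (m : nat) : set 'rV[R]_d :=
  if unpickle m is Some z then
    [set x | forall i, (z : 'rV[int]_d) 0 i = Num.floor (x 0 i / h)]
  else set0.

Lemma grid_cell_cover h x : exists m, grid_cell h m x.
Proof.
exists (pickle (\row_i Num.floor (x 0 i / h))); rewrite /grid_cell pickleK /= => i.
by rewrite mxE.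
Qed.

Lemma grid_cell_diam h m x y : 0 < h -> grid_cell h m x -> grid_cell h m y ->
  enorm (x - y) <= d%:R * h.
Proof.
rewrite /grid_cell; case: unpickle => // z h0 /= hx hy.
apply: enorm_le_coord => i; rewrite !mxE.
have := floor_itv (x 0 i / h); have := floor_itv (y 0 i / h).
rewrite -hx -hy => /andP[a1 a2] /andP[b1 b2].
rewrite !intrD in a2 b2; rewrite -[h in leRHS]mul1r -ler_pdivrMr //.
rewrite -[X in _ / X](ger0_norm (ltW h0)) -normfV -normrM mulrBl.
by rewrite ler_norml; apply/andP; split; lra.
Qed.

Lemma separated_bound (A alpha r0 : R) c r rho : 0 < A ->
  (forall x rho, supp mu x -> 0 < rho <= r0 ->
      ((A^-1 * rho `^ alpha)%:E <= mu (eball x rho) <= (A * rho `^ alpha)%:E)%E) ->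
  supp mu c -> 0 < r <= r0 -> 0 < rho <= r -> forall E : set 'rV[R]_d,
  (forall y, E y -> supp mu y /\ eball c (r / 2) y) ->
  exists l, [/\ separated rho l, forall x, x \in l -> E x &
    forall x, E x -> exists2 y, y \in l & enorm (x - y) < rho].
Proof.
move=> A0 hA sc r01 /[dup] rho01 /andP[rho0 _] E hE.
have p0 : 0 < (rho / 3) `^ alpha by rewrite powR_gt0 // divr_gt0.
apply: (@maximal_separated _ _ E rho (Num.bound (A ^+ 2 * r `^ alpha / (rho / 3) `^ alpha))) => //.
move=> l sl lE; have := packing A0 hA sc r01 rho01 sl (fun y yl => hE y (lE y yl)).
rewrite -ler_pdivlMr // => h.
rewrite -(ler_nat R); apply: le_trans h _; apply/ltW/archi_boundP.
by rewrite divr_ge0 ?powR_ge0 // mulr_ge0 ?powR_ge0 // exprn_ge0 // ltW.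
Qed.

(** The support may be unbounded, so it is covered cell by cell, cell [m] receiving the share
    [eps / 2 ^+ m.+1]. The side [h] puts each cell within [r0 / 2] of any of its points; by packing,
    a maximal [rho]-separated set in it costs a constant times [rho ^ (t - alpha)]. *)
Lemma supp_null alpha t : (0 < d)%N -> ahlfors_regular_exp mu alpha -> 0 < t -> alpha < t ->
  hausdorff_measure t (supp mu) = 0%E.
Proof.
move=> d0 [A [r0 [A0 r00 hA]]] t0 alt; apply: hausdorff_null => delta eps del0 eps0.
pose h := r0 / (2 * d%:R).
have dR : 0 < d%:R :> R by rewrite ltr0n.
have h0 : 0 < h by rewrite divr_gt0 // mulr_gt0.
have hd : d%:R * h = r0 / 2 by rewrite /h; field; rewrite gt_eqF.
have /choice[lr hlr] : forall m, exists lr : seq 'rV[R]_d * R,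
   [/\ 0 < lr.2, 2 * lr.2 <= delta,
     forall x, supp mu x -> grid_cell h m x -> exists2 y, y \in lr.1 & enorm (x - y) <= lr.2 &
     (size lr.1)%:R * (2 * lr.2) `^ t <= eps / 2 ^+ m.+1].
  move=> m; have e0 : 0 < eps / 2 ^+ m.+1 by rewrite divr_gt0 // exprn_gt0.
  have [[c [sc cc]]|no] := pselect (exists c, supp mu c /\ grid_cell h m c); last first.
    exists ([::], delta / 2) => /=; split; rewrite ?divr_gt0 //; first by lra.
      by move=> x sx cx; exfalso; apply: no; exists x.
    by rewrite mul0r ltW.
  pose Cst := A ^+ 2 * r0 `^ alpha * 2 `^ t * 3 `^ alpha.
  have C0 : 0 < Cst.
    by rewrite /Cst; do 3?apply: mulr_gt0; rewrite ?exprn_gt0 ?powR_gt0.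
  have ta : 0 < t - alpha by rewrite subr_gt0.
  have [rho1 rho10 hrho1] := powR_small ta (divr_gt0 e0 C0).
  pose rho := Num.min rho1 (Num.min r0 (delta / 2)).
  have rho0 : 0 < rho by rewrite !lt_min rho10 r00 divr_gt0.
  have rhor : rho <= r0 by rewrite /rho !ge_min lexx orbT.
  have rhod : 2 * rho <= delta.
    have : rho <= delta / 2 by rewrite /rho !ge_min lexx !orbT.
    by lra.
  have rho01 : 0 < rho <= r0 by rewrite rho0.
  have r01 : 0 < r0 <= r0 by rewrite r00 lexx.
  have hE y : (supp mu `&` grid_cell h m) y -> supp mu y /\ eball c (r0 / 2) y.
    by move=> [sy cy]; split => //; rewrite /eball /= -hd; exact: grid_cell_diam cy cc.
  have [l [sl lE cov]] := separated_bound A0 hA sc r01 rho01 hE.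
  exists (l, rho) => /=; split => //.
    by move=> x sx cx; have [|y yl xy] := cov x; [split|exists y => //; exact: ltW].
  have pk := packing A0 hA sc r01 rho01 sl (fun y yl => hE y (lE y yl)).
  have ra0 : 0 < rho `^ alpha by rewrite powR_gt0.
  have E1 : (2 * rho) `^ t = 2 `^ t * 3 `^ alpha * rho `^ (t - alpha) * (rho / 3) `^ alpha.
    have e0' : rho `^ alpha = (rho / 3) `^ alpha * 3 `^ alpha.
      by rewrite -powRM ?divr_ge0 ?(ltW rho0) // divfK.
    have e1 : rho `^ t = rho `^ (t - alpha) * rho `^ alpha.
      by rewrite -powRD ?subrK // (gt_eqF rho0) implybT.
    by rewrite powRM ?(ltW rho0) // e1 e0'; ring.
  have mono : rho `^ (t - alpha) <= (eps / 2 ^+ m.+1) / Cst.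
    apply: le_trans hrho1; apply: ge0_ler_powR; rewrite ?nnegrE ?(ltW ta) ?(ltW rho0) ?(ltW rho10) //.
    by rewrite /rho ge_min lexx.
  rewrite E1 mulrCA.
  apply: le_trans (ler_wpM2l _ pk) _.
    by rewrite !mulr_ge0 ?powR_ge0.
  have -> : 2 `^ t * 3 `^ alpha * rho `^ (t - alpha) * (A ^+ 2 * r0 `^ alpha) =
    Cst * rho `^ (t - alpha) by rewrite /Cst; ring.
  by rewrite mulrC -ler_pdivlMr.
pose U (p : nat * nat) := if (p.2 < size (lr p.1).1)%N then
  eball (nth 0 (lr p.1).1 p.2) (lr p.1).2 else set0.
have dU p : (ediam (U p) <= (2 * (lr p.1).2)%:E)%E.
  rewrite /U; case: ifP => _; first exact: ediam_eball.
  by apply: ediam_le.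
apply: le_trans (@hausdorff_content_le R d t delta (supp mu) U _ _) _.
- move=> x sx; have [m cx] := grid_cell_cover h x.
  have [_ _ cov _] := hlr m; have [y yl xy] := cov x sx cx.
  exists (m, index y (lr m).1) => //=; rewrite /U /= index_mem yl nth_index //.
- move=> p; apply: le_trans (dU p) _; rewrite lee_fin.
  by have [_ h2 _ _] := hlr p.1.
have -> : [set: nat * nat] = [set: nat] `*`` (fun=> [set: nat]).
  by rewrite eqEsubset; split => -[a n].
rewrite -(@esum_esum R nat nat setT (fun=> setT) (fun m i => diam_pow t (U (m, i)))); last first.
  by move=> *; exact: diam_pow_ge0.
apply: le_trans (esum_nat_halves (ltW eps0)); apply: le_esum => m _.
have [l0 _ _ hs] := hlr m.
apply: le_trans (esum_initial (n := size (lr m).1) (v := (2 * (lr m).2) `^ t) _ _ _) _.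
- by move=> i; exact: diam_pow_ge0.
- by move=> i _; apply: diam_pow_le (dU (m, i)); [exact: ltW|rewrite mulr_ge0 // ltW].
- by move=> i hi; rewrite /U /= ltnNge hi /diam_pow eqxx.
by rewrite lee_fin.
Qed.

End Upper.

(** * Bob's greedy play against a cover *)

Section Weights.
Context {R : realType} {d : nat}.
Notation ball := (@ball_pair R d).
Variables (U : nat -> set 'rV[R]_d) (u : nat -> R) (s : R).
Hypotheses (u0 : forall k, 0 < u k)
  (Uu : forall k x y, U k x -> U k y -> enorm (x - y) `^ s <= u k) (s0 : 0 < s).

Definition hit k (B : ball) : \bar R :=
  if `[< U k `&` pball B !=set0 >] then (u k)%:E else 0%E.

Definition hit_weight (B : ball) : \bar R := (\esum_(k in [set: nat]) hit k B)%E.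

Lemma hit_ge0 k B : (0 <= hit k B)%E.
Proof. by rewrite /hit; case: ifP => // _; rewrite lee_fin ltW. Qed.

Lemma hit_le k B : (hit k B <= hit_weight B)%E.
Proof.
apply: esum_ge; exists [set k]; first by split => //; exact: finite_set1.
by rewrite fsbig_set1.
Qed.

Lemma hit_weight_le B : (hit_weight B <= \esum_(k in [set: nat]) (u k)%:E)%E.
Proof.
by apply: le_esum => k _; rewrite /hit; case: ifP => // _; rewrite lee_fin ltW.
Qed.

(** Any two points of [U k] are closer than [2 * rho], while balls of radius [rho] about points
    [4 * rho] apart are at distance at least [2 * rho]; so at most one of them is met. *)
Lemma hit_separated k rho (v : R) (l : seq 'rV[R]_d) : 0 < rho -> 4 * rho <= v ->
  u k < (2 * rho) `^ s -> separated v l -> (\sum_(y <- l) hit k (y, rho) <= (u k)%:E)%E.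
Proof.
move=> rho0 rv us; elim: l => [|y l IH]; first by rewrite big_nil lee_fin ltW.
rewrite /separated /= -/(separated _ _) => /andP[/allP sy sl]; rewrite big_cons.
rewrite {1}/hit; case: asboolP => [[p [Up py]]|_]; last by rewrite add0e IH.
rewrite big_seq big1 ?adde0 // => z zl; rewrite /hit asboolF // => -[q [Uq qz]].
have := sy z zl; move: py qz; rewrite /pball /eball /= => py qz yz.
have : 2 * rho <= enorm (p - q).
  have := ler_enorm_dist y p z; have := ler_enorm_dist p q z.
  by rewrite (enormB y p); lra.
move=> pq; move: us; apply/negP; rewrite -leNgt; apply: le_trans (Uu Up Uq).
by apply: ge0_ler_powR; rewrite ?nnegrE ?enorm_ge0 ?mulr_ge0 ?(ltW rho0) ?(ltW s0).
Qed.

Lemma hit_weight_children (B : ball) rho v (l : seq 'rV[R]_d) : 0 < rho -> 4 * rho <= v ->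
  (hit_weight B < ((2 * rho) `^ s)%:E)%E -> separated v l ->
  (forall y, y \in l -> pball (y, rho) `<=` pball B) ->
  (\sum_(y <- l) hit_weight (y, rho) <= hit_weight B)%E.
Proof.
move=> rho0 rv hB sl sub; rewrite -esum_sum; last by move=> *; exact: hit_ge0.
apply: le_esum => k _; rewrite {2}/hit; case: asboolP => [h|h].
  apply: hit_separated sl => //; rewrite -lte_fin; apply: le_lt_trans hB.
  by apply: le_trans (hit_le k B); rewrite /hit asboolT.
rewrite big_seq big1 // => y yl; rewrite /hit asboolF // => -[p [Up py]]; apply: h.
by exists p; split => //; exact: (sub y yl).
Qed.

End Weights.

Section Lower.
Context {R : realType} {d : nat}.
Variable mu : {measure set (borel_rV R d) -> \bar R}.
Notation ball := (@ball_pair R d).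

(* Sets of diameter 0 have no weight in the cover itself, hence the added
   geometric terms that make every u k positive. *)
Lemma weighted_cover (S : set 'rV[R]_d) s s1 eps : 0 <= s -> s < s1 -> 0 < eps ->
  hausdorff_measure s S = 0%E ->
  exists (U : nat -> set 'rV[R]_d) (u : nat -> R), [/\ S `<=` \bigcup_k U k,
    forall k, 0 < u k, forall k x y, U k x -> U k y -> enorm (x - y) `^ s1 <= u k &
    (\esum_(k in [set: nat]) (u k)%:E <= eps%:E)%E].
Proof.
move=> s0 ss1 e0 hS; have e20 : 0 < eps / 2 by rewrite divr_gt0.
have [U [SU dU hU]] := hausdorff_null_cover hS ltr01 e20.
have fin k : diam_pow s (U k) = (fine (diam_pow s (U k)))%:E.
  rewrite fineK // ge0_fin_numE ?diam_pow_ge0 //.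
  by apply: le_lt_trans (diam_pow_le s0 ler01 (dU k)) _; exact: ltry.
have f0 k : 0 <= fine (diam_pow s (U k)) by rewrite fine_ge0 // diam_pow_ge0.
exists U, (fun k => fine (diam_pow s (U k)) + eps / 2 / 2 ^+ k.+1); split => //.
- by move=> k; rewrite ltr_wpDl // divr_gt0 // exprn_gt0.
- move=> k x y Ux Uy.
  have h1 : enorm (x - y) <= 1 by rewrite -lee_fin; exact: le_trans (ediam_ge Ux Uy) (dU k).
  apply: (@le_trans _ _ (fine (diam_pow s (U k)))); last first.
    by rewrite lerDl divr_ge0 ?exprn_ge0 // ltW.
  have [z|nz] := eqVneq (enorm (x - y)) 0.
    by rewrite z powR0 // gt_eqF // (le_lt_trans s0).
  have n0 : 0 < enorm (x - y) by rewrite lt_def nz enorm_ge0.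
  apply: (@le_trans _ _ (enorm (x - y) `^ s)).
    rewrite -[s1](subrK s) powRD ?(gt_eqF n0) ?implybT //.
    rewrite ger_pMl ?powR_gt0 // -(powRr0 (enorm (x - y))).
    have -> : enorm (x - y) `^ 0 = 1 `^ (s1 - s) by rewrite powRr0 powR1.
    by apply: ge0_ler_powR; rewrite ?nnegrE ?subr_ge0 ?(ltW ss1) ?enorm_ge0.
  rewrite -lee_fin -fin /diam_pow ifF; last by apply/negbTE/set0P; exists x.
  rewrite -poweR_EFin; apply: gt0_ler_poweR => //; last exact: ediam_ge.
    by rewrite in_itv /= leey lee_fin enorm_ge0.
  rewrite in_itv /= leey andbT; apply: le_trans (ediam_ge Ux Uy).
  by rewrite lee_fin enorm_ge0.
rewrite (@eq_esum _ _ _ _ (fun k => (diam_pow s (U k) + (eps / 2 / 2 ^+ k.+1)%:E)%E)); last first.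
  by move=> k _; rewrite fin EFinD.
rewrite esumD; last 2 first.
- by move=> *; exact: diam_pow_ge0.
- by move=> k _; rewrite lee_fin divr_ge0 ?exprn_ge0 // ltW.
rewrite (_ : eps%:E = (eps / 2)%:E + (eps / 2)%:E)%E; last by rewrite -EFinD -splitr.
apply: leeD; last exact: esum_nat_halves (ltW e20).
by rewrite -nneseries_esumT // => k; exact: diam_pow_ge0.
Qed.

(** Outside the neighbourhood of the hyperplane, the ball of radius [r / 2] is covered by balls of
    radius [4 * beta * r] about [l] and a compact set off the support, which is null. By decay the
    neighbourhood takes at most half of the mass, so comparing the two Ahlfors bounds counts [l]. *)
Lemma many_children (A alpha D delta r0 beta : R) (a : 'rV[R]_d) b x r (l : seq 'rV[R]_d) :
  0 < A -> 0 < r <= r0 -> 0 < beta <= 8^-1 -> a != 0 -> supp mu x ->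
  (forall x rho, supp mu x -> 0 < rho <= r0 ->
      ((A^-1 * rho `^ alpha)%:E <= mu (eball x rho) <= (A * rho `^ alpha)%:E)%E) ->
  (mu (closed_nbhd (hplane a b) (2 * beta * r) `&` eball x (r / 2)) <=
       (D * ((2 * beta * r) / (r / 2)) `^ delta)%:E * mu (eball x (r / 2)))%E ->
  D * (4 * beta) `^ delta <= 2^-1 ->
  (forall y, y \in l -> supp mu y) ->
  (forall y, supp mu y -> eball x (r / 2) y -> 2 * beta * r <= hdist a b y ->
     exists2 z, z \in l & enorm (y - z) < 4 * beta * r) ->
  1 <= (size l)%:R * (2 * A ^+ 2 * 8 `^ alpha * beta `^ alpha).
Proof.
move=> A0 /andP[r_0 rr0] /andP[b0 b8] a0 sx hA dec hD sl cov.
pose X := eball x (r / 2).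
have r2 : 0 < r / 2 <= r0 by apply/andP; split; lra.
have mX : measurable (X : set (borel_rV R d)) := @borel_eball R d x (r / 2).
pose N := [set z : 'rV[R]_d | hdist a b z <= 2 * beta * r].
have NE : closed_nbhd (hplane a b) (2 * beta * r) = N.
  by apply/seteqP; split => z; rewrite /closed_nbhd /N /= edist_hplane.
have mN : measurable (N : set (borel_rV R d)) by apply: borel_closed; exact: closed_hdist_le.
pose K := X `&` [set z | 2 * beta * r <= hdist a b z] `&`
  \bigcap_(y in [set` l]) [set z | 4 * beta * r <= enorm (z - y)].
have clK : closed K.
  apply: closedI; first by apply: closedI; [exact: closed_eball|exact: closed_hdist_ge].
  by apply: closed_bigI => y _; exact: closed_far.
have muK : mu K = 0%E.
  apply: null_outside_supp => //.
    by apply: (subclosed_compact clK (@compact_eball R d x (r / 2))) => z [[]].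
  move=> z [[Xz hz] fz] sz; have [y yl zy] := cov z sz Xz hz.
  by move: zy; apply/negP; rewrite -leNgt; exact: (fz y).
pose F (o : option 'rV[R]_d) : set (borel_rV R d) := if o is Some y then eball y (4 * beta * r) else K.
have b4 : 0 < 4 * beta * r <= r0.
  apply/andP; split; first by rewrite !mulr_gt0.
  apply: le_trans rr0; rewrite ger_pMl //; lra.
have h1 : (mu (X `\` N) <= \sum_(o <- None :: map Some l) mu (F o))%E.
  apply: measure_cover_seq; first exact: measurableD.
    by move=> [y|] _; [exact: borel_eball|exact: borel_closed].
  move=> z [Xz nz]; have hz : 2 * beta * r <= hdist a b z.
    by rewrite leNgt; apply/negP => h; apply: nz; exact: ltW.
  have [[y yl zy]|no] := pselect (exists2 y, y \in l & enorm (z - y) < 4 * beta * r).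
    by exists (Some y); [rewrite inE /= map_f|exact: ltW].
  exists None; first by rewrite mem_head.
  split => // y /= yl; rewrite leNgt; apply/negP => h; apply: no; by exists y.
rewrite big_cons big_map /= muK add0e in h1.
have h2 : (mu (X `\` N) <= ((size l)%:R * (A * (4 * beta * r) `^ alpha))%:E)%E.
  apply: le_trans h1 _; rewrite big_seq.
  apply: (@le_trans _ _ (\sum_(y <- l | y \in l) (A * (4 * beta * r) `^ alpha)%:E)%E).
    by apply: lee_sum => y /sl sy; have /andP[] := hA y _ sy b4.
  rewrite -big_seq sumEFin big_const_seq count_predT iter_addr_0 lee_fin.
  by rewrite -[leLHS]mulr_natl.
have /andP[m1 m2] := hA x _ sx r2.
have [m mE] : exists m : R, mu X = m%:E.
  exists (fine (mu X)); rewrite fineK // ge0_fin_numE ?measure_ge0 //.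
  exact: le_lt_trans m2 (ltry _).
have h3 : (mu (X `&` N) <= (2^-1 * m)%:E)%E.
  rewrite setIC -NE; apply: le_trans dec _; rewrite -/X mE -EFinM lee_fin.
  apply: ler_wpM2r; first by rewrite -lee_fin -mE measure_ge0.
  have -> : 2 * beta * r / (r / 2) = 4 * beta by field; rewrite gt_eqF.
  exact: hD.
have h4 : m <= (size l)%:R * (A * (4 * beta * r) `^ alpha) + 2^-1 * m.
  by rewrite -lee_fin -mE (measureDI _ mX mN) EFinD; exact: leeD.
rewrite -/X mE lee_fin in m1.
have p0 : 0 < (r / 2) `^ alpha by rewrite powR_gt0 // divr_gt0.
have e1 : (4 * beta * r) `^ alpha = 8 `^ alpha * beta `^ alpha * (r / 2) `^ alpha.
  rewrite -powRM ?(ltW b0) // -powRM ?mulr_ge0 ?divr_ge0 ?(ltW b0) ?(ltW r_0) //.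
  by congr (_ `^ _); field.
rewrite e1 in h4.
have : A^-1 * (r / 2) `^ alpha <= 2 * ((size l)%:R * (A * (8 `^ alpha * beta `^ alpha * (r / 2) `^ alpha))).
  by lra.
have -> : 2 * ((size l)%:R * (A * (8 `^ alpha * beta `^ alpha * (r / 2) `^ alpha))) =
  (2 * ((size l)%:R * (A * (8 `^ alpha * beta `^ alpha)))) * (r / 2) `^ alpha by ring.
rewrite ler_pM2r // -(ler_pM2l A0) mulfV ?gt_eqF // => h; apply: le_trans h _.
by rewrite le_eqVlt; apply/orP; left; apply/eqP; ring.
Qed.

End Lower.

Section Lower.
Context {R : realType} {d : nat}.
Variable mu : {measure set (borel_rV R d) -> \bar R}.
Notation ball := (@ball_pair R d).

(** The threshold is half of [(2 * beta * B.2) ^ s], so every set of the cover that meets [B] meets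
    at most one child, and the weights of the children add up to at most that of [B]. There are at
    least [2 * beta ^ (- s)] children, so one of them keeps below its own threshold. *)
Lemma child_move (A alpha D delta r0 beta s : R) (U : nat -> set 'rV[R]_d) (u : nat -> R)
    (B : ball) H e :
  0 < A -> 0 < B.2 <= r0 -> 0 < beta <= 8^-1 -> 0 < s -> s < alpha -> supp mu B.1 ->
  (forall x rho, supp mu x -> 0 < rho <= r0 ->
      ((A^-1 * rho `^ alpha)%:E <= mu (eball x rho) <= (A * rho `^ alpha)%:E)%E) ->
  (forall x r, supp mu x -> 0 < r <= r0 ->
    forall (H : set 'rV[R]_d) (r' : R), affine_hyperplane H -> 0 < r' ->
      (mu (closed_nbhd H r' `&` eball x r) <= (D * (r' / r) `^ delta)%:E * mu (eball x r))%E) ->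
  D * (4 * beta) `^ delta <= 2^-1 ->
  4 * A ^+ 2 * 8 `^ alpha * beta `^ (alpha - s) <= 1 ->
  (forall k, 0 < u k) -> (forall k x y, U k x -> U k y -> enorm (x - y) `^ s <= u k) ->
  (hit_weight U u B <= ((2 * beta) `^ s / 2 * B.2 `^ s)%:E)%E ->
  affine_hyperplane H -> e <= beta * B.2 ->
  exists B' : ball, [/\ B'.2 = beta * B.2, pball B' `<=` pball B,
    pball B' `&` open_nbhd H e = set0, supp mu B'.1 &
    (hit_weight U u B' <= ((2 * beta) `^ s / 2 * B'.2 `^ s)%:E)%E].
Proof.
case: B => x r /= A0 r01 b08 s0 sa sx hA hdec hD hb u0 Uu hW [a [b [a0 HE]]] he.
have /andP[r_0 rr0] := r01; have /andP[b0 b8] := b08.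
have b1 : beta < 1 by apply: le_lt_trans b8 _; rewrite invf_lt1 ?ltr1n.
pose E := supp mu `&` eball x (r / 2) `&` [set y | 2 * beta * r <= hdist a b y].
have v01 : 0 < 4 * beta * r <= r.
  by apply/andP; split; [rewrite !mulr_gt0|rewrite ger_pMl //; lra].
have [l [sl lE cov]] := @separated_bound R d mu A alpha r0 x r (4 * beta * r) A0 hA sx r01 v01 E
  (fun y Ey => Ey.1).
have r2 : 0 < r / 2 <= r0 by apply/andP; split; lra.
have H' : affine_hyperplane (hplane a b) by exists a, b.
have br0 : 0 < beta * r by rewrite mulr_gt0.
have h2 : 0 < 2 * beta * r by rewrite -mulrA mulr_gt0.
have many : 1 <= (size l)%:R * (2 * A ^+ 2 * 8 `^ alpha * beta `^ alpha).
  apply: (many_children A0 r01 b08 a0 sx hA (hdec x (r / 2) sx r2 _ _ H' h2) hD).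
    by move=> y /lE[[]].
  by move=> y sy yX hy; apply: cov.
have bs0 : 0 < beta `^ s by rewrite powR_gt0.
have many' : 2 <= (size l)%:R * beta `^ s.
  have bE : beta `^ alpha = beta `^ s * beta `^ (alpha - s).
    by rewrite -powRD ?(gt_eqF b0) ?implybT // addrC subrK.
  have : (size l)%:R * beta `^ s * (4 * A ^+ 2 * 8 `^ alpha * beta `^ (alpha - s)) <=
     (size l)%:R * beta `^ s by rewrite ler_piMr // mulr_ge0 // ltW.
  by rewrite bE in many; lra.
have sub y : y \in l -> pball (y, beta * r) `<=` pball (x, r).
  move=> /lE[[_ yx] _]; apply: pball_sub; rewrite /eball /= in yx *; apply: le_trans yx _.
  have : beta * r <= 8^-1 * r by rewrite ler_pM2r.
  by lra.
have dis y : y \in l -> pball (y, beta * r) `&` open_nbhd H e = set0.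
  move=> /lE[_ hy]; rewrite HE; apply: hplane_disjoint => //=.
  rewrite /hdist /= ler_pdivlMr ?enorm_gt0 // in hy; apply: le_trans hy.
  by rewrite ler_pM2r ?enorm_gt0 //; lra.
have lt2 : (hit_weight U u (x, r) < ((2 * (beta * r)) `^ s)%:E)%E.
  have e2 : (2 * (beta * r)) `^ s = (2 * beta) `^ s * r `^ s.
    by rewrite mulrA powRM ?(ltW r_0) ?mulr_ge0 ?(ltW b0).
  apply: le_lt_trans hW _; rewrite lte_fin e2 ltr_pM2r ?powR_gt0 // ltr_pdivrMr // ltr_pMr ?ltr1n //.
  by rewrite powR_gt0 // mulr_gt0.
have [[y yl hy]|no] := pselect (exists2 y, y \in l &
    (hit_weight U u (y, (beta * r)%R) <= ((2 * beta) `^ s / 2 * (beta * r) `^ s)%:E)%E).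
  exists (y, beta * r); split => //=; [exact: (sub y yl)|exact: (dis y yl)|].
  by have [[]] := lE y yl.
exfalso; have := hit_weight_children u0 Uu s0 br0 (v := 4 * beta * r) _ lt2 sl sub.
rewrite mulrA lexx => /(_ isT) hc.
have : (\sum_(y <- l) ((2 * beta) `^ s / 2 * (beta * r) `^ s)%:E <= \sum_(y <- l) hit_weight U u (y, (beta * r)%R))%E.
  rewrite big_seq [leRHS]big_seq; apply: lee_sum => y yl.
  by rewrite leNgt; apply/negP => h; apply: no; exists y => //; exact: ltW.
move=> /le_trans/(_ (le_trans hc hW)).
rewrite sumEFin lee_fin big_const_seq count_predT iter_addr_0 -[leLHS]mulr_natl.
rewrite [(beta * r) `^ s]powRM ?(ltW b0) ?(ltW r_0) //.
set c := (2 * beta) `^ s / 2; set rs := r `^ s.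
have c0 : 0 < c * rs by rewrite mulr_gt0 ?powR_gt0 // divr_gt0 // powR_gt0 // mulr_gt0.
have -> : (size l)%:R * (c * (beta `^ s * rs)) = (size l)%:R * beta `^ s * (c * rs) by ring.
apply/negP; rewrite -ltNge; apply: lt_le_trans (_ : 2 * (c * rs) <= _).
  by rewrite ltr_pMl // ltr1n.
by rewrite ler_pM2r.
Qed.

Lemma winning_supp_null (S : set 'rV[R]_d) (alpha s : R) : (0 < d)%N ->
  hyperplane_absolute_winning S -> ahlfors_regular_exp mu alpha -> absolutely_decaying mu ->
  supp mu !=set0 -> 0 <= s -> hausdorff_measure s (S `&` supp mu) = 0%E -> alpha <= s.
Proof.
move=> d0 hS [A [ra [A0 ra0 hA]]] [D [delta [rd [D0 delta0 rd0 hdec]]]] [x0 sx0] s0 hs.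
rewrite leNgt; apply/negP => sa.
(* Room on both sides: [s < s1] allows positive weights for the cover, and [s1 < alpha] yields
   enough children. *)
pose s1 := (s + alpha) / 2.
have ss1 : s < s1 by rewrite /s1; lra.
have s1a : s1 < alpha by rewrite /s1; lra.
have s10 : 0 < s1 by exact: le_lt_trans ss1.
pose r0 := Num.min ra rd.
have r00 : 0 < r0 by rewrite lt_min ra0.
have hA' x rho : supp mu x -> 0 < rho <= r0 ->
    ((A^-1 * rho `^ alpha)%:E <= mu (eball x rho) <= (A * rho `^ alpha)%:E)%E.
  move=> sx /andP[h1 h2]; apply: hA => //; rewrite h1.
  by apply: le_trans h2 _; rewrite /r0 ge_min lexx.
have hdec' x r : supp mu x -> 0 < r <= r0 ->
    forall (H : set 'rV[R]_d) (r' : R), affine_hyperplane H -> 0 < r' ->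
      (mu (closed_nbhd H r' `&` eball x r) <= (D * (r' / r) `^ delta)%:E * mu (eball x r))%E.
  move=> sx /andP[h1 h2]; apply: hdec => //; rewrite h1.
  by apply: le_trans h2 _; rewrite /r0 ge_min lexx orbT.
have as0 : 0 < alpha - s1 by rewrite subr_gt0.
have k10 : 0 < (2 * D * 4 `^ delta)^-1 by rewrite invr_gt0 !mulr_gt0 ?powR_gt0.
have k20 : 0 < (4 * A ^+ 2 * 8 `^ alpha)^-1 by rewrite invr_gt0 !mulr_gt0 ?powR_gt0 ?exprn_gt0.
have [b1 b10 hb1] := powR_small delta0 k10.
have [b2 b20 hb2] := powR_small as0 k20.
(* [b1] halves the mass near Alice's hyperplane, [b2] gives at least [2 * beta ^ (- s1)] children,
   and 1/8 keeps the children inside the ball and [beta] below 1/3. *)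
pose beta := Num.min b1 (Num.min b2 8^-1).
have beta0 : 0 < beta by rewrite !lt_min b10 b20 invr_gt0 ltr0n.
have beta8 : beta <= 8^-1 by rewrite /beta !ge_min lexx !orbT.
have beta3 : beta < 3^-1 by apply: le_lt_trans beta8 _; rewrite ltf_pV2 ?posrE ?ltr_nat.
have beta1 : beta < 1 by apply: lt_trans beta3 _; rewrite invf_lt1 ?ltr1n.
have hD : D * (4 * beta) `^ delta <= 2^-1.
  rewrite powRM ?(ltW beta0) // mulrA.
  have : beta `^ delta <= (2 * D * 4 `^ delta)^-1.
    apply: le_trans hb1; apply: ge0_ler_powR; rewrite ?nnegrE ?(ltW delta0) ?(ltW beta0) ?(ltW b10) //.
    by rewrite /beta ge_min lexx.
  have D4 : 0 < D * 4 `^ delta by rewrite mulr_gt0 ?powR_gt0.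
  move=> /(ler_wpM2l (ltW D4)) h; apply: le_trans h _.
  rewrite -mulrA invfM mulrCA mulfV ?mulr1 //; exact: lt0r_neq0.
have hb : 4 * A ^+ 2 * 8 `^ alpha * beta `^ (alpha - s1) <= 1.
  have K0 : 0 < 4 * A ^+ 2 * 8 `^ alpha by rewrite -invr_gt0.
  rewrite mulrC -ler_pdivlMr // mul1r; apply: le_trans hb2.
  apply: ge0_ler_powR; rewrite ?nnegrE ?(ltW as0) ?(ltW beta0) ?(ltW b20) //.
  by rewrite /beta !ge_min lexx orbT.
pose c := (2 * beta) `^ s1 / 2.
have c0 : 0 < c by rewrite divr_gt0 // powR_gt0 // mulr_gt0.
have eps0 : 0 < c * r0 `^ s1 by rewrite mulr_gt0 // powR_gt0.
have [U [u [SU u0 Uu sumu]]] := weighted_cover s0 ss1 eps0 hs.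
have [|sigma [al win]] := hS beta; first by rewrite beta0.
have [||B [B00 hB]] := @history_recursion ball
  (fun _ B => [/\ 0 < B.2 <= r0, supp mu B.1 & (hit_weight U u B <= (c * B.2 `^ s1)%:E)%E])
  (fun h B B' => [/\ B'.2 = beta * B.2, pball B' `<=` pball B &
    pball B' `&` open_nbhd (sigma h B).1 (sigma h B).2 = set0]) (x0, r0).
- by split => //=; [rewrite r00 lexx|exact: le_trans (hit_weight_le _ u0 _) sumu].
- move=> h B [r01 sB WB]; have /andP[Bp Br] := r01.
  have [hH /andP[_ he]] := al h B Bp.
  have b08 : 0 < beta <= 8^-1 by rewrite beta0.
  have [B' [e1 e2 e3 e4 e5]] := child_move A0 r01 b08 s10 s1a sB hA' hdec' hD hb u0 Uu WB hH he.
  exists B' => //; split => //; rewrite e1 mulr_gt0 //=.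
  by apply: le_trans Br; rewrite ger_pMl // ltW.
have lB : bob_legal beta sigma B.
  split; first by rewrite B00.
  move=> n; have [_ [e1 e2 e3]] := hB n; rewrite /alice_move.
  by move: e3; case: (sigma _ _) => H e /= e3; split; rewrite ?e1.
have rE n : (B n).2 = r0 * beta ^+ n.
  elim: n => [|n IH]; first by rewrite B00 expr0 mulr1.
  by have [_ [-> _ _]] := hB n; rewrite IH exprS mulrCA.
have [x [Bx Sx]] := win B lB.
have small e : 0 < e -> exists n, (B n).2 <= e.
  move=> e0; have [n hn] := geometric_small (ltW r00) beta0 beta1 e0.
  by exists n; rewrite rE.
have sx : supp mu x.
  apply: supp_closed => e e0; have [n hn] := small e e0.
  have [[_ sB _] _] := hB n; exists (B n).1 => //; rewrite enormB.
  by apply: le_trans hn; exact: (Bx n).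
(* The set [U k] meets every ball of the play, so its fixed weight [u k > 0] stays below a bound
   that tends to 0 with the radius. *)
have [k _ Uk] := SU x (conj Sx sx).
have uc : 0 < u k / 2 / c by apply: divr_gt0 => //; rewrite divr_gt0.
have [e e0 he] := powR_small s10 uc.
have [n hn] := small e e0.
have [[/andP[Bp _] _ WB] _] := hB n.
have := le_trans (hit_le U u k (B n)) WB.
rewrite /hit asboolT; last by exists x; split => //; exact: (Bx n).
rewrite lee_fin; apply/negP; rewrite -ltNge.
apply: (@le_lt_trans _ _ (c * (u k / 2 / c))).
  rewrite ler_pM2l //; apply: le_trans he.
  by apply: ge0_ler_powR; rewrite ?nnegrE ?(ltW s10) ?(ltW Bp) ?(ltW e0).
by rewrite mulrC divfK ?gt_eqF // ltr_pdivrMr // ltr_pMr // ltr1n.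
Qed.

(** Every exponent at which the intersection is null is at least [alpha], and the whole support is
    null at every exponent above it; the dimension of the support need not be computed. *)
Theorem winning_dim (S : set 'rV[R]_d) : (0 < d)%N ->
  hyperplane_absolute_winning S -> ahlfors_regular mu -> absolutely_decaying mu ->
  hausdorff_dim (S `&` supp mu) = hausdorff_dim (supp mu).
Proof.
move=> d0 hS [alpha hA] hdec.
have [sne|] := pselect (supp mu !=set0); last first.
  by move=> /set0P/negP/negPn/eqP ->; rewrite setI0.
apply/le_anti; rewrite (hausdorff_dimS (@subIsetr _ S (supp mu))) /=.
apply: le_ereal_inf_tmp => _ [s [s0 hs] <-].
have as_ := winning_supp_null d0 hS hA hdec sne s0 hs.
apply: hausdorff_dim_le => // t st; apply: (supp_null d0 hA).
  exact: le_lt_trans st.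
exact: le_lt_trans st.
Qed.

End Lower.

Theorem corollary1p1 (R : realType) (d : nat)
    (w : nat -> 'rV[R]_d) (theta : nat -> 'rV[R]_d)
    (f : nat -> 'rV[R]_d -> 'rV[R]_d)
    (hw : forall j, weight (w j))
    (hf : forall j, C1_diffeomorphism (f j)) :
  hyperplane_absolute_winning (\bigcap_j (f j @` Bad (theta j) (w j))) /\
  forall mu : {measure set (borel_rV R d) -> \bar R},
    ahlfors_regular mu -> absolutely_decaying mu ->
    hausdorff_dim ((\bigcap_j (f j @` Bad (theta j) (w j))) `&` supp mu) =
    hausdorff_dim (supp mu).
Proof.
split; first exact: winning.
move=> mu ahl dec; apply: winning_dim ahl dec; first exact: weight_dim (hw 0%N).
exact: winning.
Qed.
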